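(* Let $n$ be an integer such that $14\leq n\leq 20$, $26\leq n\leq 44$ or $n\geq 50$. Let $p\equiv 11 \pmod{12}$ be a prime such that $(n+2)/2\leq p\leq n-3$. Let $r,s$ be integers with $|r|,|s|<p$, such that $r$ generates the multiplicative group $\mathbb{F}_p^*$ and $s(r-1)\equiv -1\pmod p$. Let $k:=2p+4-n$, so that $6\leq k\leq p+1$ and $n\equiv k \pmod 2$. Let $\alpha\in\mathbb{F}_p^*$ be such that $\alpha^3=r$ (such $\alpha$ exists because $\gcd(p-1,3)=1$). Realize $S_n$ as $\operatorname{Sym}(\{-p+k-1,\ldots,p+2\})$, and use $\{1,2,\ldots,p\}$ as representatives of $\mathbb{F}_p$. Define the following words in the symbols $a,g,y$: - $b:=g^3$, $z:=g^{p-1}$; for integers $i,j$, $z(i):=z^{a^i}$ and $d(i,j):=z(i)z(j)^{-1}z(i)$; $h:=(b^2z(1)z(r))^{(p+1)/2}$; $x:=d(0,1)$. - $c(i,j):=a^{-j}(ax)^{j-i}a^i$ for $1\leq i\leq j\leq p-1$; $c(i,p):=z^{(za)^{-2}}c(i,p-2)$ for $1\leq i\leq p-2$; $c(i,p+1):=z^{(za)^{-1}}c(i,p-1)$ for $1\leq i\leq p-1$; $c(i,p+2):=z\,c(i,p)$ for $1\leq i\leq p-2$. - $b_2:=b^{(p-1)/2}$; $c_\bullet:=c(1,\tfrac{p-1}{2})\,c(\tfrac{p+1}{2},p-1)^{-1}$; $v:=(c_\bullet d(1,-1))^{(p-1)/2}$; $t:=vb_2$. - $\tilde a:=z(3)^{z(2)z(1)}$.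 - $c:=c(2,k)t$ if $n$ is odd, and $c:=c(1,k)t$ if $n$ is even. - $d:=c(5,p+2)$. - $e:=zat\,c(3,k+1)^{-1}$ if $n$ is odd, and $e:=zat\,c(2,k+1)^{-1}$ if $n$ is even. - $w$: if $k=p+1$, $w:=t^{yz}$; if $k=p$, $w:=z^{yz^{-1}}z^{yz}$; if $k=p-1$, $w:=z^{aya^{-1}z^{-1}}z^{aya^{-1}z}[d(1,p)t]^{ya^{-1}}$ (square brackets around a single element are just parentheses); if $k\leq p-2$, set $\tilde x:=[d(1,k+2)d(2,k+1)]^{d(1,k+2)^y d(2,k+1)^y}$ and $u:=(za)(za)^y$, and let $w:=(\tilde xu^{-2})^{(p-k)/2}\tilde xu^{p-k}$ if $n$ is odd, and $w:=t^{zay(za)^{-1}}(\tilde xu^{-2})^{(p-k-1)/2}\tilde xu^{p-k-1}$ if $n$ is even. Then $$\bar J:=\langle a,g,y\mid a^p=b^{p-1},\ (a^s)^b=a^{s-1},\ (zz^a)^2=1,\ \tilde a=(\tilde ah)^y,\ c=c^y,\ [d,e^y]=1,\ y=w\rangle\cong S_n,$$ and this 3-generator 7-relator presentation has bit-length $O(\log n)$. An isomorphism $\bar\varphi\colon\bar J\to S_n$ is induced by $$a\mapsto(1,2,\ldots,p),$$ $$g\mapsto(x\mapsto\alpha x: x\in\mathbb{F}_p^* )\,(p,p+1,p+2),$$ $$y\mapsto(-p-1+k,p+2)(-p+k,p+1)\cdots(-1,k+2)(0,k+1).$$ Moreover the words have the following images under $\bar\varphi$: $b\mapsto(x\mapsto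 rx:x\in\mathbb{F}_p^* )$; $z\mapsto(p,p+1,p+2)$; $h\mapsto1$; $z(i)\mapsto(i,p+1,p+2)$ for $1\leq i\leq p$; $d(i,j)\mapsto(i,j)(p+1,p+2)$ for $1\leq i\neq j\leq p$; $x\mapsto(1,p)(p+1,p+2)$; $c(i,j)\mapsto(i,i+1,\ldots,j)(p+1,p+2)^{j-i}$ where defined; $b_2\mapsto(1,p-1)(2,p-2)\cdots(\frac{p-1}2,\frac{p+1}2)$; $c_\bullet\mapsto(1,2,\ldots,\frac{p-1}2)(p-1,p-2,\ldots,\frac{p+1}2)$; $v\mapsto(1,p-1)(2,p-2)\cdots(\frac{p-1}2,\frac{p+1}2)(p+1,p+2)$; $t\mapsto(p+1,p+2)$; $\tilde a\mapsto(1,2,3)$; $c\mapsto(2,\ldots,k)$ if $n$ is odd and $(1,\ldots,k)$ if $n$ is even; $d\mapsto(5,\ldots,p+2)$; $e\mapsto(1,2,k+1,\ldots,p+2)$ if $n$ is odd and $(1,k+1,\ldots,p+2)$ if $n$ is even; for $k\le p-2$, $\tilde x\mapsto(-1,k+2)(0,k+1)$ and $u\mapsto(1,\ldots,p+2)(1,\ldots,k,0,-1,\ldots,-p-1+k)$; and $w$ has the same image as $y$.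
   Context: Conventions: $g^h=h^{-1}gh$ and $[g,h]=g^{-1}h^{-1}gh$. Permutations act on the right and are multiplied left to right, e.g. $(1,2)(2,3)=(1,3,2)$. The notation $(x\mapsto\alpha x: x\in\mathbb{F}_p^* )$ denotes the permutation multiplying the elements of $\mathbb{F}_p^*$, represented by $1,\ldots,p-1$, by $\alpha$ and fixing all other points. A cycle $(i,i+1,\ldots,j)$ with $i=j$ is the identity. The bit-length of a finite presentation is the number of symbols required to write it down, where each generator is a single symbol, each relator is a string of symbols (a group expression in the generators, in which powers, inverses and parentheses may be used), and exponents are written in binary. $O(\log n)$ means bounded by an absolute constant times $\log n$. *)

(* Defs.v *)
From HB Require Import structures.
From mathcomp Require Import all_boot all_order all_algebra all_fingroup all_solvable.
From mathcomp Require Import boolp.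

Set Implicit Arguments.
Unset Strict Implicit.
Unset Printing Implicit Defensive.

Import Order.TTheory GRing.Theory Num.Theory.
Local Open Scope nat_scope.

Inductive expr (X : Type) : Type :=
| EOne
| EGen of X
| EMul of expr X & expr X
| EPow of expr X & int.

Arguments EOne {X}.

Declare Scope expr_scope.
Delimit Scope expr_scope with W.
Bind Scope expr_scope with expr.

(* Only products and powers are primitive: conjugates and commutators are
   abbreviations, so that their expansions are what [esize] counts. *)
Notation "e * f" := (EMul e f) : expr_scope.
Notation "e ^+ m" := (EPow e m%R) : expr_scope.
Notation "e ^-1" := (EPow e (-1)%R) : expr_scope.
Definition econj (X : Type) (e f : expr X) : expr X := (f^-1 * e * f)%W.
Definition ecomm (X : Type) (e f : expr X) : expr X := (e^-1 * f^-1 * e * f)%W.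
Notation "e ^ f" := (econj e f) : expr_scope.

(* The relation e = f, as a relator. *)
Definition erel (X : Type) (e f : expr X) : expr X := (e * f^-1)%W.

(* Number of symbols of an expression: a power costs a pair of parentheses, a
   sign if the exponent is negative, and the binary digits of the exponent. *)
Definition int_size (m : int) : nat := (m < 0)%R + (trunc_log 2 `|m|%N).+1.

Fixpoint esize (X : Type) (e : expr X) : nat :=
  match e with
  | EOne => 1
  | EGen _ => 1
  | EMul e1 e2 => esize e1 + esize e2
  | EPow e1 m => esize e1 + 2 + int_size m
  end.

Definition bitlength (X : finType) (R : seq (expr X)) : nat :=
  #|X| + \sum_(e <- R) esize e.

(* A letter (x, false) stands for x, and (x, true) for its inverse. *)
Definition word (X : Type) : Type := seq (X * bool).

Definition winv (X : Type) (w : word X) : word X :=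
  rev [seq (l.1, ~~ l.2) | l <- w].

Definition wpow (X : Type) (w : word X) (m : int) : word X :=
  match m with
  | Posz n => flatten (nseq n w)
  | Negz n => flatten (nseq n.+1 (winv w))
  end.

Fixpoint word_of (X : Type) (e : expr X) : word X :=
  match e with
  | EOne => [::]
  | EGen x => [:: (x, false)]
  | EMul e1 e2 => word_of e1 ++ word_of e2
  | EPow e1 m => wpow (word_of e1) m
  end.

Section Presentation.

Variables (X : choiceType) (R : seq (expr X)).

(* The congruence on words generated by free cancellation and the relators. *)
Inductive weq : word X -> word X -> Prop :=
| weq_refl w : weq w w
| weq_sym w w' : weq w w' -> weq w' w
| weq_trans w1 w2 w3 : weq w1 w2 -> weq w2 w3 -> weq w1 w3
| weq_free u v x b : weq (u ++ [:: (x, b); (x, ~~ b)] ++ v) (u ++ v)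
| weq_relator u v w :
    w \in [seq word_of e | e <- R] -> weq (u ++ w ++ v) (u ++ v).

Definition weqb : rel (word X) := fun w w' => `[< weq w w' >].

Lemma weqb_refl : reflexive weqb.
Proof. by move=> w; apply/asboolP; exact: weq_refl. Qed.

Lemma weqb_sym : symmetric weqb.
Proof. by move=> w w'; apply/asboolP/asboolP; exact: weq_sym. Qed.

Lemma weqb_trans : transitive weqb.
Proof.
by move=> w2 w1 w3 /asboolP h /asboolP h'; apply/asboolP; exact: weq_trans h'.
Qed.

Canonical weqb_equiv := EquivRel weqb weqb_refl weqb_sym weqb_trans.

Definition presented : Type := {eq_quot weqb}%qT.

HB.instance Definition _ := Choice.on presented.

Definition pclass (w : word X) : presented := \pi_presented%qT w.

Lemma pclassP w w' : reflect (weq w w') (pclass w == pclass w').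
Proof. by rewrite /pclass; unlock; rewrite eqmodE; exact: asboolP. Qed.

Lemma weq_cat u v w w' : weq w w' -> weq (u ++ w ++ v) (u ++ w' ++ v).
Proof.
move=> h; elim: h u v => {w w'} /=.
- by move=> w u v; exact: weq_refl.
- by move=> w w' _ ih u v; exact/weq_sym/ih.
- by move=> w1 w2 w3 _ ih1 _ ih2 u v; exact: weq_trans (ih2 u v).
- move=> u v x b u' v'; rewrite -!catA !(catA u' u).
  exact: weq_free.
- move=> u v w hw u' v'; rewrite -!catA !(catA u' u).
  exact: weq_relator.
Qed.

Lemma weq_cat2 w1 w1' w2 w2' :
  weq w1 w1' -> weq w2 w2' -> weq (w1 ++ w2) (w1' ++ w2').
Proof.
move=> h1 h2; apply: (@weq_trans _ (w1' ++ w2)).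
  exact: (@weq_cat [::] w2).
by have := @weq_cat w1' [::] _ _ h2; rewrite !cats0.
Qed.

Lemma winv_cat (u v : word X) : winv (u ++ v) = winv v ++ winv u.
Proof. by rewrite /winv map_cat rev_cat. Qed.

Lemma winvK : involutive (@winv X).
Proof.
move=> w; rewrite /winv map_rev revK -map_comp -[RHS]map_id.
by apply: eq_map => -[x b] /=; rewrite negbK.
Qed.

Lemma weq_mulV w : weq (w ++ winv w) [::].
Proof.
elim: w => [|[x b] w ih]; first exact: weq_refl.
rewrite -cat1s winv_cat -catA (catA w).
apply: weq_trans (weq_cat [:: (x, b)] (winv [:: (x, b)]) ih) _.
exact: (@weq_free [::] [::] x b).
Qed.

Lemma weq_Vmul w : weq (winv w ++ w) [::].
Proof. by have := weq_mulV (winv w); rewrite winvK. Qed.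

Lemma weq_inv w w' : weq w w' -> weq (winv w) (winv w').
Proof.
move=> h; apply: (@weq_trans _ (winv w ++ w' ++ winv w')).
  apply: weq_sym; have := @weq_cat (winv w) [::] _ _ (weq_mulV w').
  by rewrite !cats0.
rewrite catA; apply: (@weq_trans _ ((winv w ++ w) ++ winv w')).
  by rewrite -!catA; apply: weq_cat; exact: weq_sym.
exact: (@weq_cat [::] _ _ _ (weq_Vmul w)).
Qed.

Definition prepr (g : presented) : word X := generic_quotient.repr g.

Definition pmul (g h : presented) : presented := pclass (prepr g ++ prepr h).
Definition pone : presented := pclass [::].
Definition pinv (g : presented) : presented := pclass (winv (prepr g)).

Lemma pclass_repr g : pclass (prepr g) = g.
Proof. exact: reprK. Qed.

Lemma weq_repr w : weq (prepr (pclass w)) w.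
Proof. by apply/pclassP; rewrite pclass_repr. Qed.

Lemma pmulE w w' : pmul (pclass w) (pclass w') = pclass (w ++ w').
Proof. by apply/eqP/pclassP; apply: weq_cat2; exact: weq_repr. Qed.

Lemma pinvE w : pinv (pclass w) = pclass (winv w).
Proof. by apply/eqP/pclassP; apply: weq_inv; exact: weq_repr. Qed.

Lemma pmulA : associative pmul.
Proof.
move=> g h k; rewrite -(pclass_repr g) -(pclass_repr h) -(pclass_repr k).
by rewrite !pmulE catA.
Qed.

Lemma pmul1 : left_id pone pmul.
Proof. by move=> g; rewrite -(pclass_repr g) pmulE. Qed.

Lemma pmul1r : right_id pone pmul.
Proof. by move=> g; rewrite -(pclass_repr g) pmulE cats0. Qed.

Lemma pmulV : left_inverse pone pinv pmul.
Proof.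
move=> g; rewrite -(pclass_repr g) pinvE pmulE.
by apply/eqP/pclassP; exact: weq_Vmul.
Qed.

Lemma pmulrV : right_inverse pone pinv pmul.
Proof.
move=> g; rewrite -(pclass_repr g) pinvE pmulE.
by apply/eqP/pclassP; exact: weq_mulV.
Qed.

HB.instance Definition _ :=
  isGroup.Build presented pmulA pmul1 pmul1r pmulV pmulrV.

Definition pelt (e : expr X) : presented := pclass (word_of e).

End Presentation.

(* [:: lo; lo + 1; ...; hi], empty if hi < lo *)
Definition irange (lo hi : int) : seq int :=
  match (hi - lo)%R with
  | Posz m => [seq (lo + Posz i)%R | i <- iota 0 m.+1]
  | Negz _ => [::]
  end.

(* The product, from left to right, of the given cycles, as a map on int;
   [next c] fixes the points outside c. *)
Definition cycles (cs : seq (seq int)) (x : int) : int :=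
  foldl (fun y c => next c y) x cs.

(* Multiplication by alpha on 1, ..., p - 1, as representatives of F_p^*. *)
Definition mulF (p : nat) (alpha : 'F_p) (x : int) : int :=
  (if 1 <= x <= p%:Z - 1 then Posz (val (alpha * x%:~R)) else x)%R.

Definition Omega (k p : nat) : finType :=
  seq_sub (irange (- p%:Z + k%:Z - 1)%R (p%:Z + 2)%R).

(* Products of permutations in fingroup are taken from left to right, as here. *)
Definition acts_as (k p : nat) (sigma : {perm Omega k p}) (f : int -> int) :
  Prop := forall x : Omega k p, val (sigma x) = f (val x).

Definition generates_units (p : nat) (r : int) : Prop :=
  exists2 u : {unit 'F_p}, val u = (r%:~R)%R & generator [set: {unit 'F_p}] u.

(* Truncated subtraction is harmless: n <= 2p - 2 wherever this is used. *)
Definition kpar (n p : nat) : nat := 2 * p + 4 - n.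

Section Words.

Local Open Scope expr_scope.

Variables (n p : nat) (r s : int).

Let k := kpar n p.

Definition wa : expr 'I_3 := EGen (@Ordinal 3 0 isT).
Definition wg : expr 'I_3 := EGen (@Ordinal 3 1 isT).
Definition wy : expr 'I_3 := EGen (@Ordinal 3 2 isT).

Definition wb := wg ^+ 3.
Definition wz := wg ^+ p.-1.
Definition wzi (i : int) := wz ^ (wa ^+ i).
Definition wdij (i j : int) := wzi i * (wzi j)^-1 * wzi i.
Definition wh := (wb ^+ 2 * wzi 1 * wzi r) ^+ p.+1./2.
Definition wx := wdij 0 1.

Definition wc_low (i j : int) := wa ^+ (- j) * (wa * wx) ^+ (j - i) * wa ^+ i.
Definition wc_p (i : int) := wz ^ ((wz * wa) ^+ (- 2)) * wc_low i (p%:Z - 2)%R.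
Definition wcij (i j : int) :=
  if (j == p%:Z)%R then wc_p i
  else if (j == p%:Z + 1)%R then wz ^ ((wz * wa)^-1) * wc_low i (p%:Z - 1)%R
  else if (j == p%:Z + 2)%R then wz * wc_p i
  else wc_low i j.

(* The pairs for which c(i,j) is meant to be defined; [wcij] itself is total. *)
Definition wcij_defined (i j : int) : bool :=
  ([|| (1 <= i <= j) && (j <= p%:Z - 1),
       (1 <= i <= p%:Z - 2) && (j == p%:Z),
       (1 <= i <= p%:Z - 1) && (j == p%:Z + 1)
     | (1 <= i <= p%:Z - 2) && (j == p%:Z + 2)])%R.

Definition wb2 := wb ^+ p.-1./2.
Definition wcbul := wcij 1 p.-1./2 * (wcij p.+1./2 p.-1)^-1.
Definition wv := (wcbul * wdij 1 (-1)%R) ^+ p.-1./2.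
Definition wt := wv * wb2.
Definition watil := wzi 3 ^ (wzi 2 * wzi 1).
Definition wc := if odd n then wcij 2 k * wt else wcij 1 k * wt.
Definition wd := wcij 5 (p%:Z + 2)%R.
Definition we :=
  if odd n then wz * wa * wt * (wcij 3 k.+1)^-1
  else wz * wa * wt * (wcij 2 k.+1)^-1.

Definition wxtil :=
  (wdij 1 k.+2 * wdij 2 k.+1) ^ (wdij 1 k.+2 ^ wy * wdij 2 k.+1 ^ wy).
Definition wu := (wz * wa) * (wz * wa) ^ wy.

Definition ww :=
  if k == p.+1 then wt ^ (wy * wz)
  else if k == p then wz ^ (wy * wz^-1) * wz ^ (wy * wz)
  else if k == p.-1 then
    wz ^ (wa * wy * wa^-1 * wz^-1) * wz ^ (wa * wy * wa^-1 * wz)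
      * (wdij 1 p * wt) ^ (wy * wa^-1)
  else if odd n then
    (wxtil * wu ^+ (- 2)) ^+ (p - k)%N./2 * wxtil * wu ^+ (p - k)%N
  else
    wt ^ (wz * wa * wy * (wz * wa)^-1)
      * (wxtil * wu ^+ (- 2)) ^+ (p - k).-1./2 * wxtil * wu ^+ (p - k).-1.

Definition relators : seq (expr 'I_3) :=
  [:: erel (wa ^+ p) (wb ^+ p.-1);
      erel ((wa ^+ s) ^ wb) (wa ^+ (s - 1));
      (wz * wz ^ wa) ^+ 2;
      erel watil ((watil * wh) ^ wy);
      erel wc (wc ^ wy);
      ecomm wd (we ^ wy);
      erel wy ww].

End Words.

(* Main.v *)
(* The permutations assigned to a, g, y satisfy the relations by direct
   computation, so the words act as claimed and induce a homomorphism phi onto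
   S_n.  Conversely, in the presented group the elements z(i) satisfy
   Carmichael's relations (z(i) z(j))^2 = z(i)^3 = 1, so they generate a copy of
   the alternating group on {1,...,p+2}; a acts on it by conjugation as its image
   does, and the relation (a^s)^b = a^(s-1) forces a itself to lie in that copy.
   Adding t gives a copy of Sym({1,...,p+2}) containing a and g.  Since h is trivial
   there, y commutes with the copy of the symmetric group on {1,...,k}, which is
   generated by the images of c and the 3-cycle (1,2,3), and [d, e^y] = 1 yields
   that disjoint transpositions of this copy and of its conjugate by y commute.
   Hence the elements (u,1,4), replaced by the conjugates (u y,1,4)^y when u lies
   outside {1,...,p+2}, again satisfy Carmichael's relations, which gives
   theta : S_n -> J with theta a = a, theta g = g, and theta y = y by the relation
   y = w. *)

From HB Require Import structures.
Require Import Defs.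
From mathcomp Require Import all_boot all_order all_algebra all_fingroup all_solvable.
From mathcomp Require Import all_field zify.
From mathcomp Require boolp.

Set Implicit Arguments.
Unset Strict Implicit.
Unset Printing Implicit Defensive.

Import Order.TTheory GRing.Theory Num.Theory.

(** Where the congruence on $p$ enters: $p \equiv 2 \pmod 3$ makes $p-1$ prime to $3$, so the single
    generator $g$ carries both $b$ (its cube) and $z$; $p \equiv 3 \pmod 4$ makes $(p-1)/2$ odd, so
    $b$ is recovered from $b_2$ and $b^2$. The obstacle in [G] is that $a$ and $b$ are at first
    known only through their conjugation action on the $z(i)$. Moreover $b$ is an odd permutation,
    so only $b^2$ can lie in the alternating copy. The word $h$ measures how far $b^2$ is from lying
    there. It centralises the copy, $h^{(p-1)/2}=1$ holds because $b^{p-1}=1$, and comparing cubes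
    in $\tilde a=(\tilde ah)^y$ gives $h^3=1$; hence $h=1$. Only then can $b^2$ be used to place
    $a$. No map defined on permutations can be told directly where to send the image of $y$. Instead
    [theta] is shown to turn conjugation by that image into conjugation by [gy] on
    $\operatorname{Sym}\{1,\ldots,p+2\}$. This suffices because $w$ contains $y$ only through
    conjugates of words free of $y$. *)

Local Open Scope group_scope.

(** * Carmichael's presentations of alternating and symmetric groups *)

Section CarmichaelRelations.

Variable G : groupType.
Implicit Types a b c : G.

Lemma expg3_sq a : a ^+ 3 = 1 -> a * a = a^-1.
Proof. by move=> a3; apply: (mulgI a); rewrite mulgV -a3 !expgS expg0 mulg1. Qed.

Lemma expg3_sqV a : a ^+ 3 = 1 -> a^-1 * a^-1 = a.
Proof. by move=> a3; rewrite -invgM expg3_sq // invgK. Qed.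

Lemma mulg_inv_swap a b : (a * b) ^+ 2 = 1 -> a * b = b^-1 * a^-1.
Proof. by move=> ab2; rewrite -invgM; apply: (mulgI (a * b)); rewrite mulgV -ab2. Qed.

Lemma expg2_mulgC a b : (a * b) ^+ 2 = 1 -> (b * a) ^+ 2 = 1.
Proof.
move=> ab2; have -> : b * a = (a * b) ^ a by rewrite conjgE mulgA mulKg.
by rewrite -conjXg ab2 conj1g.
Qed.

(** Moves the coset representative $ab^{-1}$ to the right end of $ab^{-1}a$, leaving a factor free
    of [a]. It comes from $b^{-1}=b^2$ and from the fact that $ab$ and $ba$ equal their inverses. *)
Lemma carmichael_conj2 a b : a ^+ 3 = 1 -> b ^+ 3 = 1 -> (a * b) ^+ 2 = 1 ->
  b^-1 * (a * b^-1) = a * (b^-1 * a).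
Proof.
move=> a3 b3 ab2; rewrite -[in RHS](expg3_sq b3) -mulgA.
rewrite (mulg_inv_swap (expg2_mulgC ab2)) !mulgA (mulg_inv_swap ab2).
by rewrite -!mulgA (mulgA a^-1) expg3_sqV.
Qed.

(** The generic Schreier rule: right multiplication by [c] keeps the representative $ab^{-1}$ and
    produces the factor $bc^{-1}b^{-1}$, again free of [a]. *)
Lemma carmichael_conj3 a b c : a ^+ 3 = 1 -> b ^+ 3 = 1 ->
  (a * b) ^+ 2 = 1 -> (a * c) ^+ 2 = 1 -> (b * c) ^+ 2 = 1 ->
  a * (b^-1 * c) = b * (c^-1 * (b^-1 * (a * b^-1))).
Proof.
move=> a3 b3 ab2 ac2 bc2; rewrite carmichael_conj2 //.
have -> : c^-1 * (a * (b^-1 * a)) = a * (c * (a^-1 * (b^-1 * a))).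
  by rewrite -{1}(expg3_sqV a3) !mulgA -(mulg_inv_swap ac2).
have -> : a^-1 * (b^-1 * a) = b * (a * a).
  by rewrite !mulgA -(mulg_inv_swap (expg2_mulgC ab2)).
rewrite (mulgA c) (mulg_inv_swap (expg2_mulgC bc2)) expg3_sq //.
rewrite (mulgA b) (mulg_inv_swap (expg2_mulgC ab2)).
rewrite -!mulgA (mulgA b^-1) expg3_sqV // -(mulg_inv_swap ac2).
by rewrite (mulgA b) (mulg_inv_swap (expg2_mulgC ab2)) !mulgA expg3_sqV.
Qed.

(** Used with [a] and [d] coset representatives, [b] a generator and [c] the correction: it rewrites
    what is left of $wb$ after splitting off [d] in terms of what is left of [w] after splitting off
    [a]. *)
Lemma mulg_shift (w a b c d : G) : a * b = c * d -> w * b * d^-1 = w * a^-1 * c.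
Proof.
move=> abcd; rewrite -!mulgA; congr (_ * _).
by apply: (mulgI a); rewrite !mulgA mulgV mul1g abcd mulgK.
Qed.

End CarmichaelRelations.

Section CosetRepresentatives.

Variables (T : finType) (al be : T).
Hypothesis al_be : al != be.

(** Locked so that simplification does not expose the transpositions. For distinct points it is the
    cycle sending [i] to [j], [j] to [l] and [l] to [i]. *)
Definition cyc3 (i j l : T) : {perm T} := locked (tperm i j * tperm i l).

(** If [x u] is read as the cycle $(u,al,be)$, this element sends [i] to [j], so it represents a
    coset of the stabiliser of [i]. The same formula is used in [G] and in [{perm T}]. *)
Definition coset_rep (G : groupType) (x : T -> G) (i j : T) : G :=
  if j == i then 1 else if j == al then x i else if j == be then (x i)^-1
  else x i * (x j)^-1.

(** The Schreier generators for these representatives. For $j \ne i$ or $l \ne i$ alike, the letter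
    [x i] never occurs, which is what allows recursion on the remaining points. *)
Definition coset_corr (G : groupType) (x : T -> G) (i j l : T) : G :=
  if l == i then if j \in [:: i; al; be] then 1 else (x j)^-1
  else if j == i then x l else if j == al then (x l)^-1
  else if j == be then x l else if j == l then 1
  else x j * (x l)^-1 * (x j)^-1.

Lemma cyc3E i j l u : i != j -> i != l -> j != l ->
  cyc3 i j l u = if u == i then j else if u == j then l else if u == l then i else u.
Proof.
move=> ij il jl; rewrite /cyc3 -lock permM [tperm i j u]permE /=.
have [ui|ui] := eqVneq u i; first by rewrite tpermD // eq_sym.
have [uj|uj] := eqVneq u j; first by rewrite tpermL.
by rewrite permE /= (negPf ui).
Qed.

Lemma cyc3J i j l (s : {perm T}) : cyc3 i j l ^ s = cyc3 (s i) (s j) (s l).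
Proof. by rewrite /cyc3 -!lock conjMg !tpermJ. Qed.

(** Carmichael's relations are exactly what the Schreier rules need, case by case in the positions
    of [j] and [l]. The group is arbitrary so that the rule can also be applied to the 3-cycles
    themselves. *)
Lemma coset_repM (G : groupType) (x : T -> G) (s : seq T) i j l :
    {in i :: s, forall u, [/\ u != al, u != be & x u ^+ 3 = 1]} ->
    {in i :: s &, forall u v, u != v -> (x u * x v) ^+ 2 = 1} ->
    i \notin s -> l \in i :: s -> j \in [:: al, be, i & s] ->
  coset_rep x i j * x l = coset_corr x i j l * coset_rep x i (cyc3 l al be j).
Proof.
move=> xP x2 iNs ls js.
have [lal lbe x3l] := xP _ ls; have [ial ibe x3i] := xP _ (mem_head i s).
have nE (u v : T) : u != v -> ((u == v) = false) * ((v == u) = false).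
  by move=> uv; split; [exact: negPf | rewrite eq_sym; exact: negPf].
have ne := (nE _ _ lal, nE _ _ lbe, nE _ _ ial, nE _ _ ibe, nE _ _ al_be, eqxx).
rewrite cyc3E // /coset_rep /coset_corr !inE.
have [eli|li] := eqVneq l i.
  subst l; have [->|ji] := eqVneq j i; first by rewrite !ne !mul1g.
  have [->|ja] := eqVneq j al; first by rewrite !ne /= mul1g expg3_sq.
  have [->|jb] := eqVneq j be; first by rewrite !ne mulVg mulg1.
  rewrite (negPf ji) (negPf ja) (negPf jb) /=.
  have jS : j \in i :: s by move: js; rewrite !inE (negPf ja) (negPf jb).
  have [_ _ x3j] := xP _ jS.
  by rewrite -!mulgA carmichael_conj2 //; apply: x2; rewrite ?mem_head // eq_sym.
have il2 : (x i * x l) ^+ 2 = 1 by apply: x2; rewrite ?mem_head // eq_sym.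
have [->|ji] := eqVneq j i; first by rewrite (eq_sym i l) (negPf li) !ne mul1g mulg1.
have [->|ja] := eqVneq j al; first by rewrite !ne (mulg_inv_swap il2).
have [->|jb] := eqVneq j be.
  rewrite !ne (negPf li) mulgA (mulg_inv_swap (expg2_mulgC il2)).
  by rewrite -mulgA expg3_sqV.
have [->|jl] := eqVneq j l; first by rewrite !ne mulgVK mul1g.
rewrite (negPf ji) (negPf ja) (negPf jb).
have jS : j \in i :: s by move: js; rewrite !inE (negPf ja) (negPf jb).
have [_ _ x3j] := xP _ jS.
rewrite -!mulgA carmichael_conj3 //; apply: x2 => //; rewrite ?mem_head //.
by rewrite eq_sym.
Qed.

(** The same rule for an involution that inverts every [x u], as the transposition of [al] and [be]
    does with the cycles $(u,al,be)$. *)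
Lemma coset_repT (G : groupType) (x : T -> G) (s : seq T) i j t :
    {in i :: s, forall u, [/\ u != al, u != be & x u ^+ 3 = 1]} ->
    {in i :: s &, forall u v, u != v -> (x u * x v) ^+ 2 = 1} ->
    t ^+ 2 = 1 -> {in i :: s, forall u, x u ^ t = (x u)^-1} ->
    i \notin s -> j \in [:: al, be, i & s] ->
  coset_rep x i j * t = t * (if j \in [:: i; al; be] then 1 else x j)
                        * coset_rep x i (tperm al be j).
Proof.
move=> xP x2 t2 xt iNs js; have [ial ibe x3i] := xP _ (mem_head i s).
have xtC u : u \in i :: s -> x u * t = t * (x u)^-1.
  by move=> us; rewrite conjgC xt.
have xVtC u : u \in i :: s -> (x u)^-1 * t = t * x u.
  by move=> us; rewrite conjgC conjVg xt // invgK.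
have nE (u v : T) : u != v -> ((u == v) = false) * ((v == u) = false).
  by move=> uv; split; [exact: negPf | rewrite eq_sym; exact: negPf].
have ne := (nE _ _ ial, nE _ _ ibe, nE _ _ al_be, eqxx).
rewrite permE /= /coset_rep !inE.
have [->|ji] := eqVneq j i; first by rewrite !ne !mulg1 mul1g.
have [->|ja] := eqVneq j al; first by rewrite !ne mulg1 xtC ?mem_head.
have [->|jb] := eqVneq j be; first by rewrite !ne mulg1 xVtC ?mem_head.
rewrite (negPf ji) (negPf ja) (negPf jb).
have jS : j \in i :: s by move: js; rewrite !inE (negPf ja) (negPf jb).
have [_ _ x3j] := xP _ jS.
have ij2 : (x i * x j) ^+ 2 = 1 by apply: x2; rewrite ?mem_head // eq_sym.
rewrite -mulgA xVtC // mulgA xtC ?mem_head // -!mulgA; congr (t * _).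
rewrite mulgA (mulg_inv_swap (expg2_mulgC ij2)) -mulgA.
by rewrite expg3_sqV.
Qed.

End CosetRepresentatives.

(** A permutation has finite order, so its inverse is one of its positive powers. *)
Lemma perm_expV (T : finType) (P : {perm T} -> Prop) :
  P 1 -> (forall u v, P u -> P v -> P (u * v)) -> forall u, P u -> P u^-1.
Proof.
move=> P1 PM u Pu; rewrite -[u^-1]mul1g -(expg_order u).
have [n ->] : exists n, #[u] = n.+1 by exists #[u].-1; rewrite prednK.
by rewrite expgSr mulgK; elim: n => // n IH; rewrite expgS; exact: PM.
Qed.

Section Carmichael.

Variables (T : finType) (al be : T).
Hypothesis al_be : al != be.
Implicit Types (i j l : T) (s : seq T) (u v : {perm T}).

Local Notation c3 l := (cyc3 l al be).
Local Notation dom s := [set i | i \in [:: al, be & s]].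

Lemma cyc3_on i j l (A : {set T}) : i \in A -> j \in A -> l \in A ->
  perm_on A (cyc3 i j l).
Proof.
move=> iA jA lA; rewrite /cyc3 -lock; apply: perm_onM; apply: subset_trans (tperm_on _ _) _;
by apply/subsetP => u; rewrite !inE => /orP[] /eqP ->.
Qed.

Lemma cyc3_expg3 i j l : i != j -> i != l -> j != l -> cyc3 i j l ^+ 3 = 1.
Proof.
move=> ij il jl; apply/permP => u.
have nE (a b : T) : a != b -> ((a == b) = false) * ((b == a) = false).
  by move=> ab; split; [exact: negPf | rewrite eq_sym; exact: negPf].
have ne := (nE _ _ ij, nE _ _ il, nE _ _ jl, eqxx).
rewrite permX perm1 /= !cyc3E //.
have [->|ui] := eqVneq u i; first by rewrite !ne.
have [->|uj] := eqVneq u j; first by rewrite !ne.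
have [->|ul] := eqVneq u l; first by rewrite !ne.
by do 3!rewrite ?(negPf ui) ?(negPf uj) ?(negPf ul) /=.
Qed.

Lemma cyc3M_expg2 i j : i != j -> i != al -> i != be -> j != al -> j != be ->
  (c3 i * c3 j) ^+ 2 = 1.
Proof.
move=> ij ia ib ja jb; apply/permP => u.
have nE (a b : T) : a != b -> ((a == b) = false) * ((b == a) = false).
  by move=> ab; split; [exact: negPf | rewrite eq_sym; exact: negPf].
have ne := (nE _ _ ij, nE _ _ ia, nE _ _ ib, nE _ _ ja, nE _ _ jb,
            nE _ _ al_be, eqxx).
have cM w : (c3 i * c3 j) w = c3 j (c3 i w) by rewrite permM.
rewrite permX perm1 /= !cM !cyc3E //.
have [->|ui] := eqVneq u i; first by rewrite !ne.
have [->|uj] := eqVneq u j; first by rewrite !ne.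
have [->|ua] := eqVneq u al; first by rewrite !ne.
have [->|ub] := eqVneq u be; first by rewrite !ne.
by do 4!rewrite ?(negPf ui) ?(negPf uj) ?(negPf ua) ?(negPf ub) /=.
Qed.

Local Notation Cp := (@coset_rep T al be {perm T} (fun l : T => c3 l)).

Lemma coset_rep_perm i j : i != al -> i != be -> j != i -> Cp i j i = j.
Proof.
move=> ia ib ji.
have nE (a b : T) : a != b -> ((a == b) = false) * ((b == a) = false).
  by move=> ab; split; [exact: negPf | rewrite eq_sym; exact: negPf].
have ne := (nE _ _ ji, nE _ _ ia, nE _ _ ib, nE _ _ al_be, eqxx).
rewrite /coset_rep !ne.
have [->|ja] := eqVneq j al; first by rewrite cyc3E ?ne.
have [->|jb] := eqVneq j be.
  by apply: (canLR (permK _)); rewrite cyc3E ?ne // eq_sym (negPf ib).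
have -> : (c3 i * (c3 j)^-1) i = (c3 j)^-1 (c3 i i) by rewrite permM.
rewrite cyc3E // eqxx; apply: (canLR (permK _)).
by rewrite cyc3E // eqxx.
Qed.

Lemma coset_rep_on s i j : i \in s -> j \in [:: al, be & s] -> perm_on (dom s) (Cp i j).
Proof.
move=> iS jS.
have c3_on l : l \in s -> perm_on (dom s) (c3 l).
  by move=> ls; apply: cyc3_on; rewrite !inE ?eqxx ?ls ?orbT.
rewrite /coset_rep; have [_|ji] := eqVneq j i; first exact: perm_on1.
have [ja|ja] := eqVneq j al; first exact: c3_on.
have [jb|jb] := eqVneq j be; first by apply: perm_onV; exact: c3_on.
apply: perm_onM; first exact: c3_on.
by apply/perm_onV/c3_on; move: jS; rewrite !inE (negPf ja) (negPf jb).
Qed.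

Lemma uniq_dom_cons i s : uniq [:: al, be, i & s] ->
  [/\ uniq [:: al, be & s], i != al, i != be & i \notin s].
Proof.
move=> /= /and4P[]; rewrite !inE !negb_or => /and3P[-> ai ->] /andP[bi ->] -> ->.
by rewrite eq_sym ai eq_sym bi.
Qed.

Lemma coset_rep_reduce i s u : uniq [:: al, be, i & s] -> perm_on (dom (i :: s)) u ->
  [/\ u i \in [:: al, be, i & s], perm_on (dom (i :: s)) (Cp i (u i))
    & perm_on (dom s) (u * (Cp i (u i))^-1)].
Proof.
move=> /uniq_dom_cons[_ ia ib _] uP.
have ui : u i \in [:: al, be, i & s].
  by have := perm_closed i uP; rewrite !inE eqxx !orbT.
have Con : perm_on (dom (i :: s)) (Cp i (u i)).
  by apply: coset_rep_on => //; rewrite mem_head.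
split=> //; apply/subsetP => w; rewrite inE; apply: contraR => wN.
have [->|wi] := eqVneq w i.
  rewrite permM; have [uii|uii] := eqVneq (u i) i.
    by rewrite uii /coset_rep eqxx invg1 perm1 eqxx.
  by apply/eqP/(canLR (permK _)); rewrite coset_rep_perm.
apply: contraR wN => ne; have := perm_onM uP (perm_onV Con).
by move=> /subsetP /(_ w ne); rewrite !inE (negPf wi).
Qed.

Section Lift.

Variables (G : groupType) (x : T -> G) (t : G).

(** The representative split off moves the first point [i] as [u] does, so the remaining factor
    fixes [i]. When the list is exhausted only [al] and [be] can still move, and the parity decides
    between the two possibilities. *)
Fixpoint carmichael_lift s u : G :=
  if s is i :: s' then
    carmichael_lift s' (u * (Cp i (u i))^-1) * coset_rep al be x i (u i)
  else if odd_perm u then t else 1.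

Definition carmichael_rel (A : {pred T}) : Prop :=
  {in A, forall i, x i ^+ 3 = 1} /\
  {in A &, forall i j, i != j -> (x i * x j) ^+ 2 = 1}.

Local Notation lift := carmichael_lift.

Lemma carmichael_lift1 s : uniq [:: al, be & s] -> lift s 1 = 1.
Proof.
elim: s => [|i s IH] sU /=; first by rewrite odd_perm1.
rewrite perm1 /coset_rep eqxx mulgV mulg1; apply: IH.
by move: sU => /= /and4P[]; rewrite !inE !negb_or => /and3P[-> _ ->] /andP[_ ->] _ ->.
Qed.

(** The rule [coset_repM] holds in [G] and among permutations with the same correction word. Hence
    the representatives on both sides agree, and the correction, a word in the later points, is
    handled by the induction hypothesis. *)
Lemma carmichael_lift_cyc3 s u l : uniq [:: al, be & s] -> carmichael_rel (mem s) ->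
  perm_on (dom s) u -> l \in s -> lift s (u * c3 l) = lift s u * x l.
Proof.
elim: s u l => [//|i s IH] u l sU [x3 x2] uP lS.
have [sU' ia ib iNs] := uniq_dom_cons sU.
have sub_s j : j \in s -> j \in i :: s by move=> js; rewrite inE js orbT.
have {}IH v j : perm_on (dom s) v -> j \in s -> lift s (v * c3 j) = lift s v * x j.
  apply: IH => //; split=> [m /sub_s /x3 //|m m' /sub_s ms /sub_s ms'].
  exact: x2.
have c3_on j : j \in s -> perm_on (dom s) (c3 j).
  by move=> js; apply: cyc3_on; rewrite !inE ?eqxx ?js ?orbT.
have IHV v j : perm_on (dom s) v -> j \in s ->
    lift s (v * (c3 j)^-1) = lift s v * (x j)^-1.
  move=> vP js; apply: (mulIg (x j)); rewrite -IH ?mulgVK //.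
  by apply: perm_onM vP _; apply: perm_onV; exact: c3_on.
have ne j : j \in i :: s -> j != al /\ j != be.
  move=> js; move: sU => /= /and3P[]; rewrite in_cons negb_or => /andP[_ aN] bN _.
  by split; [apply: contraNneq aN => <- | apply: contraNneq bN => <-].
have [jS Con vP] := coset_rep_reduce sU uP.
have xP : {in i :: s, forall j, [/\ j != al, j != be & x j ^+ 3 = 1]}.
  by move=> j js; have [? ?] := ne j js; split=> //; exact: x3.
have cP : {in i :: s, forall j, [/\ j != al, j != be & c3 j ^+ 3 = 1]}.
  by move=> j js; have [? ?] := ne j js; split=> //; exact: cyc3_expg3.
have c2 : {in i :: s &, forall j m, j != m -> (c3 j * c3 m) ^+ 2 = 1}.
  move=> j m js ms jm; have [? ?] := ne j js; have [? ?] := ne m ms.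
  exact: cyc3M_expg2.
rewrite /= permM -[RHS]mulgA (coset_repM al_be xP x2 iNs lS jS) [RHS]mulgA.
congr (_ * _).
rewrite (mulg_shift u (coset_repM al_be cP c2 iNs lS jS)).
move: {+}(u * _) vP => v vP; rewrite /coset_corr.
have lE : l != i -> l \in s by move: lS; rewrite inE => /predU1P[->|//]; rewrite eqxx.
case: (eqVneq l i) => [_|/lE ls].
  case: ifPn => [_|]; first by rewrite !mulg1.
  rewrite !inE !negb_or => /and3P[ji ja jb]; apply: IHV => //.
  by move: jS; rewrite !inE (negPf ji) (negPf ja) (negPf jb).
case: ifPn => [_|ji]; first exact: IH.
case: ifPn => [_|ja]; first exact: IHV.
case: ifPn => [_|jb]; first exact: IH.
case: ifPn => [_|jl]; first by rewrite !mulg1.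
have js : u i \in s by move: jS; rewrite !inE (negPf ji) (negPf ja) (negPf jb).
by rewrite !mulgA !IHV ?IH //; repeat apply: perm_onM => //; repeat apply: perm_onV; auto.
Qed.

Lemma carmichael_lift_tperm s u : uniq [:: al, be & s] -> carmichael_rel (mem s) ->
    t ^+ 2 = 1 -> {in s, forall i, x i ^ t = (x i)^-1} ->
  perm_on (dom s) u -> lift s (u * tperm al be) = lift s u * t.
Proof.
move=> + + t2; elim: s u => [|i s IH] u sU [x3 x2] xt uP.
  rewrite /= odd_permM odd_tperm al_be.
  by case: odd_perm; rewrite /= ?mul1g // -expg2 t2.
have [sU' ia ib iNs] := uniq_dom_cons sU.
have sub_s j : j \in s -> j \in i :: s by move=> js; rewrite inE js orbT.
have xR : carmichael_rel (mem s).
  by split=> [m /sub_s /x3 //|m m' /sub_s ms /sub_s ms']; exact: x2.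
have {}IH v : perm_on (dom s) v -> lift s (v * tperm al be) = lift s v * t.
  by apply: IH => // j /sub_s /xt.
have t_on : perm_on (dom s) (tperm al be).
  apply: subset_trans (tperm_on _ _) _.
  by apply/subsetP => w; rewrite !inE => /orP[] ->; rewrite ?orbT.
have ne j : j \in i :: s -> j != al /\ j != be.
  move=> js; move: sU => /= /and3P[]; rewrite in_cons negb_or => /andP[_ aN] bN _.
  by split; [apply: contraNneq aN => <- | apply: contraNneq bN => <-].
have [jS Con vP] := coset_rep_reduce sU uP.
have xP : {in i :: s, forall j, [/\ j != al, j != be & x j ^+ 3 = 1]}.
  by move=> j js; have [? ?] := ne j js; split=> //; exact: x3.
have cP : {in i :: s, forall j, [/\ j != al, j != be & c3 j ^+ 3 = 1]}.
  by move=> j js; have [? ?] := ne j js; split=> //; exact: cyc3_expg3.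
have c2 : {in i :: s &, forall j m, j != m -> (c3 j * c3 m) ^+ 2 = 1}.
  move=> j m js ms jm; have [? ?] := ne j js; have [? ?] := ne m ms.
  exact: cyc3M_expg2.
have ct : {in i :: s, forall j, c3 j ^ tperm al be = (c3 j)^-1}.
  move=> j js; have [ja jb] := ne j js.
  by rewrite cyc3J tpermL tpermR tpermD 1?eq_sym // /cyc3 -!lock invgM !tpermV.
rewrite /= permM -[RHS]mulgA (coset_repT al_be xP x2 t2 xt iNs jS) [RHS]mulgA.
congr (_ * _).
have tt2 : tperm al be ^+ 2 = 1 by rewrite expg2 tperm2.
rewrite (mulg_shift u (coset_repT al_be cP c2 tt2 ct iNs jS)) mulgA.
move: {+}(u * _) vP => v vP.
case: ifPn => [_|]; first by rewrite !mulg1 IH.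
rewrite !inE !negb_or => /and3P[ji ja jb].
have js : u i \in s by move: jS; rewrite !inE (negPf ji) (negPf ja) (negPf jb).
rewrite carmichael_lift_cyc3 // ?IH ?mulgA //.
exact: perm_onM.
Qed.

End Lift.

Lemma perm_on_pair u : perm_on [set al; be] u -> u = tperm al be ^+ odd_perm u.
Proof.
move=> uP; have ua : u al \in [set al; be] by rewrite perm_closed // !inE eqxx.
have ub : u be \in [set al; be] by rewrite perm_closed // !inE eqxx orbT.
suff [->|->] : u = 1 \/ u = tperm al be.
- by rewrite odd_perm1.
- by rewrite odd_tperm al_be.
have ne : u al != u be by rewrite (inj_eq perm_inj).
move: ua ub ne; rewrite !inE => /orP[]/eqP ea /orP[]/eqP eb; rewrite ea eb ?eqxx // => _.
  left; apply/permP => w; rewrite perm1; have [->//|wa] := eqVneq w al.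
  by have [->//|wb] := eqVneq w be; rewrite (out_perm uP) // !inE negb_or wa.
right; apply/permP => w; rewrite permE /=; have [->//|wa] := eqVneq w al.
by have [->//|wb] := eqVneq w be; rewrite (out_perm uP) // !inE negb_or wa.
Qed.

Lemma odd_cyc3 i j l : i != j -> i != l -> odd_perm (cyc3 i j l) = false.
Proof. by move=> ij il; rewrite /cyc3 -lock odd_permM !odd_tperm ij il. Qed.

(** Follows the factorisation behind [carmichael_lift]. All representatives are even, so the factor
    left at the end is the power of [tperm al be] given by the parity of [u]; inverses of 3-cycles
    are obtained as squares. *)
Lemma perm_word (P : {perm T} -> Prop) s : uniq [:: al, be & s] ->
    (forall u i, i \in s -> P u -> P (u * c3 i)) ->
  forall u, perm_on (dom s) u -> P (tperm al be ^+ odd_perm u) -> P u.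
Proof.
elim: s => [|i s IH] sU PM u uP.
  rewrite -perm_on_pair //; apply: subset_trans uP _.
  by apply/subsetP => w; rewrite !inE.
have [sU' ia ib iNs] := uniq_dom_cons sU.
have [jS Con vP] := coset_rep_reduce sU uP.
have ne j : j \in i :: s -> j != al /\ j != be.
  move=> js; move: sU => /= /and3P[]; rewrite in_cons negb_or => /andP[_ aN] bN _.
  by split; [apply: contraNneq aN => <- | apply: contraNneq bN => <-].
have PV v j : j \in i :: s -> P v -> P (v * (c3 j)^-1).
  move=> js Pv; have [ja jb] := ne j js.
  by rewrite -(expg3_sq (cyc3_expg3 ja jb al_be)) mulgA; apply: (PM) => //; apply: (PM).
set C := Cp i (u i) in Con vP.
have oddC : odd_perm C = false.
  rewrite /C /coset_rep; case: eqP => _; first by rewrite odd_perm1.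
  case: eqP => ua; first by rewrite odd_cyc3.
  case: eqP => ub; first by rewrite odd_permV odd_cyc3.
  rewrite odd_permM odd_permV !odd_cyc3 //; by apply/eqP.
move=> Pu; have: P (u * C^-1).
  apply: IH => // [v j js|]; first by apply: PM; rewrite inE js orbT.
  by rewrite odd_permM odd_permV oddC addbF.
rewrite -[u in X in _ -> X](mulgVK C).
move: (u * C^-1) => v Pv; rewrite /C /coset_rep.
case: eqP => [_|ui]; first by rewrite mulg1.
case: eqP => ua; first by apply: PM; rewrite ?mem_head.
case: eqP => ub; first by apply: PV; rewrite ?mem_head.
rewrite mulgA; apply: PV; last by apply: PM; rewrite ?mem_head.
by move: jS; rewrite !inE => /or4P[/eqP|/eqP|/eqP|->] //; rewrite orbT.
Qed.

Variable A : {set T}.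
Hypotheses (alA : al \in A) (beA : be \in A).

Local Notation s0 := (enum (A :\ al :\ be)).

Lemma uniq_s0 : uniq [:: al, be & s0].
Proof.
by rewrite /= enum_uniq !inE !mem_enum !inE (negPf al_be) eqxx !andbF !andbT /= eqxx.
Qed.

Lemma dom_s0 : dom s0 = A.
Proof.
apply/setP => w; rewrite !inE mem_enum !inE.
have [->|] := eqVneq w al; first by rewrite alA.
by have [->|] := eqVneq w be; first by rewrite beA.
Qed.

Lemma alt_ind (P : {perm T} -> Prop) : P 1 ->
    (forall u i, i \in A -> i != al -> i != be -> P u -> P (u * c3 i)) ->
  forall u, perm_on A u -> ~~ odd_perm u -> P u.
Proof.
move=> P1 PM u uA /negPf uE; apply: (perm_word uniq_s0); last by rewrite uE.
  by move=> v i; rewrite mem_enum !inE => /and3P[ib ia iA]; exact: PM.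
by rewrite dom_s0.
Qed.

Lemma sym_ind (P : {perm T} -> Prop) : P 1 ->
    (forall u i, i \in A -> i != al -> i != be -> P u -> P (u * c3 i)) ->
    (forall u, P u -> P (u * tperm al be)) ->
  forall u, perm_on A u -> P u.
Proof.
move=> P1 PM Pt u uA; apply: (perm_word uniq_s0).
- by move=> v i; rewrite mem_enum !inE => /and3P[ib ia iA]; exact: PM.
- by rewrite dom_s0.
by case: odd_perm => //; rewrite expg1 -[tperm al be]mul1g; exact: Pt.
Qed.

Variables (G : groupType) (x : T -> G).
Hypothesis x3 : forall i, i \in A -> i != al -> i != be -> x i ^+ 3 = 1.
Hypothesis x2 : forall i j, i \in A -> i != al -> i != be ->
  j \in A -> j != al -> j != be -> i != j -> (x i * x j) ^+ 2 = 1.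

Lemma carmichael_rel_s0 : carmichael_rel x (mem s0).
Proof.
split=> [i|i j] /=; rewrite !mem_enum !inE; first by case/and3P=> ? ? ?; exact: x3.
by case/and3P=> ? ? ? /and3P[? ? ?]; exact: x2.
Qed.

Lemma c3_on i : i \in A -> perm_on A (c3 i).
Proof. by move=> iA; apply: cyc3_on. Qed.

(** [F] is a total function whose recursion discards a final transposition. It is therefore
    multiplicative only against an even right factor, which is a product of the 3-cycles. *)
Theorem carmichael_alt : exists F : {perm T} -> G,
  (forall i, i \in A -> i != al -> i != be -> F (c3 i) = x i) /\
  (forall u v, perm_on A u -> perm_on A v -> ~~ odd_perm v -> F (u * v) = F u * F v).
Proof.
pose F := carmichael_lift x 1 s0; exists F.
have F1 : F 1 = 1 by exact: carmichael_lift1 uniq_s0.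
have FM u i : perm_on A u -> i \in A -> i != al -> i != be -> F (u * c3 i) = F u * x i.
  move=> uA iA ia ib; apply: carmichael_lift_cyc3 uniq_s0 carmichael_rel_s0 _ _.
    by rewrite dom_s0.
  by rewrite mem_enum !inE ia ib.
have Fx i : i \in A -> i != al -> i != be -> F (c3 i) = x i.
  by move=> iA ia ib; rewrite -[c3 i]mul1g FM ?F1 ?mul1g // perm_on1.
split=> // u v uA vA vE; suff [] : perm_on A v /\ F (u * v) = F u * F v by [].
move: v vA vE; apply: alt_ind => [|v i iA ia ib [vA FuV]].
  by rewrite perm_on1 F1 !mulg1.
split; first exact: perm_onM (c3_on iA).
by rewrite mulgA !FM ?FuV ?mulgA // perm_onM.
Qed.

Theorem carmichael_sym (t : G) : t ^+ 2 = 1 ->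
    (forall i, i \in A -> i != al -> i != be -> x i ^ t = (x i)^-1) ->
  exists F : {perm T} -> G,
  [/\ forall i, i \in A -> i != al -> i != be -> F (c3 i) = x i,
      F (tperm al be) = t &
      forall u v, perm_on A u -> perm_on A v -> F (u * v) = F u * F v].
Proof.
move=> t2 xt; pose F := carmichael_lift x t s0; exists F.
have F1 : F 1 = 1 by exact: carmichael_lift1 uniq_s0.
have FM u i : perm_on A u -> i \in A -> i != al -> i != be -> F (u * c3 i) = F u * x i.
  move=> uA iA ia ib; apply: carmichael_lift_cyc3 uniq_s0 carmichael_rel_s0 _ _.
    by rewrite dom_s0.
  by rewrite mem_enum !inE ia ib.
have FT u : perm_on A u -> F (u * tperm al be) = F u * t.
  move=> uA; apply: carmichael_lift_tperm uniq_s0 carmichael_rel_s0 t2 _ _.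
    by move=> i; rewrite mem_enum !inE => /and3P[? ? ?]; exact: xt.
  by rewrite dom_s0.
have t_on : perm_on A (tperm al be).
  apply: subset_trans (tperm_on _ _) _.
  by apply/subsetP => w; rewrite !inE => /orP[] /eqP ->.
have Fx i : i \in A -> i != al -> i != be -> F (c3 i) = x i.
  by move=> iA ia ib; rewrite -[c3 i]mul1g FM ?F1 ?mul1g // perm_on1.
have Ft : F (tperm al be) = t by rewrite -[tperm _ _]mul1g FT ?F1 ?mul1g // perm_on1.
split=> // u v uA vA; suff [] : perm_on A v /\ F (u * v) = F u * F v by [].
move: v vA; apply: sym_ind => [|v i iA ia ib [vA FuV]|v [vA FuV]].
- by rewrite perm_on1 F1 !mulg1.
- split; first exact: perm_onM (c3_on iA).
  by rewrite mulgA !FM ?FuV ?mulgA // perm_onM.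
split; first exact: perm_onM t_on.
by rewrite mulgA !FT ?FuV ?mulgA // perm_onM.
Qed.

End Carmichael.

Local Close Scope group_scope.
Local Open Scope ring_scope.

(** * Cycles as maps on the integers *)

(** For $0 \le m \le hi-lo+1$ this is the $m$-th power of the cycle $(lo,\ldots,hi)$; one wrap is
    enough in that range. Piecewise linear maps of this kind bring identities between permutations
    within reach of [lia]. *)
Definition rotz (lo hi m x : int) : int :=
  if (lo <= x) && (x <= hi) then
    if x + m <= hi then x + m else x + m - (hi - lo + 1)
  else x.
Definition swap (i j x : int) : int := if x == i then j else if x == j then i else x.
Definition c3f (i j l x : int) : int :=
  if x == i then j else if x == j then l else if x == l then i else x.
Definition swap_if (b : bool) (i j x : int) : int := if b then swap i j x else x.

(** Conditions that themselves contain a conditional wait their turn, and contradictory branches are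
    closed at once, which keeps the number of cases small. *)
Ltac split_if := repeat match goal with
  | |- context [if ?b then _ else _] =>
    lazymatch b with
    | context [if _ then _ else _] => fail
    | true => rewrite /=
    | false => rewrite /=
    | _ => let H := fresh "H" in case: (boolP b) => H; try (exfalso; lia)
    end
  end.

Ltac pw := rewrite /rotz /swap_if /swap /c3f /=; split_if; try lia.

Lemma size_irange (lo hi : int) : lo <= hi + 1 -> size (irange lo hi) = `|(hi - lo + 1)%R|%N.
Proof.
rewrite /irange => h; case E: (hi - lo) => [m|m]; rewrite ?size_map ?size_iota /=; lia.
Qed.

Lemma nth_irange (lo hi : int) (i : nat) : (i%:Z <= hi - lo) -> nth 0 (irange lo hi) i = lo + i%:Z.
Proof.
rewrite /irange; case E: (hi - lo) => [m|m] h; last by lia.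
by rewrite (nth_map 0%N) ?size_iota ?nth_iota //; lia.
Qed.

Lemma mem_irange (lo hi x : int) : (x \in irange lo hi) = (lo <= x) && (x <= hi).
Proof.
rewrite /irange; case E: (hi - lo) => [m|m]; last by rewrite in_nil; lia.
apply/mapP/andP => [[i]|[h1 h2]]; first by rewrite mem_iota => ? ->; lia.
by exists `|(x - lo)%R|%N; rewrite ?mem_iota; lia.
Qed.

Lemma irange_uniq (lo hi : int) : uniq (irange lo hi).
Proof.
rewrite /irange; case: (hi - lo) => [m|m] //.
by rewrite map_inj_uniq ?iota_uniq // => i j; lia.
Qed.

Lemma next_spec (c : seq int) (f : int -> int) :
    uniq c -> (forall i, (i.+1 < size c)%N -> f (nth 0 c i) = nth 0 c i.+1) ->
    ((0 < size c)%N -> f (nth 0 c (size c).-1) = nth 0 c 0) ->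
    (forall x, x \notin c -> f x = x) ->
  next c =1 f.
Proof.
move=> cU fS f0 fN x; rewrite next_nth; case: ifPn => [xc|/fN //].
case: c cU fS f0 fN xc => [//|y c'] cU fS f0 _ xc; set i := index x _.
have xE : nth 0 (y :: c') i = x by exact: nth_index.
have il : (i < size (y :: c'))%N by rewrite index_mem.
have [ic|ic] := ltnP i (size c'); rewrite -[in RHS]xE.
  by rewrite (set_nth_default 0) // fS.
rewrite nth_default //; have -> : i = (size (y :: c')).-1 by move: il ic => /=; lia.
by rewrite f0.
Qed.

Lemma next_irange (lo hi : int) : next (irange lo hi) =1 rotz lo hi 1.
Proof.
have [h|h] := lerP (hi + 1) lo.
  have -> : irange lo hi = [::] by apply: size0nil; rewrite /irange; case E: (hi - lo) => [m|m] //; lia.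
  by move=> x; pw.
have sz : size (irange lo hi) = `|(hi - lo + 1)%R|%N by apply: size_irange; lia.
apply: next_spec => [|i|_|x]; rewrite ?irange_uniq // ?sz.
- by move=> il; rewrite !nth_irange; [pw | lia | lia].
- by rewrite !nth_irange; [pw | lia | lia].
by rewrite mem_irange => h'; pw.
Qed.

Lemma next_rev_irange (lo hi x : int) : next (rev (irange lo hi)) x =
  if (lo <= x) && (x <= hi) then (if x == lo then hi else x - 1) else x.
Proof.
pose f x := if (lo <= x) && (x <= hi) then (if x == lo then hi else x - 1) else x.
rewrite -/(f x); move: x; have [h|h] := lerP (hi + 1) lo.
  have -> : irange lo hi = [::] by apply: size0nil; rewrite /irange; case E: (hi - lo) => [m|m] //; lia.
  by move=> x; rewrite /f; pw.
have sz : size (irange lo hi) = `|(hi - lo + 1)%R|%N by apply: size_irange; lia.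
apply: next_spec => [|i|_|x]; rewrite ?rev_uniq ?irange_uniq // ?size_rev ?sz /f.
- by move=> il; rewrite !nth_rev ?sz ?nth_irange; try lia; pw.
- by rewrite !nth_rev ?sz ?nth_irange; try lia; pw.
by rewrite mem_rev mem_irange => h'; pw.
Qed.

(** The hypothesis includes the case $i=j$, so no pair degenerates; the transpositions are disjoint
    and each point is moved at most once. *)
Lemma cycles_swaps (S : int) (s : seq int) (x : int) :
    uniq s -> {in s &, forall i j, i != S - j} ->
  cycles [seq [:: i; S - i] | i <- s] x =
    if (x \in s) || (S - x \in s) then S - x else x.
Proof.
rewrite /cycles; elim: s x => [//|i s IH] x /= /andP[iNs sU] dis.
have iS : i != S - i by apply: dis; rewrite mem_head.
have disj j : j \in s -> i != S - j by move=> js; apply: dis; rewrite !inE ?eqxx ?js ?orbT.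
rewrite IH //; last by move=> j l js ls; apply: dis; rewrite inE ?js ?ls orbT.
have -> : (if x == i then S - i else if x == S - i then i else x) = swap i (S - i) x by [].
rewrite !inE /swap; have [->|xi] := eqVneq x i.
  rewrite /= subKr (negPf iNs) orbF; case: ifPn => // h.
  by have := disj _ h; rewrite subKr eqxx.
have [->|xSi] := eqVneq x (S - i).
  rewrite (negPf iNs) subKr eqxx /= orbT; case: ifPn => // h.
  by have := disj _ h; rewrite subKr eqxx.
have -> : (S - x == i) = false by apply: contraNF xSi; lia.
by [].
Qed.

(** * Evaluation of words *)

Section Evaluation.

Variables (X : Type) (G : groupType) (f : X -> G).

Definition gexpz (g : G) (m : int) : G :=
  match m with Posz n => (g ^+ n)%g | Negz n => (g^-1 ^+ n.+1)%g end.

Fixpoint ev (e : expr X) : G :=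
  match e with
  | EOne => 1%g
  | EGen x => f x
  | EMul e1 e2 => (ev e1 * ev e2)%g
  | EPow e1 m => gexpz (ev e1) m
  end.

Lemma gexpzN (g : G) (m : int) : gexpz g (- m) = (gexpz g m)^-1%g.
Proof.
case: m => [[|n]|n]; first by rewrite oppr0 /= expg0 invg1.
  by rewrite -NegzE /= expVgn.
by rewrite NegzE opprK /= expVgn invgK.
Qed.

Lemma gexpzD (g : G) (m n : int) : gexpz g (m + n) = (gexpz g m * gexpz g n)%g.
Proof.
have D1 (i : int) : gexpz g (i + 1) = (gexpz g i * g)%g.
  case: i => [i|[|i]].
  - by rewrite -PoszD addn1 /= expgSr.
  - by rewrite /= expg1 mulVg.
  have -> : Negz i.+1 + 1 = Negz i by lia.
  by rewrite /= [in RHS]expgSr mulgVK.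
elim/int_rec: n => [|n IH|n IH]; first by rewrite addr0 mulg1.
  by rewrite -addn1 PoszD addrA D1 IH -mulgA -D1.
apply: (mulIg g); rewrite -D1 -mulgA -D1.
have -> : - n.+1%:Z + 1 = - n%:Z by lia.
by rewrite -IH; congr gexpz; lia.
Qed.

Lemma evJ e e' : ev (econj e e') = (ev e ^ ev e')%g.
Proof. by rewrite conjgE mulgA. Qed.

Lemma evM e e' : ev (EMul e e') = (ev e * ev e')%g. Proof. by []. Qed.

Lemma evV e : ev (EPow e (-1)) = (ev e)^-1%g.
Proof. by []. Qed.

Definition evw (w : word X) : G :=
  foldr (fun l g => ((if l.2 then (f l.1)^-1 else f l.1) * g)%g) 1%g w.

Lemma evw_cat u v : evw (u ++ v) = (evw u * evw v)%g.
Proof. by elim: u => [|l u IH] /=; rewrite ?mul1g // IH mulgA. Qed.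

Lemma evw_inv u : evw (winv u) = (evw u)^-1%g.
Proof.
elim: u => [|[x b] u IH] /=; first by rewrite invg1.
rewrite /winv /= rev_cons -cats1 evw_cat -/(winv u) IH /= invgM mulg1.
by case: b; rewrite //= invgK.
Qed.

Lemma evw_flatten n u : evw (flatten (nseq n u)) = (evw u ^+ n)%g.
Proof. by elim: n => [|n IH] //=; rewrite evw_cat IH expgS. Qed.

Lemma ev_word e : ev e = evw (word_of e).
Proof.
elim: e => [|x|e1 IH1 e2 IH2|e IH m] /=; rewrite ?mulg1 ?evw_cat ?IH1 ?IH2 //.
by case: m => n; rewrite IH /wpow evw_flatten ?evw_inv.
Qed.

End Evaluation.

Section Morphism.

Variables (G H : groupType) (phi : G -> H).
Hypothesis phiM : {morph phi : x y / (x * y)%g}.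

Lemma morph_grp1 : phi 1%g = 1%g.
Proof. by apply: (mulgI (phi 1%g)); rewrite -phiM !mulg1. Qed.

Lemma morph_grpV x : phi x^-1%g = (phi x)^-1%g.
Proof. by apply: (mulgI (phi x)); rewrite -phiM !mulgV morph_grp1. Qed.

Lemma morph_grpX x n : phi (x ^+ n)%g = (phi x ^+ n)%g.
Proof. by elim: n => [|n IH]; rewrite ?expg0 ?morph_grp1 // !expgS phiM IH. Qed.

Lemma ev_morph X (f : X -> G) e : ev (phi \o f) e = phi (ev f e).
Proof.
elim: e => [|x|e1 IH1 e2 IH2|e IH m] //=; first by rewrite morph_grp1.
  by rewrite IH1 IH2 phiM.
by rewrite IH; case: m => n; rewrite /= morph_grpX ?morph_grpV.
Qed.

End Morphism.

Lemma pelt_ev (X : choiceType) (R : seq (expr X)) e :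
  pelt R e = ev (fun x => pelt R (EGen x)) e.
Proof.
rewrite ev_word /pelt; move: (word_of e) => w.
elim: w => [|[x b] w IH] //=.
rewrite -IH -[_ :: w]/([:: (x, b)] ++ w) -pmulE; congr (_ * _)%g.
by case: b => //; rewrite -[RHS]/(pinv _) pinvE.
Qed.

Section Lifting.

Variables (X : choiceType) (R : seq (expr X)) (G : groupType) (f : X -> G).
Hypothesis fR : {in [seq word_of e | e <- R], forall w, evw f w = 1%g}.

Lemma weq_ev w w' : weq R w w' -> evw f w = evw f w'.
Proof.
elim=> // {w w'} [w1 w2 w3 _ -> _ -> //|u v x b|u v w wR].
  rewrite !evw_cat; congr (_ * _)%g.
  by rewrite /=; case: b; rewrite /= mulg1 ?mulgV ?mulVg mul1g.
by rewrite !evw_cat (fR wR) mul1g.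
Qed.

Definition presented_lift (g : presented R) : G := evw f (prepr g).

Lemma presented_liftE w : presented_lift (pclass R w) = evw f w.
Proof. by apply: weq_ev; exact: weq_repr. Qed.

Lemma presented_liftM : {morph presented_lift : g h / (g * h)%g >-> (g * h)%g}.
Proof.
move=> g h; rewrite -(pclass_repr g) -(pclass_repr h).
rewrite -[X in presented_lift X]/(pmul _ _) pmulE !presented_liftE.
exact: evw_cat.
Qed.

End Lifting.

(** * Permutations of [Omega] described by maps on the integers *)

Section Points.

Variables (k p : nat).
Hypothesis kp : (k <= p.+1)%N.

Local Notation P := (p%:Z).
Local Notation K := (k%:Z).
Local Notation lo := (- P + K - 1).
Local Notation O := (Omega k p).
Local Notation inO x := ((lo <= x) && (x <= P + 2)).

Lemma valO (x : O) : inO (val x).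
Proof. by rewrite -mem_irange; exact: valP. Qed.

Lemma pt0_subproof : P + 2 \in irange lo (P + 2).
Proof. by rewrite mem_irange; lia. Qed.

(** Integers out of range are sent to the default point $p+2$, which is why the lemmas on [omega_pt]
    carry range conditions. *)
Definition omega_pt (x : int) : O := insubd (SeqSub pt0_subproof) x.

Local Notation pt := omega_pt.

Lemma val_pt x : inO x -> val (pt x) = x.
Proof. by move=> h; rewrite /omega_pt insubdK // unfold_in mem_irange. Qed.

Lemma ptK (x : O) : pt (val x) = x.
Proof. by apply: val_inj; rewrite val_pt ?valO. Qed.

Lemma pt_eq x y : inO x -> inO y -> (pt x == pt y) = (x == y).
Proof. by move=> hx hy; rewrite -(inj_eq val_inj) !val_pt. Qed.

Lemma card_Omega : #|O| = (2 * p + 4 - k)%N.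
Proof. by rewrite card_seq_sub ?irange_uniq // size_irange; lia. Qed.

Implicit Types (u v : {perm O}) (f g : int -> int).

Lemma acts_as_exists f : (forall x, inO x -> inO (f x)) ->
    (forall x y, inO x -> inO y -> f x = f y -> x = y) ->
  exists u, acts_as u f.
Proof.
move=> fO fI; have inj : injective (fun x : O => pt (f (val x))).
  move=> x y /(congr1 val); rewrite !val_pt ?fO ?valO // => /fI h.
  by apply: val_inj; apply: h; exact: valO.
by exists (perm inj) => x; rewrite permE val_pt ?fO ?valO.
Qed.

Lemma acts_as_uniq u v f : acts_as u f -> acts_as v f -> u = v.
Proof. by move=> uf vf; apply/permP => x; apply: val_inj; rewrite uf vf. Qed.

Lemma acts_as_eq u f g : acts_as u f -> (forall x, inO x -> f x = g x) -> acts_as u g.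
Proof. by move=> uf fg x; rewrite uf fg ?valO. Qed.

Lemma acts_as_pt u f x : acts_as u f -> inO x -> u (pt x) = pt (f x).
Proof. by move=> uf hx; rewrite -(ptK (u (pt x))) uf val_pt. Qed.

Lemma acts_as1 : acts_as (1%g : {perm O}) id.
Proof. by move=> x; rewrite perm1. Qed.

Lemma acts_asM u v f g : acts_as u f -> acts_as v g -> acts_as (u * v)%g (g \o f).
Proof. by move=> uf vg x; rewrite permM vg uf. Qed.

Lemma acts_asV u f g : acts_as u f -> (forall x, inO x -> inO (g x) /\ f (g x) = x) ->
  acts_as u^-1%g g.
Proof.
move=> uf fg x; have [h1 h2] := fg _ (valO x).
by rewrite -{1}(ptK x) -{1}h2 -(acts_as_pt uf h1) permK val_pt.
Qed.

Lemma acts_as_rotX u a b (m : nat) : lo <= a -> a <= b -> b <= P + 2 ->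
    (m%:Z <= b - a + 1) -> acts_as u (rotz a b 1) -> acts_as (u ^+ m)%g (rotz a b m%:Z).
Proof.
move=> h1 h2 h3 + uf; elim: m => [|m IH] hm.
  by apply: acts_as_eq acts_as1 _ => x hx; pw.
rewrite expgSr; apply: acts_as_eq (acts_asM (IH _) uf) _; first lia.
by move=> x hx /=; pw.
Qed.

Lemma acts_as_rotV u a b (m : int) : lo <= a -> a <= b -> b <= P + 2 ->
    0 <= m -> m <= b - a + 1 -> acts_as u (rotz a b m) -> acts_as u^-1%g (rotz a b (b - a + 1 - m)).
Proof.
by move=> h1 h2 h3 h4 h5 uf; apply: acts_asV uf _ => x hx; pw.
Qed.

Lemma acts_as_rotz u a b (m : int) : lo <= a -> a <= b -> b <= P + 2 ->
    0 <= m -> (m <= b - a + 1) -> acts_as u (rotz a b 1) -> acts_as (gexpz u m) (rotz a b m).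
Proof. by case: m => m // *; apply: acts_as_rotX. Qed.

Lemma acts_as_rotzN u a b (m : int) : lo <= a -> a <= b -> b <= P + 2 ->
    0 <= m -> (m <= b - a + 1) -> acts_as u (rotz a b 1) ->
  acts_as (gexpz u (- m)) (rotz a b (b - a + 1 - m)).
Proof.
move=> h1 h2 h3 h4 h5 uf; rewrite gexpzN; apply: acts_as_rotV => //.
exact: acts_as_rotz.
Qed.

Lemma acts_as_tperm x y : inO x -> inO y -> acts_as (tperm (pt x) (pt y)) (swap x y).
Proof.
move=> hx hy w; rewrite permE /= /swap -!(inj_eq val_inj) !val_pt //.
by do 2?case: ifP => _; rewrite ?val_pt.
Qed.

Lemma acts_as_cyc3 x y z : inO x -> inO y -> inO z -> x != y -> x != z -> y != z ->
  acts_as (cyc3 (pt x) (pt y) (pt z)) (c3f x y z).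
Proof.
move=> hx hy hz xy xz yz w; rewrite cyc3E ?pt_eq // /c3f -!(inj_eq val_inj) !val_pt //.
by do 3?case: ifP => _; rewrite ?val_pt.
Qed.

End Points.

(** * The representatives $1,\ldots,p$ of the prime field *)

Section PrimeField.

Variable p : nat.
Hypothesis p_pr : prime p.
Local Notation P := (p%:Z).

Lemma Fp_int_nat (x : int) : 0 <= x -> (x%:~R : 'F_p) = `|x|%N%:R.
Proof. by case: x => // n _; rewrite pmulrn. Qed.

Lemma val_Fp_int (x : int) : 0 <= x < P -> Posz (val (x%:~R : 'F_p)) = x.
Proof.
move=> hx; rewrite Fp_int_nat; last lia.
by rewrite /= val_Fp_nat // modn_small; lia.
Qed.

Lemma Fp_lt (f : 'F_p) : (val f < p)%N.
Proof. by have := ltn_ord f; rewrite [X in (_ < X)%N]Fp_cast. Qed.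

Lemma Fp_valK (f : 'F_p) : ((Posz (val f))%:~R : 'F_p) = f.
Proof. by rewrite Fp_int_nat //= natr_Zp. Qed.

Lemma Fp_P : (P%:~R : 'F_p) = 0.
Proof. by rewrite Fp_int_nat //= (pchar_Fp_0 p_pr). Qed.

Lemma Fp_int_eq0 (x : int) : 0 <= x < P -> (x%:~R == 0 :> 'F_p) = (x == 0).
Proof.
move=> hx; apply/eqP/eqP => [h|->//].
by rewrite -(val_Fp_int hx) h.
Qed.

(** Zero is represented by $p$ and not by $0$: the integer $0$ is another point of [Omega], which
    the image of $a$ fixes. *)
Definition repF (f : 'F_p) : int := if f == 0 then P else Posz (val f).

Lemma repF_bound f : 1 <= repF f <= P.
Proof.
have := prime_gt1 p_pr; rewrite /repF; case: eqP => f0; first lia.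
have := Fp_lt f; have : val f <> 0%N by move=> h; apply/f0/val_inj.
by move: (val f) => v; lia.
Qed.

Lemma repF_lt f : f != 0 -> 1 <= repF f <= P - 1.
Proof.
move=> f0; have := repF_bound f; have := Fp_lt f.
by rewrite /repF (negPf f0); lia.
Qed.

Lemma repFK f : ((repF f)%:~R : 'F_p) = f.
Proof. by rewrite /repF; case: eqP => [->|_]; rewrite ?Fp_P ?Fp_valK. Qed.

Lemma repF_int (x : int) : 1 <= x <= P -> repF (x%:~R) = x.
Proof.
move=> hx; have [->|xP] := eqVneq x P; first by rewrite Fp_P /repF eqxx.
rewrite /repF Fp_int_eq0; last lia.
by case: eqP => [|_]; [lia | rewrite val_Fp_int; lia].
Qed.

Lemma mulFE (al : 'F_p) (x : int) : al != 0 ->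
  mulF al x = if (1 <= x) && (x <= P - 1) then repF (al * x%:~R) else x.
Proof.
move=> al0; rewrite /mulF /repF; case: ifP => // hx.
by rewrite mulf_eq0 (negPf al0) Fp_int_eq0; [case: eqP => //|]; lia.
Qed.

End PrimeField.

Lemma perm_disjoint_commute (T : finType) (u v : {perm T}) :
  (forall x, u x = x \/ v x = x) -> (u * v = v * u)%g.
Proof.
move=> uv; have on (w : {perm T}) : perm_on [set x | w x != x] w.
  by apply/subsetP => x; rewrite !inE.
apply: perm_onC (on u) (on v) _; apply/pred0P => x; rewrite /= !inE.
by case: (uv x) => ->; rewrite eqxx ?andbF.
Qed.

Lemma cyc3_mulV (T : finType) (i j a b : T) : i != j -> i != a -> i != b ->
    j != a -> j != b -> a != b ->
  (cyc3 i a b * (cyc3 j a b)^-1 * cyc3 i a b = tperm i j * tperm a b)%g.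
Proof.
move=> ij ia ib ja jb ab; rewrite -(expg3_sq (cyc3_expg3 ja jb ab)).
apply/permP => u.
have nE (c d : T) : c != d -> ((c == d) = false) * ((d == c) = false).
  by move=> cd; split; [exact: negPf | rewrite eq_sym; exact: negPf].
have ne := (nE _ _ ij, nE _ _ ia, nE _ _ ib, nE _ _ ja, nE _ _ jb, nE _ _ ab, eqxx).
have cE v : cyc3 i a b v =
    if v == i then a else if v == a then b else if v == b then i else v by exact: cyc3E.
have dE v : cyc3 j a b v =
    if v == j then a else if v == a then b else if v == b then j else v by exact: cyc3E.
have tE (c d v : T) : tperm c d v = if v == c then d else if v == d then c else v by rewrite permE.
rewrite !permM.
have [->|ui] := eqVneq u i; first by do 5?rewrite ?cE ?dE ?tE ?ne.
have [->|uj] := eqVneq u j; first by do 5?rewrite ?cE ?dE ?tE ?ne.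
have [->|ua] := eqVneq u a; first by do 5?rewrite ?cE ?dE ?tE ?ne.
have [->|ub] := eqVneq u b; first by do 5?rewrite ?cE ?dE ?tE ?ne.
have neu := (negPf ui, negPf uj, negPf ua, negPf ub).
by do 5?rewrite ?cE ?dE ?tE ?neu.
Qed.

Class setting (k p : nat) : Prop := Setting {
  p_pr : prime p;
  p11 : (p %% 12 = 11)%N;
  k6 : (6 <= k)%N;
  kp : (k <= p.+1)%N }.

#[local] Hint Extern 0 (is_true (prime _)) =>
  match goal with S : setting _ _ |- _ => exact: (@p_pr _ _ S) end : core.

(* Dropping the irrelevant context first keeps [lia] fast, and so does leaving out
   the congruence modulo 12, which is rarely needed. *)
Ltac slim :=
  repeat match goal with
  | H : ?T |- _ =>
    lazymatch T with
    | is_true (Order.le _ _) => idtac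
    | is_true (Order.lt _ _) => idtac
    | is_true (leq _ _) => idtac
    | is_true (~~ _) => idtac
    | is_true (_ && _) => idtac
    | is_true (_ || _) => idtac
    | is_true (_ == _) => idtac
    | is_true (odd _) => idtac
    | ~ _ => idtac
    | _ = _ => idtac
    end; revert H
  end;
  lazymatch goal with S : setting ?k ?p |- _ =>
    clear -S; intros; have ? := @k6 k p S; have ? := @kp k p S
  end.

Ltac slia := slim; first [lia |
  lazymatch goal with S : setting ?k ?p |- _ => have ? := @p11 k p S; lia end].

Ltac ssplit := repeat match goal with
  | |- context [if ?b then _ else _] =>
    lazymatch b with
    | context [if _ then _ else _] => fail
    | true => rewrite /=
    | false => rewrite /=
    | _ => let H := fresh "H" in case: (boolP b) => H; try (exfalso; slim; lia)
    end
  end.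
Ltac spw := rewrite /rotz /swap_if /swap /c3f /=; ssplit; try slia.

(** * Field elements as points, and multiplication permutations *)

Section Points.

Context {k p : nat} {kpS : setting k p}.
Local Notation p_pr := (@p_pr k p kpS).

Local Notation P := (p%:Z).
Local Notation K := (k%:Z).
Local Notation lo := (- P + K - 1).
Local Notation O := (Omega k p).
Local Notation inO x := ((lo <= x) && (x <= P + 2)).
Local Notation pt := (omega_pt (@kp k p kpS)).
Local Notation al := (pt (P + 1)).
Local Notation be := (pt (P + 2)).
Implicit Types (x : int) (f : 'F_p).

Definition ptF f : O := pt (repF f).

Arguments ptF f%_R.

Lemma ptF_int x : 1 <= x <= P -> ptF x%:~R = pt x.
Proof. by move=> hx; rewrite /ptF repF_int. Qed.

Lemma ptF_al f : ptF f != al.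
Proof. by have h := repF_bound p_pr f; rewrite pt_eq; slia. Qed.

Lemma ptF_be f : ptF f != be.
Proof. by have := repF_bound p_pr f => h; rewrite pt_eq; slia. Qed.

Lemma al_be : al != be.
Proof. by rewrite pt_eq; slia. Qed.

Lemma ptF_inj : injective ptF.
Proof.
move=> f g /eqP; rewrite pt_eq; try by have := repF_bound p_pr f; have := repF_bound p_pr g; slia.
by move=> /eqP e; rewrite -(repFK p_pr f) e repFK.
Qed.

Lemma ptP0 : pt P = ptF 0. Proof. by rewrite /ptF /repF eqxx. Qed.

(** Picked by a decidable form of [acts_as], so as to be an honest function of [f]. For nonzero [f]
    a suitable permutation exists and the default is never taken. *)
Definition mulP (f : 'F_p) : {perm O} :=
  odflt 1%g [pick u : {perm O} | [forall x : O, val (u x) == mulF f (val x)]].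

Arguments mulP f%_R.

Lemma acts_mulP f : f != 0 -> acts_as (mulP f) (mulF f).
Proof.
move=> f0; rewrite /mulP; case: pickP => [u /forallP h x|h]; first exact/eqP.
have [x hx|x y hx hy|u uf] := @acts_as_exists k p (@kp k p kpS) (mulF f).
- rewrite mulFE //; case: ifP => // hx'; have := repF_bound p_pr (f * x%:~R); slia.
- rewrite !mulFE //; do 2!case: ifP => ?.
  + move=> /(congr1 (fun z : int => z%:~R : 'F_p)); rewrite !repFK //.
    by move=> /(mulfI f0) e; rewrite -(repF_int p_pr (x := x)) ?e ?repF_int //; slia.
  + have : f * x%:~R != 0 by rewrite mulf_neq0 // Fp_int_eq0 //; slia.
    by move=> /repF_lt -/(_ p_pr); slia.
  + have : f * y%:~R != 0 by rewrite mulf_neq0 // Fp_int_eq0 //; slia.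
    by move=> /repF_lt -/(_ p_pr); slia.
  by [].
by have /forallP[] := h u; move=> x; rewrite uf.
Qed.

Lemma mulP_ptF f h : f != 0 -> mulP f (ptF h) = ptF (f * h).
Proof.
move=> f0; rewrite /ptF; have hb := repF_bound p_pr h.
rewrite (acts_as_pt _ (acts_mulP f0)); last slia.
rewrite mulFE // repFK //; have [->|h0] := eqVneq h 0.
  by rewrite mulr0 {1 2 4}/repF eqxx; case: ifP => //; slia.
by have := repF_lt p_pr h0 => h1; rewrite ifT //; slia.
Qed.

Lemma mulP_out f x : f != 0 -> inO x -> ~~ (1 <= x <= P) -> mulP f (pt x) = pt x.
Proof.
by move=> f0 hx h; rewrite (acts_as_pt _ (acts_mulP f0)) // mulFE // ifF //; slia.
Qed.

Lemma OP (x : O) : (exists f, x = ptF f) \/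
  (exists2 z, x = pt z & inO z && ~~ (1 <= z <= P)).
Proof.
case: (boolP (1 <= val x <= P)) => h.
  by left; exists ((val x)%:~R); rewrite ptF_int // ptK.
by right; exists (val x); rewrite ?ptK // h valO.
Qed.

Lemma mulPM f h : f != 0 -> h != 0 -> (mulP f * mulP h)%g = mulP (f * h).
Proof.
move=> f0 h0; have fh0 := mulf_neq0 f0 h0; apply/permP => x; rewrite permM.
case: (OP x) => [[e ->]|[z -> /andP[hz hz']]].
  by rewrite !mulP_ptF // mulrCA mulrA.
by rewrite !mulP_out.
Qed.

Lemma mulP1 : mulP 1%R = 1%g.
Proof.
have one0 := oner_neq0 'F_p.
have h : (mulP 1%R * mulP 1%R)%g = mulP 1%R by rewrite mulPM ?mulr1.
by apply: (mulgI (mulP 1%R)); rewrite mulg1.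
Qed.

Lemma mulPX f m : f != 0 -> (mulP f ^+ m)%g = mulP (f ^+ m).
Proof.
move=> f0; elim: m => [|m IH]; first by rewrite expg0 expr0 mulP1.
by rewrite expgS IH mulPM ?expf_neq0 // exprS.
Qed.

Lemma mulP_al f : f != 0 -> mulP f al = al.
Proof. by move=> f0; rewrite mulP_out //; slia. Qed.

Lemma mulP_be f : f != 0 -> mulP f be = be.
Proof. by move=> f0; rewrite mulP_out //; slia. Qed.

End Points.
Arguments ptF {k p kpS} f%_R.
Arguments mulP {k p} f%_R.

(** * Bit-length *)

Local Close Scope ring_scope.

Section BitLength.

Variables (n p : nat) (r s : int).
Hypotheses (n14 : 14 <= n) (p_le : p + 3 <= n) (kn : n + 2 <= 2 * p).
Hypotheses (r_lt : (`|r| < p)%N) (s_lt : (`|s| < p)%N).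

Local Notation l := (trunc_log 2 n).
Let bounded (c : nat) (e : expr 'I_3) : Prop := esize e <= c * l.

Lemma trunc_log_gt : 3 <= l.
Proof. by rewrite -(@trunc_expnK 2 3) //; apply: leq_trunc_log; lia. Qed.

(** Doubling, the leading digit and the sign each add one to [l], and $l+3 \le 2l$ because
    [3 <= l]. *)
Lemma int_size_le (m : int) : `|m| <= 2 * n -> int_size m <= 2 * l.
Proof.
move=> hm; have h3 := trunc_log_gt.
have : trunc_log 2 `|m| <= l.+1.
  by rewrite -trunc_log2_double; [apply: leq_trunc_log; rewrite -mul2n; lia | lia].
by rewrite /int_size; case: (m < 0)%R; lia.
Qed.

Let b_gen i : bounded 1 (EGen i).
Proof. by rewrite /bounded /=; have := trunc_log_gt; lia. Qed.

Let b_mul c1 c2 e1 e2 : bounded c1 e1 -> bounded c2 e2 -> bounded (c1 + c2) (EMul e1 e2).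
Proof. by rewrite /bounded /= mulnDl => *; lia. Qed.

(** The increment 4 is [2 * l] for the exponent and a generous [2 * l] for the two parentheses. *)
Let b_pow c e m : `|m| <= 2 * n -> bounded c e -> bounded (c + 4) (EPow e m).
Proof.
by move/int_size_le; rewrite /bounded /= mulnDl; have := trunc_log_gt; lia.
Qed.

Let b_conj c1 c2 e1 e2 : bounded c1 e1 -> bounded c2 e2 ->
  bounded (c2 + 4 + c1 + c2) (econj e1 e2).
Proof.
move=> h1 h2; apply: (b_mul (b_mul (b_pow _ h2) h1) h2); lia.
Qed.

Let b_le c c' e : bounded c e -> c <= c' -> bounded c' e.
Proof. by rewrite /bounded => h cc; apply: leq_trans h _; rewrite leq_mul2r cc orbT. Qed.

Let b_b : bounded 5 wb. Proof. by apply: (b_pow _ (b_gen _)); lia. Qed.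

Let b_z : bounded 5 (wz p). Proof. by apply: (b_pow _ (b_gen _)); lia. Qed.

Let b_zi i : `|i| <= 2 * n -> bounded 19 (wzi p i).
Proof. by move=> hi; exact: (b_conj b_z (b_pow hi (b_gen _))). Qed.

Let b_d i j : `|i| <= 2 * n -> `|j| <= 2 * n -> bounded 61 (wdij p i j).
Proof.
move=> hi hj; apply: (b_mul (b_mul (b_zi hi) (b_pow _ (b_zi hj))) (b_zi hi)); lia.
Qed.

Let b_c_low (i j : int) : `|i| <= 2 * n -> `|j| <= 2 * n -> `|(j - i)%R| <= 2 * n ->
  bounded 76 (wc_low p i j).
Proof.
move=> hi hj hij.
have x61 : bounded 61 (wx p) by apply: b_d; lia.
apply: (b_mul (b_mul (b_pow _ (b_gen _)) (b_pow hij (b_mul (b_gen _) x61))) (b_pow hi (b_gen _))).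
lia.
Qed.

Let b_za : bounded 6 (EMul (wz p) wa). Proof. exact: b_mul b_z (b_gen _). Qed.

Let b_c_p (i : int) : `|i| <= n -> bounded 105 (wc_p p i).
Proof.
by move=> hi; apply: (b_mul (b_conj b_z (b_pow _ b_za)) (b_c_low _ _ _)); lia.
Qed.

Let b_c (i j : int) : `|i| <= n -> `|j| <= n -> bounded 110 (wcij p i j).
Proof.
move=> hi hj; rewrite /wcij; case: ifP => _; first by apply: b_le (b_c_p hi) _.
case: ifP => _.
  by apply: b_le (b_mul (b_conj b_z (b_pow _ b_za)) (b_c_low _ _ _)) _; lia.
case: ifP => _; first by apply: b_le (b_mul b_z (b_c_p hi)) _.
by apply: b_le (b_c_low _ _ _) _; lia.
Qed.

Let b_h : bounded 51 (wh p r).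
Proof.
by apply: (b_pow _ (b_mul (b_mul (b_pow _ b_b) (b_zi _)) (b_zi _))); lia.
Qed.

Let b_v : bounded 289 (wv p).
Proof.
apply: (@b_pow 285); first lia.
apply: (@b_mul 224 61); last by apply: b_d; lia.
by apply: (@b_mul 110 114); [apply: b_c | apply: (@b_pow 110); [|apply: b_c]]; lia.
Qed.

Let b_t : bounded 298 (wt p).
Proof. by apply: (b_mul b_v); apply: (@b_pow 5) => //; lia. Qed.

Let b_watil : bounded 99 (watil p).
Proof. by apply: (b_conj (b_zi _) (b_mul (b_zi _) (b_zi _))); lia. Qed.

Let k_le : kpar n p <= n.
Proof. rewrite /kpar; lia. Qed.

Let b_wc : bounded 408 (wc n p).
Proof.
have := k_le; rewrite /wc; case: ifP => _ hk; apply: (@b_mul 110 298) => //; apply: b_c; lia.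
Qed.

Let b_wd : bounded 110 (wd p).
Proof. by apply: b_c; lia. Qed.

Let b_we : bounded 418 (we n p).
Proof.
have hk : kpar n p < n by rewrite /kpar; lia.
rewrite /we; case: ifP => _.
  apply: (b_mul (b_mul (b_mul b_z (b_gen _)) b_t) (b_pow _ (b_c _ _))); lia.
apply: (b_mul (b_mul (b_mul b_z (b_gen _)) b_t) (b_pow _ (b_c _ _))); lia.
Qed.

Let b_ww : bounded 1172 (ww n p).
Proof.
have hk := k_le; have y1 := b_gen (@Ordinal 3 2 isT); have a1 := b_gen (@Ordinal 3 0 isT).
have d1 : bounded 61 (wdij p 1 (kpar n p).+2) by apply: b_d; lia.
have d2 : bounded 61 (wdij p 2 (kpar n p).+1) by apply: b_d; lia.
have d3 : bounded 61 (wdij p 1 p) by apply: b_d; lia.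
have n1 : `|(-1)%R : int| <= 2 * n by lia.
have n2 : `|(-2)%R : int| <= 2 * n by lia.
have xt : bounded 394 (wxtil n p).
  exact: (b_conj (b_mul d1 d2) (b_mul (b_conj d1 y1) (b_conj d2 y1))).
have u : bounded 18 (wu p) by exact: (b_mul b_za (b_conj b_za y1)).
have xu := b_mul xt (b_pow n2 u).
rewrite /ww; case: ifP => _; first by apply: b_le (b_conj b_t (b_mul y1 b_z)) _.
case: ifP => _.
  by apply: b_le (b_mul (b_conj b_z (b_mul y1 (b_pow n1 b_z))) (b_conj b_z (b_mul y1 b_z))) _.
have aya := b_mul (b_mul a1 y1) (b_pow n1 a1).
case: ifP => _.
  apply: b_le (b_mul (b_mul (b_conj b_z (b_mul aya (b_pow n1 b_z))) (b_conj b_z (b_mul aya b_z)))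
    (b_conj (b_mul d3 b_t) (b_mul y1 (b_pow n1 a1)))) _.
  by [].
case: ifP => _.
  have e1 : `|Posz (p - kpar n p)./2| <= 2 * n by lia.
  have e2 : `|Posz (p - kpar n p)| <= 2 * n by lia.
  by apply: b_le (b_mul (b_mul (b_pow e1 xu) xt) (b_pow e2 u)) _.
have e1 : `|Posz (p - kpar n p).-1./2| <= 2 * n by lia.
have e2 : `|Posz (p - kpar n p).-1| <= 2 * n by lia.
by apply: b_le (b_mul (b_mul (b_mul (b_conj b_t (b_mul (b_mul b_za y1) (b_pow n1 b_za)))
  (b_pow e1 xu)) xt) (b_pow e2 u)) _.
Qed.

(** The seven relators contribute $18+28+20+259+826+1076+1177=3404$ multiples of [l]; the three
    generators are absorbed in rounding up to 3410. *)
Lemma bitlength_relators : bitlength (relators n p r s) <= 3410 * l.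
Proof.
have n1 : `|(-1)%R : int| <= 2 * n by lia.
have y1 := b_gen (@Ordinal 3 2 isT); have a1 := b_gen (@Ordinal 3 0 isT).
have rel c1 c2 e1 e2 : bounded c1 e1 -> bounded c2 e2 -> bounded (c1 + (c2 + 4)) (erel e1 e2).
  by move=> h1 h2; apply: b_mul h1 _; exact: b_pow.
have r1 : bounded 18 (erel (EPow wa p) (EPow wb p.-1)).
  by apply: (@rel 5 9); [apply: (@b_pow 1) => // | apply: (@b_pow 5) => //]; lia.
have r2 : bounded 28 (erel (econj (EPow wa s) wb) (EPow wa (s - 1)%R)).
  by apply: (@rel 19 5); [apply: (b_conj (b_pow _ a1) b_b) | apply: (@b_pow 1) => //]; lia.
have r3 : bounded 20 (EPow (EMul (wz p) (econj (wz p) wa)) 2%R).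
  by apply: (b_pow _ (b_mul b_z (b_conj b_z a1))); lia.
have r4 : bounded 259 (erel (watil p) (econj (EMul (watil p) (wh p r)) wy)).
  exact: rel b_watil (b_conj (b_mul b_watil b_h) y1).
have r5 : bounded 826 (erel (wc n p) (econj (wc n p) wy)).
  exact: rel b_wc (b_conj b_wc y1).
have ey := b_conj b_we y1.
have r6 : bounded 1076 (ecomm (wd p) (econj (we n p) wy)).
  exact: (b_mul (b_mul (b_mul (b_pow n1 b_wd) (b_pow n1 ey)) b_wd) ey).
have r7 : bounded 1177 (erel wy (ww n p)) by exact: rel y1 b_ww.
have l3 := trunc_log_gt.
rewrite /bitlength card_ord /relators !big_cons big_nil.
rewrite addn0; apply: leq_trans (leq_add (leqnn 3) (leq_add r1 (leq_add r2 (leq_add r3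
  (leq_add r4 (leq_add r5 (leq_add r6 r7))))))) _.
by lia.
Qed.

End BitLength.

Local Open Scope ring_scope.

Definition flip (k p : nat) (x : int) : int :=
  if (- p%:Z + k%:Z - 1 <= x) && (x <= 0) || (k%:Z + 1 <= x) && (x <= p%:Z + 2)
  then k%:Z + 1 - x else x.

Class gen_setting (k p : nat) (r s : int) (alpha : 'F_p)
    (sa sg sy : {perm Omega k p}) : Prop := GenSetting {
  alpha0 : alpha != 0;
  alpha3 : alpha ^+ 3 = r%:~R;
  rho_order : forall i j : nat,
    ((r%:~R : 'F_p) ^+ i == r%:~R ^+ j) = (i == j %[mod p.-1])%N;
  rho_gen : forall f : 'F_p, f != 0 -> exists2 i : nat, (i < p.-1)%N & f = r%:~R ^+ i;
  rho_s : (s%:~R : 'F_p) * (r%:~R - 1) = -1;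
  sa_acts : acts_as sa (rotz 1 p%:Z 1);
  sg_acts : acts_as sg (fun x => c3f p%:Z (p%:Z + 1) (p%:Z + 2) (mulF alpha x));
  sy_acts : acts_as sy (flip k p) }.

Definition gens (G : groupType) (a g y : G) (i : 'I_3) : G := nth 1%g [:: a; g; y] i.

Lemma cyc3_mul (T : finType) (i j a b : T) : i != j -> i != a -> i != b ->
    j != a -> j != b -> a != b ->
  (cyc3 i a b * cyc3 j a b = tperm i b * tperm a j)%g.
Proof.
move=> ij ia ib ja jb ab; apply/permP => u.
have nE (c d : T) : c != d -> ((c == d) = false) * ((d == c) = false).
  by move=> cd; split; [exact: negPf | rewrite eq_sym; exact: negPf].
have ne := (nE _ _ ij, nE _ _ ia, nE _ _ ib, nE _ _ ja, nE _ _ jb, nE _ _ ab, eqxx).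
have cE v : cyc3 i a b v =
    if v == i then a else if v == a then b else if v == b then i else v by exact: cyc3E.
have dE v : cyc3 j a b v =
    if v == j then a else if v == a then b else if v == b then j else v by exact: cyc3E.
have tE (c d v : T) : tperm c d v = if v == c then d else if v == d then c else v by rewrite permE.
rewrite !permM.
have [->|ui] := eqVneq u i; first by do 3?rewrite ?cE ?dE ?tE ?ne.
have [->|uj] := eqVneq u j; first by do 3?rewrite ?cE ?dE ?tE ?ne.
have [->|ua] := eqVneq u a; first by do 3?rewrite ?cE ?dE ?tE ?ne.
have [->|ub] := eqVneq u b; first by do 3?rewrite ?cE ?dE ?tE ?ne.
have neu := (negPf ui, negPf uj, negPf ua, negPf ub).
by do 3?rewrite ?cE ?dE ?tE ?neu.
Qed.

(** * Powers, affine conjugation, and generation of alternating groups *)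

Section GroupPowers.

Variable G : groupType.
Implicit Types g h : G.

Lemma gexpzX g (n : nat) (m : int) : gexpz (g ^+ n)%g m = (gexpz g m ^+ n)%g.
Proof.
case: m => m /=; first by rewrite expgnAC.
by rewrite -[((g ^+ n)^-1)%g]expVgn expgnAC.
Qed.

Lemma gexpzJ g h (m : int) : gexpz (g ^ h)%g m = (gexpz g m ^ h)%g.
Proof. by case: m => m /=; rewrite conjXg // conjVg. Qed.

Lemma expg_coprime g (m n : nat) : (0 < m)%N -> coprime m n ->
  (g ^+ m = 1 -> g ^+ n = 1 -> g = 1)%g.
Proof.
move=> m0 co gm gn; have [km kn e _] := egcdnP n m0.
have : (g ^+ (km * m) = 1)%g by rewrite mulnC expgnA gm expg1n.
by rewrite e expgnDr mulnC expgnA gn expg1n mul1g (eqP co) expg1.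
Qed.

Lemma expg_modn g (m n : nat) : (g ^+ n = 1)%g -> (g ^+ (m %% n) = g ^+ m)%g.
Proof. by move=> gn; rewrite {2}(divn_eq m n) expgnDr mulnC expgnA gn expg1n mul1g. Qed.

End GroupPowers.

Section AffineConjugation.

Variables (p : nat) (p_pr : prime p) (G : groupType) (a : G).
Hypothesis ap : (a ^+ p = 1)%g.

Definition expF (f : 'F_p) : G := (a ^+ val f)%g.

Lemma expF_nat (n : nat) : expF n%:R = (a ^+ n)%g.
Proof. by rewrite /expF /= val_Fp_nat // expg_modn. Qed.

Lemma expFD f h : expF (f + h) = (expF f * expF h)%g.
Proof.
rewrite -[f](natr_Zp f) -[h](natr_Zp h) -natrD !expF_nat.
by rewrite expgnDr.
Qed.

Lemma expF0 : expF 0 = 1%g. Proof. by []. Qed.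

Lemma expF1 : expF 1 = a. Proof. by rewrite -[1]/(1%:R) expF_nat. Qed.

Lemma expF_int (i : int) : expF i%:~R = gexpz a i.
Proof.
case: i => n; first exact: expF_nat.
apply: (mulIg (a ^+ n.+1)%g); rewrite -expF_nat -expFD NegzE intrN addNr expF0.
by rewrite [gexpz _ _]/= expVgn -expF_nat mulVg.
Qed.

Lemma expFX f (n : nat) : (expF f ^+ n)%g = expF (f * n%:R).
Proof.
elim: n => [|n IH]; first by rewrite mulr0.
by rewrite expgS IH -expFD -natr1 mulrDr mulr1 addrC.
Qed.

(** From $s(r-1)=-1$ follows $s-1=rs$, so the relation says that [b] raises $a^s$ to the power $r$.
    Since $f=s(1-r)f$, every power of [a] is a power of $a^s$. *)
Lemma affine_conj (b : G) (r s : int) : (s%:~R : 'F_p) * (r%:~R - 1) = -1 ->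
    (gexpz a s ^ b)%g = gexpz a (s - 1) ->
  forall f, (expF f ^ b)%g = expF (r%:~R * f).
Proof.
move=> rs asb f; pose h := (1 - r%:~R) * f.
have fE : f = s%:~R * h by rewrite /h mulrA -[1 - _]opprB mulrN rs opprK mul1r.
have hE : h = (val h)%:R by rewrite natr_Zp.
rewrite {1}fE {1}hE -expFX conjXg expF_int asb -expF_int expFX -hE.
congr expF; rewrite intrB mulrBl -fE /h mul1r mulrBl mul1r opprB addrC subrK.
by [].
Qed.

End AffineConjugation.

Section AltGeneration.

Variables (T : finType) (P : {perm T} -> Prop).
Hypotheses (P1 : P 1%g) (PM : forall u v, P u -> P v -> P (u * v)%g).

Lemma submonoidJ u v : P u -> P v -> P (u ^ v)%g.
Proof. by move=> Pu Pv; rewrite conjgE; apply: (PM _ (PM _ _)) => //; exact: perm_expV P1 PM _ Pv. Qed.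

Lemma submonoidX u (m : nat) : P u -> P (u ^+ m)%g.
Proof. by move=> Pu; elim: m => // m IH; rewrite expgS; exact: PM. Qed.

Lemma alt_add (A : {set T}) (i al be : T) : al != be -> al \in A -> be \in A ->
    (forall u, perm_on A u -> ~~ odd_perm u -> P u) -> P (cyc3 i al be) ->
  forall u, perm_on (i |: A) u -> ~~ odd_perm u -> P u.
Proof.
move=> ab aA bA PA Pi; have AI x : x \in A -> x \in i |: A by rewrite !inE orbC => ->.
apply: (alt_ind ab (AI _ aA) (AI _ bA) P1) => u j.
rewrite !inE => jA ja jb Pu; apply: (PM Pu).
case/orP: jA => [/eqP -> //|jA]; apply: PA; first exact: cyc3_on.
by rewrite odd_cyc3.
Qed.

(** As [e] fixes [q], conjugating the given cycle by $e^m$ yields $(e^{m+1}x,\,q,\,e^mx)$. This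
    adjoins the next point of the orbit to an alternating group that already contains [q] and $e^mx$
    among its points. *)
Lemma alt_chain (e : {perm T}) (q x : T) : P e -> e q = q -> q != x ->
    P (cyc3 (e x) q x) ->
  forall u, perm_on (q |: porbit e x) u -> ~~ odd_perm u -> P u.
Proof.
move=> Pe eq qx Pc u; rewrite /perm_on.
have eX (m : nat) : (e ^+ m)%g q = q by rewrite permX; elim: m => //= m ->.
pose S (m : nat) : {set T} := q |: [set y | y \in traject e x m.+1].
suff H m : forall u, perm_on (S m) u -> ~~ odd_perm u -> P u.
  have := H #|porbit e x|.-1 u; rewrite /S prednK;
    last by rewrite card_gt0; apply/set0Pn; exists x; exact: porbit_id.
  move=> h uS; apply: h; apply: subset_trans uS _; apply/subsetP => y.
  by rewrite !inE -porbit_traject.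
elim: m => [|m IH] {}u uS ue.
  have : perm_on [set q; x] u.
    by apply: subset_trans uS _; apply/subsetP => y; rewrite !inE.
  by move/(perm_on_pair qx) ->; rewrite (negPf ue) expg0.
have Sm : S m.+1 = (e ^+ m.+1)%g x |: S m.
  apply/setP => y; rewrite /S !in_setU1 !in_set trajectSr mem_rcons in_cons -permX.
  by rewrite orbCA.
have bS : (e ^+ m)%g x \in S m.
  by rewrite /S in_setU1 in_set trajectSr mem_rcons in_cons permX eqxx orbT.
rewrite Sm in uS; apply: (alt_add (al := q) (be := (e ^+ m)%g x)) uS ue => //.
- by rewrite -{1}(eX m) (inj_eq perm_inj).
- by rewrite /S in_setU1 eqxx.
have -> : cyc3 ((e ^+ m.+1)%g x) q ((e ^+ m)%g x) = (cyc3 (e x) q x ^ (e ^+ m))%g.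
  by rewrite cyc3J eX expgS permM.
by apply: submonoidJ => //; exact: submonoidX.
Qed.

End AltGeneration.

Lemma cyc3_rot (T : finType) (a b c : T) : a != b -> a != c -> b != c ->
  cyc3 a b c = cyc3 b c a.
Proof.
move=> ab ac bc; apply/permP => x; rewrite !cyc3E //; try by rewrite eq_sym.
have [->|xa] := eqVneq x a; first by rewrite (negPf ab) (negPf ac).
by have [_|xb] := eqVneq x b.
Qed.

Lemma cyc3_tperm (T : finType) (u a b : T) : u != a -> u != b -> a != b ->
  cyc3 u a b = (tperm b u * tperm a b)%g /\ cyc3 u a b = (tperm a b * tperm a u)%g.
Proof.
move=> ua ub ab.
have nE (c d : T) : c != d -> ((c == d) = false) * ((d == c) = false).
  by move=> cd; split; [exact: negPf | rewrite eq_sym; exact: negPf].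
have ne := (nE _ _ ua, nE _ _ ub, nE _ _ ab, eqxx).
have cE v : cyc3 u a b v =
    if v == u then a else if v == a then b else if v == b then u else v by exact: cyc3E.
have tE (c d v : T) : tperm c d v = if v == c then d else if v == d then c else v by rewrite permE.
split; apply/permP => w; rewrite permM.
all: have [->|wu] := eqVneq w u; first by do 2?rewrite ?cE ?tE ?ne.
all: have [->|wa] := eqVneq w a; first by do 2?rewrite ?cE ?tE ?ne.
all: have [->|wb] := eqVneq w b; first by do 2?rewrite ?cE ?tE ?ne.
all: by do 2?rewrite ?cE ?tE ?(negPf wu) ?(negPf wa) ?(negPf wb).
Qed.

Lemma cycles_irange1 (lo hi x : int) : cycles [:: irange lo hi] x = rotz lo hi 1 x.
Proof. exact: next_irange. Qed.

Lemma cycles_irange_nseq (lo hi a b x : int) (m : nat) :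
  cycles (irange lo hi :: nseq m [:: a; b]) x = swap_if (odd m) a b (rotz lo hi 1 x).
Proof.
have swapK y : swap a b (swap a b y) = y.
  rewrite /swap; case: (eqVneq y a) => [->|ya].
    by case: (eqVneq b a) => [->|_]; rewrite ?eqxx.
  by case: (eqVneq y b) => [->|yb]; rewrite ?eqxx // (negPf ya) (negPf yb).
rewrite /cycles /= next_irange; move: (rotz _ _ _ _) => y.
elim: m y => [//|m IH] y /=; rewrite IH -[if _ then _ else _]/(swap a b y).
by case: (odd m); rewrite /swap_if /= ?swapK.
Qed.

Lemma cycles_rcons cs c x : cycles (rcons cs c) x = next c (cycles cs x).
Proof. by rewrite /cycles foldl_rcons. Qed.

Lemma cycles2 c c' x : cycles [:: c; c'] x = next c' (next c x).
Proof. by []. Qed.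

(** * Images of the words *)

Section Images.

Context {k p : nat} {kpS : setting k p}.
Local Notation p_pr := (@p_pr k p kpS).
Local Notation P := (p%:Z).
Local Notation K := (k%:Z).
Local Notation lo := (- P + K - 1).
Local Notation O := (Omega k p).
Local Notation inO x := ((lo <= x) && (x <= P + 2)).
Local Notation pt := (omega_pt (@kp k p kpS)).
Local Notation al := (pt (P + 1)).
Local Notation be := (pt (P + 2)).
Implicit Types (x i j : int) (f : 'F_p).

Context {r s : int} {alpha : 'F_p} {sa sg sy : {perm O}}.
Context {GS : gen_setting r s alpha sa sg sy}.
Local Notation rho := (r%:~R : 'F_p).
Local Notation alpha0 := (@alpha0 _ _ _ _ _ _ _ _ GS).
Local Notation alpha3 := (@alpha3 _ _ _ _ _ _ _ _ GS).
Local Notation rho_order := (@rho_order _ _ _ _ _ _ _ _ GS).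
Local Notation rho_gen := (@rho_gen _ _ _ _ _ _ _ _ GS).
Local Notation rho_s := (@rho_s _ _ _ _ _ _ _ _ GS).
Local Notation sa_acts := (@sa_acts _ _ _ _ _ _ _ _ GS).
Local Notation sg_acts := (@sg_acts _ _ _ _ _ _ _ _ GS).
Local Notation sy_acts := (@sy_acts _ _ _ _ _ _ _ _ GS).

Local Notation E e := (ev (gens sa sg sy) e).

#[local] Hint Extern 0 (is_true (alpha != _)) => exact: alpha0 : core.

Lemma rho0 : rho != 0.
Proof. by rewrite -alpha3 expf_neq0 ?alpha0. Qed.

Lemma rhoX_eq1 (i : nat) : (rho ^+ i == 1) = (p.-1 %| i)%N.
Proof. by rewrite -(expr0 rho) rho_order mod0n. Qed.

Lemma alphaX1 : alpha ^+ p.-1 = 1.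
Proof.
have [i _ ->] := rho_gen alpha0; rewrite -exprM mulnC exprM.
by have /eqP -> : rho ^+ p.-1 == 1; rewrite ?rhoX_eq1 ?expr1n.
Qed.

Lemma sg_mul : sg = (mulP alpha * cyc3 (pt P) al be)%g.
Proof.
apply: acts_as_uniq sg_acts _.
by apply: (acts_asM (acts_mulP alpha0)); apply: acts_as_cyc3; slia.
Qed.

Lemma mulP_c_commute f : f != 0 -> commute (mulP f) (cyc3 (pt P) al be).
Proof.
move=> f0; apply: perm_disjoint_commute => x; case: (OP x) => [[h ->]|[z -> /andP[hz hz']]].
  have [->|h0] := eqVneq h 0; first by left; rewrite mulP_ptF // mulr0.
  right; rewrite ptP0 cyc3E ?ptF_al ?ptF_be ?al_be //.
  by rewrite (inj_eq ptF_inj) (negPf h0) (negPf (ptF_al _)) (negPf (ptF_be _)).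
by left; rewrite mulP_out.
Qed.

Lemma sg_exp (m : nat) : (sg ^+ m)%g = (mulP (alpha ^+ m) * cyc3 (pt P) al be ^+ m)%g.
Proof. by rewrite sg_mul (expgMn _ (mulP_c_commute alpha0)) mulPX. Qed.

Lemma cz3 : (cyc3 (pt P) al be ^+ 3)%g = 1%g.
Proof. by apply: cyc3_expg3; rewrite ?ptP0 ?ptF_al ?ptF_be ?al_be. Qed.

Lemma Eb : E wb = mulP rho.
Proof. by rewrite -[LHS]/(sg ^+ 3)%g sg_exp alpha3 cz3 mulg1. Qed.

Lemma mod3_p : (p.-1 %% 3 = 1)%N. Proof. slia. Qed.

(** The exponent $p-1$ kills the multiplication by [alpha] and, being $1$ modulo $3$, leaves the
    3-cycle unchanged. The cube in $b$ does the opposite. *)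
Lemma Ez : E (wz p) = cyc3 (ptF 0) al be.
Proof.
rewrite -[LHS]/(sg ^+ p.-1)%g sg_exp alphaX1 mulP1 // mul1g.
by rewrite {1}(divn_eq p.-1 3) mod3_p expgnDr mulnC expgnA cz3 expg1n mul1g expg1 ptP0.
Qed.

Lemma sa_ptF f : sa (ptF f) = ptF (f + 1).
Proof.
have hf := repF_bound p_pr f.
rewrite /ptF (acts_as_pt _ sa_acts); last slia.
congr omega_pt; have [->|f0] := eqVneq f 0.
  have -> : repF (0 + 1 : 'F_p) = 1 by rewrite add0r -(mulr1z 1) repF_int //; slia.
  by rewrite /repF eqxx; spw.
have hf' := repF_lt p_pr f0.
have -> : f + 1 = (repF f + 1)%:~R by rewrite intrD repFK.
by rewrite repF_int //; spw.
Qed.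

Lemma sa_out x : inO x -> ~~ (1 <= x <= P) -> sa (pt x) = pt x.
Proof. by move=> hx hx'; rewrite (acts_as_pt _ sa_acts) //; congr omega_pt; pw. Qed.

Lemma sa_exp (m : nat) f : (sa ^+ m)%g (ptF f) = ptF (f + m%:R).
Proof.
elim: m f => [|m IH] f; first by rewrite expg0 perm1 addr0.
by rewrite expgS permM sa_ptF IH -addrA -[1]/(1%:R) -natrD add1n.
Qed.

Lemma sa_exp_out (m : nat) x : inO x -> ~~ (1 <= x <= P) -> (sa ^+ m)%g (pt x) = pt x.
Proof. by move=> hx hx'; rewrite permX; elim: m => //= m ->; rewrite sa_out. Qed.

Lemma sa_expP : (sa ^+ p = 1)%g.
Proof.
apply/permP => x; rewrite perm1; case: (OP x) => [[h ->]|[z -> /andP[hz hz']]].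
  by rewrite sa_exp (pchar_Fp_0 p_pr) addr0.
by rewrite sa_exp_out.
Qed.

Lemma sa_expz i f : gexpz sa i (ptF f) = ptF (f + i%:~R).
Proof.
case: i => m; first by rewrite /= sa_exp.
by rewrite /= expVgn; apply: (canLR (permK _)); rewrite sa_exp NegzE intrN subrK.
Qed.

Lemma sa_expz_out i x : inO x -> ~~ (1 <= x <= P) -> gexpz sa i (pt x) = pt x.
Proof.
move=> hx hx'; case: i => m; first exact: sa_exp_out.
by rewrite /= expVgn; apply: (canLR (permK _)); rewrite sa_exp_out.
Qed.

Lemma Ezi i : E (wzi p i) = cyc3 (ptF i%:~R) al be.
Proof.
rewrite /wzi evJ Ez cyc3J -[ev _ (EPow _ _)]/(gexpz sa i) sa_expz add0r.
by rewrite !sa_expz_out //; slia.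
Qed.

Lemma Ezi_int i : 1 <= i <= P -> E (wzi p i) = cyc3 (pt i) al be.
Proof. by move=> hi; rewrite Ezi ptF_int. Qed.

Lemma Edij i j : i%:~R != j%:~R :> 'F_p ->
  E (wdij p i j) = (tperm (ptF i%:~R) (ptF j%:~R) * tperm al be)%g.
Proof.
move=> ij; rewrite -[LHS]/(E (wzi p i) * (E (wzi p j))^-1 * E (wzi p i))%g !Ezi.
by apply: cyc3_mulV; rewrite ?ptF_al ?ptF_be ?al_be // (inj_eq ptF_inj).
Qed.

Lemma Fp_int_eq x y : 1 <= x <= P -> 1 <= y <= P -> (x%:~R == y%:~R :> 'F_p) = (x == y).
Proof.
move=> hx hy; apply/eqP/eqP => [h|->//].
by rewrite -(repF_int p_pr hx) h repF_int.
Qed.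

Lemma Edij_int i j : 1 <= i <= P -> 1 <= j <= P -> i != j ->
  E (wdij p i j) = (tperm (pt i) (pt j) * tperm al be)%g.
Proof. by move=> hi hj ij; rewrite Edij ?ptF_int // Fp_int_eq. Qed.

Lemma acts_tt i j : 1 <= i <= P -> 1 <= j <= P -> i != j ->
  acts_as (tperm (pt i) (pt j) * tperm al be)%g (swap (P + 1) (P + 2) \o swap i j).
Proof. by move=> hi hj ij; apply: acts_asM; apply: acts_as_tperm; slia. Qed.

Lemma acts_x : acts_as (E (wx p)) (swap (P + 1) (P + 2) \o swap 1 P).
Proof.
have E0 : (0%:~R : 'F_p) = P%:~R by rewrite Fp_P.
rewrite /wx Edij E0; last by rewrite Fp_int_eq; slia.
rewrite !ptF_int; try slia.
by rewrite tpermC; apply: acts_tt; slia.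
Qed.

Lemma acts_ax : acts_as (E (EMul wa (wx p))) (swap (P + 1) (P + 2) \o rotz 1 (P - 1) 1).
Proof.
apply: acts_as_eq (acts_asM sa_acts acts_x) _ => x hx /=.
by spw.
Qed.

#[local] Hint Extern 0 (is_true (rho != _)) => exact: rho0 : core.

Lemma half_p : [/\ p.-1 = (2 * p.-1./2)%N, p.+1./2 = p.-1./2.+1, odd p.-1./2
  & (5 <= p.-1./2)%N].
Proof. by split; slia. Qed.

Lemma rho_half : rho ^+ p.-1./2 = -1.
Proof.
have [e1 _ _ e5] := half_p.
have : (rho ^+ p.-1./2) ^+ 2 == 1 by rewrite -exprM rhoX_eq1 mulnC -e1.
rewrite sqrf_eq1 rhoX_eq1 => /orP[/dvdn_leq h|/eqP //].
by have := h (ltn_trans _ e5); slia.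
Qed.

Lemma Eb2 : E (wb2 p) = mulP (- 1).
Proof. by rewrite -[LHS]/((E wb) ^+ p.-1./2)%g Eb mulPX // rho_half. Qed.

Lemma acts_b2 : acts_as (E (wb2 p)) (fun x => if (1 <= x) && (x <= P - 1) then P - x else x).
Proof.
rewrite Eb2; have n10 : -1 != 0 :> 'F_p by rewrite oppr_eq0 oner_eq0.
apply: acts_as_eq (acts_mulP n10) _ => x hx; rewrite mulFE //; case: ifP => // hx'.
rewrite mulN1r; have -> : - x%:~R = (P - x)%:~R :> 'F_p by rewrite intrB Fp_P // sub0r.
by rewrite repF_int //; slia.
Qed.

Lemma bX_p1 : (E wb ^+ p.-1 = 1)%g.
Proof.
rewrite Eb mulPX //; have /eqP -> : rho ^+ p.-1 == 1 by rewrite rhoX_eq1.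
by rewrite mulP1.
Qed.

Lemma rho_neq1 : rho != 1.
Proof.
rewrite -(expr1 rho) rhoX_eq1; apply/negP => /dvdn_leq h.
by have := h isT; have [? ? ? ?] := half_p; lia.
Qed.

Let beta := (E wb ^+ 2 * E (wzi p 1) * E (wzi p r))%g.

(** The two long cycles of [beta]: the even powers of $r$ followed by $p+2$, and the odd powers
    followed by $p+1$. The index $j=(p-1)/2$ is the last one, so both have length $(p+1)/2$. *)
Let Q (e : bool) (j : nat) : O :=
  if (j < p.-1./2)%N then ptF (rho ^+ (2 * j + e)) else if e then al else be.

Lemma betaE : beta = (mulP (rho ^+ 2) * (tperm (ptF 1) be * tperm al (ptF rho)))%g.
Proof.
rewrite /beta Eb mulPX // !Ezi -mulgA mulr1z cyc3_mul ?ptF_al ?ptF_be ?al_be //.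
by rewrite (inj_eq ptF_inj) eq_sym rho_neq1.
Qed.

Lemma beta_tperm (f : 'F_p) : let u := (tperm (ptF 1) be * tperm al (ptF rho))%g in
  [/\ u be = ptF 1, u al = ptF rho, u (ptF 1) = be, u (ptF rho) = al
    & f != 1 -> f != rho -> u (ptF f) = ptF f].
Proof.
have ae : (al == be) = false by exact: negPf al_be.
have r1 : rho != 1 := rho_neq1.
split; last move=> f1 fr; rewrite permM.
- by rewrite tpermR tpermD ?(inj_eq ptF_inj) // eq_sym ptF_al.
- by rewrite (@tpermD _ _ _ al) ?tpermL ?ptF_al // eq_sym al_be.
- by rewrite tpermL tpermD ?al_be // ptF_be.
- rewrite (@tpermD _ _ _ (ptF rho)) ?tpermR ?(inj_eq ptF_inj) // 1?eq_sym ?ptF_be //.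
rewrite !tpermD ?(inj_eq ptF_inj) // 1?eq_sym ?ptF_al ?ptF_be //.
Qed.

Lemma beta_Q (e : bool) (j : nat) : (j <= p.-1./2)%N ->
  beta (Q e j) = Q e (if j == p.-1./2 then 0 else j.+1)%N.
Proof.
have [e1 e2 e3 e5] := half_p.
have r20 : rho ^+ 2 != 0 by rewrite expf_neq0 ?rho0.
rewrite betaE permM leq_eqVlt /Q => /orP[/eqP ->|jm].
  rewrite ltnn eqxx (ltn_trans _ e5) // muln0 add0n.
  have [tb ta _ _ _] := beta_tperm 0.
  by case: e; rewrite ?mulP_al ?mulP_be ?ta ?tb //= ?expr1 ?expr0.
rewrite jm (ltn_eqF jm) mulP_ptF // -exprD.
have -> : (2 + (2 * j + e) = 2 * j.+1 + e)%N by lia.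
have [_ _ t1 tr tf] := beta_tperm (rho ^+ (2 * j.+1 + e)).
have [jm'|jm'] := ltnP j.+1 p.-1./2.
  apply: tf.
    by rewrite rhoX_eq1; apply/negP => /dvdn_leq h; have := h isT; case: (e); lia.
  rewrite -[X in _ != X](expr1 rho) rho_order !modn_small; by case: (e); lia.
have jE : j.+1 = p.-1./2 by lia.
have -> : rho ^+ (2 * j.+1 + e) = rho ^+ e.
  by rewrite jE -e1 exprD; have /eqP -> : rho ^+ p.-1 == 1; rewrite ?mul1r ?rhoX_eq1.
by case: (e); rewrite /= ?expr1 ?expr0 ?t1 ?tr.
Qed.

(** The exponent $(p+1)/2$ in $h$ is the common length of the two cycles [Q true] and [Q false];
    [beta] fixes all other points. *)
Lemma Eh : E (wh p r) = 1%g.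
Proof.
have [e1 e2 e3 e5] := half_p.
rewrite -[LHS]/(beta ^+ p.+1./2)%g e2.
have iterQ (e : bool) (j : nat) : (j <= p.-1./2)%N -> iter j beta (Q e 0%N) = Q e j.
  elim: j => [|j IH] jm; first by rewrite /Q (ltn_trans _ e5).
  by rewrite /= IH ?beta_Q ?(ltn_eqF jm) // ltnW.
have cyc : forall (b : bool) (j : nat), (j <= p.-1./2)%N ->
    (beta ^+ p.-1./2.+1)%g (Q b j) = Q b j.
  move=> b j jm; rewrite permX -{1}(iterQ b j jm) -iterD addnC iterD /= iterQ // beta_Q //.
  by rewrite eqxx iterQ.
apply/permP => x; rewrite perm1; case: (OP x) => [[f ->]|[z -> /andP[hz hz']]].
  have [->|f0] := eqVneq f 0; last first.
    have [i ip ->] := rho_gen f0; have := cyc (odd i) i./2.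
    by rewrite /Q ifT; [rewrite mul2n addnC odd_double_half; apply; lia | lia].
  have fix0 : beta (ptF 0) = ptF 0.
    have [_ _ _ _ tf] := beta_tperm 0.
    rewrite betaE permM mulP_ptF ?expf_neq0 ?rho0 // mulr0 tf //.
    by rewrite eq_sym rho0.
  by rewrite permX; elim: {1}(p.-1./2.+1) => //= j ->.
have [->|za] := eqVneq z (P + 1).
  by have := cyc true p.-1./2 (leqnn _); rewrite /Q ltnn.
have [->|zb] := eqVneq z (P + 2).
  by have := cyc false p.-1./2 (leqnn _); rewrite /Q ltnn.
have fixz : beta (pt z) = pt z.
  have h1 : ptF 1 != pt z by rewrite -(mulr1z 1) ptF_int ?pt_eq; slia.
  have h2 : ptF rho != pt z.
    by have hr := repF_bound p_pr rho; rewrite /ptF pt_eq; slia.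
  rewrite betaE 2!permM mulP_out ?expf_neq0 ?rho0 // tpermD ?tpermD // pt_eq //; slia.
by rewrite permX; elim: {1}(p.-1./2.+1) => //= j ->.
Qed.

Lemma acts_as_conj (u v : {perm O}) (f g g' : int -> int) : acts_as u f -> acts_as v g ->
  (forall x, inO x -> inO (g' x) /\ g (g' x) = x) -> acts_as (u ^ v)%g (g \o f \o g').
Proof.
move=> uf vg gg; rewrite conjgE.
by apply: acts_as_eq (acts_asM (acts_asV kp vg gg) (acts_asM uf vg)) _.
Qed.

Lemma cyc3_conj_acts (v : {perm O}) (g : int -> int) x1 x2 x3 : acts_as v g ->
    inO x1 -> inO x2 -> inO x3 -> x1 != x2 -> x1 != x3 -> x2 != x3 ->
  acts_as (cyc3 (pt x1) (pt x2) (pt x3) ^ v)%g (c3f (g x1) (g x2) (g x3)).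
Proof.
move=> vg h1 h2 h3 n12 n13 n23; rewrite cyc3J.
have gO x : inO x -> inO (g x) by move=> hx; rewrite -(val_pt kp hx) -vg valO.
have vE x : inO x -> val (v (pt x)) = g x by move=> hx; rewrite vg val_pt.
have vptE x : inO x -> v (pt x) = pt (g x) by move=> hx; apply: acts_as_pt vg hx.
have ne x y : inO x -> inO y -> x != y -> g x != g y.
  by move=> hx hy; rewrite -!vE // (inj_eq val_inj) (inj_eq perm_inj) pt_eq.
by rewrite !vptE //; apply: acts_as_cyc3; auto.
Qed.

Lemma acts_z : acts_as (E (wz p)) (c3f P (P + 1) (P + 2)).
Proof. by rewrite Ez -ptP0; apply: acts_as_cyc3; slia. Qed.

Lemma acts_axX (m : nat) : (m <= p.-2)%N -> acts_as (E (EMul wa (wx p)) ^+ m)%g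
  (fun x => swap_if (odd m) (P + 1) (P + 2) (rotz 1 (P - 1) m x)).
Proof.
elim: m => [|m IH] hm.
  by rewrite expg0; apply: acts_as_eq (@acts_as1 k p) _ => x hx; spw.
rewrite expgSr; apply: acts_as_eq (acts_asM (IH _) acts_ax) _; first lia.
by move=> x hx /=; case: (odd m); spw.
Qed.

(** Shifting by $-j$, rotating $1,\ldots,p-1$ by $j-i$ and shifting back by $i$ has net effect zero,
    except where the middle rotation wraps in its shorter cycle, which costs one extra step. That
    happens for $i,\ldots,j-1$; the point $j$ is sent to $p$, which $ax$ fixes, and lands on $i$. *)
Lemma acts_c_low i j : 1 <= i -> i <= j -> j <= P - 1 ->
  acts_as (E (wc_low p i j))
    (fun x => swap_if (odd `|(j - i)%R|%N) (P + 1) (P + 2) (rotz i j 1 x)).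
Proof.
move=> h1 h2 h3.
have aj : acts_as (gexpz sa (- j)) (rotz 1 P (P - j)).
  by apply: acts_as_eq (acts_as_rotzN kp _ _ _ _ _ sa_acts) _; try slia; move=> x hx; spw.
have ai : acts_as (gexpz sa i) (rotz 1 P i) by apply: (acts_as_rotz kp) sa_acts; slia.
have [m mE] : exists m : nat, j - i = m%:Z by exists `|(j - i)%R|%N; lia.
rewrite mE; have am : acts_as (gexpz (E (EMul wa (wx p))) m)
    (fun x => swap_if (odd m) (P + 1) (P + 2) (rotz 1 (P - 1) m x)).
  by apply: acts_axX; slia.
rewrite /wc_low mE; apply: acts_as_eq (acts_asM (acts_asM aj am) ai) _ => x hx /=.
by case: (odd m); spw.
Qed.

Lemma acts_za : acts_as (E (EMul (wz p) wa)) (rotz 1 (P + 2) 1).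
Proof. by apply: acts_as_eq (acts_asM acts_z sa_acts) _ => x hx /=; spw. Qed.

Lemma acts_zaN (m : int) : 0 <= m -> m <= P + 2 ->
  acts_as (gexpz (E (EMul (wz p) wa)) (- m)) (rotz 1 (P + 2) (P + 2 - m)).
Proof.
move=> h1 h2; apply: acts_as_eq (acts_as_rotzN kp _ _ _ _ _ acts_za) _; try slia.
by move=> x hx; spw.
Qed.

Lemma acts_zconj (e : expr 'I_3) (g : int -> int) : acts_as (E e) g ->
  acts_as (E (econj (wz p) e)) (c3f (g P) (g (P + 1)) (g (P + 2))).
Proof.
by move=> eg; rewrite evJ Ez -ptP0; apply: cyc3_conj_acts; rewrite ?eg //; slia.
Qed.

(** The conjugate of $z$ is $(p-2,p-1,p)$, which prolongs the cycle $(i,\ldots,p-2)$ by two points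
    without changing the parity of its length. *)
Lemma acts_c_p i : 1 <= i -> i <= P - 2 ->
  acts_as (E (wc_p p i))
    (fun x => swap_if (odd `|(P - i)%R|%N) (P + 1) (P + 2) (rotz i P 1 x)).
Proof.
move=> h1 h2; have za : acts_as (E (EPow (EMul (wz p) wa) (- 2))) (rotz 1 (P + 2) (P + 2 - 2)).
  by apply: acts_zaN; slia.
apply: acts_as_eq (acts_asM (acts_zconj za) (@acts_c_low i (P - 2) h1 _ _)) _; try lia.
move=> x hx /=; have -> : odd `|(P - i)%R|%N = odd `|(P - 2 - i)%R|%N by lia.
by case: (odd _); spw.
Qed.

Lemma acts_c i j : wcij_defined p i j ->
  acts_as (E (wcij p i j))
    (fun x => swap_if (odd `|(j - i)%R|%N) (P + 1) (P + 2) (rotz i j 1 x)).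
Proof.
rewrite /wcij_defined /wcij => hij.
case: eqP => jP; first by rewrite jP; apply: acts_c_p; lia.
case: eqP => jP1; first rewrite jP1.
  have za : acts_as (E (EPow (EMul (wz p) wa) (- 1))) (rotz 1 (P + 2) (P + 2 - 1)).
    by apply: acts_zaN; slia.
  apply: acts_as_eq (acts_asM (acts_zconj za) (@acts_c_low i (P - 1) _ _ _)) _; try lia.
  have hi : (1 <= i) && (i <= P - 1) by lia.
  move=> x hx /=; have -> : odd `|(P + 1 - i)%R|%N = odd `|(P - 1 - i)%R|%N by lia.
  by clear hij jP jP1; case: (odd _); spw.
case: eqP => jP2; last by apply: acts_c_low; lia.
rewrite jP2.
apply: acts_as_eq (acts_asM acts_z (@acts_c_p i _ _)) _; try lia.
have hi : (1 <= i) && (i <= P - 2) by lia.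
move=> x hx /=; have -> : odd `|(P + 2 - i)%R|%N = odd `|(P - i)%R|%N by lia.
by clear hij jP jP1 jP2; case: (odd _); spw.
Qed.

Lemma acts_cbul : acts_as (E (wcbul p)) (fun x =>
  if (1 <= x) && (x <= p.-1./2) then rotz 1 p.-1./2 1 x
  else if (p.+1./2%:Z <= x) && (x <= P - 1) then (if x == p.+1./2%:Z then P - 1 else x - 1)
  else x).
Proof.
have c1 : acts_as (E (wcij p 1 p.-1./2)) (rotz 1 p.-1./2 1).
  apply: acts_as_eq (acts_c _) _; rewrite /wcij_defined; try slia.
  by move=> x hx; rewrite /swap_if ifF; slia.
have c2 : acts_as (E (wcij p p.+1./2 p.-1)) (rotz p.+1./2 (P - 1) 1).
  apply: acts_as_eq (acts_c _) _; rewrite /wcij_defined; try slia.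
  by move=> x hx; rewrite /swap_if ifF; [have -> : p.-1%:Z = P - 1 by slia | slia].
pose g x := if (p.+1./2%:Z <= x) && (x <= P - 1) then (if x == p.+1./2%:Z then P - 1 else x - 1) else x.
have c2V : acts_as (E (wcij p p.+1./2 p.-1))^-1%g g.
  by apply: (acts_asV kp c2) => x hx; rewrite /g; spw.
apply: acts_as_eq (acts_asM c1 c2V) _ => x hx /=; rewrite /g; spw.
Qed.

(** For $0 \le m \le (p-1)/2$, the $m$-th power of $c_\bullet d(1,-1)$. That element is the
    $(p-1)$-cycle running up through $1,\ldots,(p-1)/2$ and then down through $p-1,\ldots,(p+1)/2$,
    times $(p+1,p+2)$. Half a turn sends $x$ to $p-x$, and $(p-1)/2$ is odd, so the transposition
    survives in $v$. *)
Definition half_turn (m : nat) (x : int) : int :=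
  if (1 <= x) && (x <= p.-1./2) then
    (if x + m%:Z <= p.-1./2 then x + m%:Z else P + p.-1./2%:Z - x - m%:Z)
  else if (p.+1./2%:Z <= x) && (x <= P - 1) then
    (if p.+1./2%:Z <= x - m%:Z then x - m%:Z else p.+1./2%:Z - x + m%:Z)
  else swap_if (odd m) (P + 1) (P + 2) x.

Lemma acts_cbul_d : acts_as (E (EMul (wcbul p) (wdij p 1 (-1)))) (half_turn 1).
Proof.
have Em : (-1)%:~R = (P - 1)%:~R :> 'F_p by rewrite intrB Fp_P // sub0r mulrNz.
have d : acts_as (E (wdij p 1 (-1))) (swap (P + 1) (P + 2) \o swap 1 (P - 1)).
  rewrite Edij Em ?Fp_int_eq //; try slia.
  by rewrite !ptF_int; try slia; apply: acts_tt; slia.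
by apply: acts_as_eq (acts_asM acts_cbul d) _ => x hx /=; rewrite /half_turn; spw.
Qed.

Lemma acts_cbul_dX (m : nat) : (m <= p.-1./2)%N ->
  acts_as (E (EMul (wcbul p) (wdij p 1 (-1))) ^+ m)%g (half_turn m).
Proof.
elim: m => [|m IH] hm.
  by rewrite expg0; apply: acts_as_eq (@acts_as1 k p) _ => x hx; rewrite /half_turn; spw.
rewrite expgSr; apply: acts_as_eq (acts_asM (IH _) acts_cbul_d) _; first lia.
by move=> x hx /=; rewrite /half_turn /=; case: (odd m); spw.
Qed.

Lemma acts_v : acts_as (E (wv p))
  (fun x => if (1 <= x) && (x <= P - 1) then P - x else swap (P + 1) (P + 2) x).
Proof.
apply: acts_as_eq (acts_cbul_dX (leqnn _)) _ => x hx.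
have [_ _ om _] := half_p.
by rewrite /half_turn om; spw.
Qed.

Lemma Et : E (wt p) = tperm al be.
Proof.
apply: (acts_as_uniq _ (acts_as_tperm kp _ _)); try slia.
by apply: acts_as_eq (acts_asM acts_v acts_b2) _ => x hx /=; spw.
Qed.

Lemma acts_t : acts_as (E (wt p)) (swap (P + 1) (P + 2)).
Proof. by rewrite Et; apply: acts_as_tperm; slia. Qed.

Lemma Ewatil : E (watil p) = cyc3 (pt 3) (pt 1) (pt 2).
Proof.
have h1 : acts_as (E (wzi p 1)) (c3f 1 (P + 1) (P + 2)).
  by rewrite Ezi_int; last slia; apply: acts_as_cyc3; slia.
have h2 : acts_as (E (wzi p 2)) (c3f 2 (P + 1) (P + 2)).
  by rewrite Ezi_int; last slia; apply: acts_as_cyc3; slia.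
rewrite /watil evJ Ezi_int; last slia.
apply: (acts_as_uniq (f := c3f 1 2 3)); last first.
  apply: acts_as_eq (acts_as_cyc3 kp (x := 3) (y := 1) (z := 2) _ _ _ _ _ _) _; try slia.
  by move=> x hx /=; spw.
apply: acts_as_eq (cyc3_conj_acts (acts_asM h2 h1) _ _ _ _ _ _) _; try slia.
by move=> x hx /=; spw.
Qed.

Lemma acts_wd : acts_as (E (wd p)) (rotz 5 (P + 2) 1).
Proof.
apply: acts_as_eq (acts_c _) _; rewrite /wcij_defined; try slia.
by move=> x hx /=; rewrite /swap_if ifF; [spw | slia].
Qed.

Lemma acts_cV i j : 1 <= i -> i <= j -> j <= P + 2 -> i <= P - 2 -> acts_as (E (wcij p i j))
    (fun x => swap_if (odd `|(j - i)%R|%N) (P + 1) (P + 2) (rotz i j 1 x)) ->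
  acts_as (E (wcij p i j))^-1%g
    (fun x => rotz i j (j - i) (swap_if (odd `|(j - i)%R|%N) (P + 1) (P + 2) x)).
Proof.
by move=> h1 h2 h3 h4 c; apply: (acts_asV kp c) => x hx; case: (odd _); spw.
Qed.

Section WordsCAndE.

Variable n : nat.
Hypotheses (kE : kpar n p = k) (nk : odd n = odd k).

Lemma acts_wc : acts_as (E (wc n p)) (rotz (if odd n then 2 else 1) K 1).
Proof.
rewrite /wc kE nk; have [ok|ok] := boolP (odd k).
  apply: acts_as_eq (acts_asM (acts_c _) acts_t) _; rewrite /wcij_defined; try slia.
  by move=> x hx /=; rewrite /swap_if ifT; [spw | slia].
apply: acts_as_eq (acts_asM (acts_c _) acts_t) _; rewrite /wcij_defined; try slia.
by move=> x hx /=; rewrite /swap_if ifT; [spw | slia].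
Qed.

Definition efun (x : int) : int :=
  if x == 1 then (if odd n then 2 else K + 1)
  else if odd n && (x == 2) then K + 1
  else if (K + 1 <= x) && (x <= P + 1) then x + 1
  else if x == P + 2 then 1 else x.

Lemma acts_we : acts_as (E (we n p)) efun.
Proof.
have zat : acts_as (E (EMul (EMul (wz p) wa) (wt p))) (swap (P + 1) (P + 2) \o rotz 1 (P + 2) 1).
  exact: acts_asM acts_za acts_t.
rewrite /we /efun kE nk; have [ok|ok] := boolP (odd k).
  have c : wcij_defined p 3 k.+1 by rewrite /wcij_defined; slia.
  apply: acts_as_eq (acts_asM zat (acts_cV _ _ _ _ (acts_c c))) _; try slia.
  by move=> x hx /=; rewrite /swap_if ifT; [spw | slia].
have c : wcij_defined p 2 k.+1 by rewrite /wcij_defined; slia.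
apply: acts_as_eq (acts_asM zat (acts_cV _ _ _ _ (acts_c c))) _; try slia.
by move=> x hx /=; rewrite /swap_if ifT; [spw | slia].
Qed.

End WordsCAndE.

Lemma flip_inO x : inO x -> inO (flip k p x) /\ flip k p (flip k p x) = x.
Proof. by move=> hx; rewrite /flip; split; ssplit; slia. Qed.

Lemma acts_conj_y (u : {perm O}) (f : int -> int) : acts_as u f ->
  acts_as (u ^ sy)%g (flip k p \o f \o flip k p).
Proof. by move=> uf; apply: acts_as_conj uf sy_acts flip_inO. Qed.

Lemma acts_d i j : 1 <= i <= P -> 1 <= j <= P -> i != j ->
  acts_as (E (wdij p i j)) (swap (P + 1) (P + 2) \o swap i j).
Proof. by move=> hi hj ij; rewrite Edij_int //; apply: acts_tt. Qed.

(** The innermost $m+1$ transpositions of the image of $y$. *)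
Definition pairswap (m x : int) : int :=
  if ((- m <= x) && (x <= 0)) || ((K + 1 <= x) && (x <= K + 1 + m)) then K + 1 - x else x.

Lemma acts_xtil n : kpar n p = k -> (k + 2 <= p)%N ->
  acts_as (E (wxtil n p)) (pairswap 1).
Proof.
move=> kE kp2; rewrite /wxtil kE evJ.
have d1 : acts_as (E (wdij p 1 k.+2)) (swap (P + 1) (P + 2) \o swap 1 (K + 2)).
  have -> : K + 2 = k.+2%:Z by lia.
  by apply: acts_d; slia.
have d2 : acts_as (E (wdij p 2 k.+1)) (swap (P + 1) (P + 2) \o swap 2 (K + 1)).
  have -> : K + 1 = k.+1%:Z by lia.
  by apply: acts_d; slia.
have d12 : acts_as (E (EMul (wdij p 1 k.+2) (wdij p 2 k.+1))) (swap 1 (K + 2) \o swap 2 (K + 1)).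
  by apply: acts_as_eq (acts_asM d1 d2) _ => x hx /=; spw.
have d12y : acts_as (E (EMul (econj (wdij p 1 k.+2) wy) (econj (wdij p 2 k.+1) wy)))
    (swap 1 (- 1) \o swap 2 0).
  rewrite evM !evJ -conjMg; apply: acts_as_eq (acts_conj_y d12) _ => x hx /=.
  by rewrite /flip; spw.
apply: acts_as_eq (acts_as_conj d12 d12y (g' := swap 1 (- 1) \o swap 2 0) _) _ => x hx /=.
  by spw.
by rewrite /pairswap; spw.
Qed.

Definition ufun (x : int) : int :=
  if (1 <= x) && (x <= K - 2) then x + 2
  else if x == K - 1 then 0
  else if (K <= x) && (x <= P + 1) then x + 1
  else if x == P + 2 then 2
  else if x == lo then 1 else x - 1.

Definition ufunV (x : int) : int :=
  if (3 <= x) && (x <= K) then x - 2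
  else if x == 0 then K - 1
  else if (K + 1 <= x) && (x <= P + 2) then x - 1
  else if x == 2 then P + 2
  else if x == 1 then lo else x + 1.

Lemma acts_u : (k + 2 <= p)%N -> acts_as (E (wu p)) ufun.
Proof.
move=> kp2; rewrite /wu evM evJ.
apply: acts_as_eq (acts_asM acts_za (acts_conj_y acts_za)) _ => x hx /=.
by rewrite /flip /ufun; spw.
Qed.

Lemma acts_uV : (k + 2 <= p)%N -> acts_as (E (wu p))^-1%g ufunV.
Proof.
move=> kp2; apply: (acts_asV kp (acts_u kp2)) => x hx.
by split; rewrite /ufunV /ufun; ssplit; slia.
Qed.

(** Conjugation by the square of [ufun] pushes every pair two places outwards and so makes room for
    the two innermost pairs, which the leading [pairswap 1] supplies. *)
Lemma pairswap_u (m x : int) : 1 <= m -> K + m + 3 <= P + 2 -> (k + 2 <= p)%N -> inO x ->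
  ufun (ufun (pairswap m (ufunV (ufunV (pairswap 1 x))))) = pairswap (m + 2) x.
Proof.
move=> h1 h2 h3 hx.
have [hx0|hx0] := boolP (((- 1 <= x) && (x <= 0)) || ((K + 1 <= x) && (x <= K + 1 + 1))).
  by rewrite [pairswap 1 x]/pairswap hx0 /ufunV; ssplit; try slia;
     rewrite /pairswap; ssplit; try slia; rewrite /ufun; ssplit; slia.
rewrite [pairswap 1 x]/pairswap (negPf hx0) /ufunV; ssplit; try slia;
     rewrite /pairswap; ssplit; try slia; rewrite /ufun; ssplit; slia.
Qed.

(** * The word $w$ evaluates to the image of $y$ *)

Section WordW.

Variable n : nat.
Hypotheses (kE : kpar n p = k) (nk : odd n = odd k).

Let X := E (wxtil n p).
Let U := E (wu p).

(** The product telescopes to $X\,X^{U^2}\cdots X^{U^{2j}}$. Writing it as a power of $XU^{-2}$ is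
    what keeps $w$ short. *)
Lemma acts_telescope (j : nat) : (k + 2 <= p)%N -> (k + 2 * j <= p)%N ->
  acts_as ((X * (U^-1 ^+ 2)) ^+ j * X * U ^+ (2 * j))%g (pairswap (2 * j + 1)%N).
Proof.
move=> kp2; elim: j => [|j IH] hj.
  by rewrite muln0 expg0 mul1g expg0 mulg1; exact: (acts_xtil kE).
have shift (H : groupType) (f g : H) : ((f * (g^-1 ^+ 2)) ^+ j.+1 * f * g ^+ (2 * j.+1) =
    f * g^-1 * g^-1 * ((f * (g^-1 ^+ 2)) ^+ j * f * g ^+ (2 * j)) * g * g)%g.
  by rewrite mulnS addnC expgnDr (expgS _ j) !expg2 !mulgA.
rewrite shift.
have XP : acts_as X (pairswap 1) by exact: (acts_xtil kE).
have uP : acts_as U (ufun) by exact: (acts_u kp2).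
have uV : acts_as U^-1%g (ufunV) by exact: (acts_uV kp2).
apply: acts_as_eq (acts_asM (acts_asM (acts_asM (acts_asM (acts_asM XP uV) uV) (IH _)) uP) uP) _.
  lia.
move=> x hx /=.
have -> : ((2 * j.+1 + 1)%N)%:Z = (2 * j + 1)%N%:Z + 2 by lia.
by apply: (pairswap_u); slia.
Qed.

Lemma acts_tconj (e : expr 'I_3) (g : int -> int) : acts_as (E e) g ->
  acts_as (E (econj (wt p) e)) (swap (g (P + 1)) (g (P + 2))).
Proof.
move=> eg; rewrite evJ Et tpermJ.
have gO x : inO x -> inO (g x) by move=> hx; rewrite -(val_pt kp hx) -eg valO.
rewrite !(acts_as_pt _ eg); try slia.
by apply: acts_as_tperm; apply: gO; slia.
Qed.

Lemma acts_zconj_to (e : expr 'I_3) (g : int -> int) (x1 x2 x3 : int) : acts_as (E e) g ->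
  g P = x1 -> g (P + 1) = x2 -> g (P + 2) = x3 -> acts_as (E (econj (wz p) e)) (c3f x1 x2 x3).
Proof. by move=> eg <- <- <-; exact: acts_zconj. Qed.

Lemma acts_tconj_to (e : expr 'I_3) (g : int -> int) (x1 x2 : int) : acts_as (E e) g ->
  g (P + 1) = x1 -> g (P + 2) = x2 -> acts_as (E (econj (wt p) e)) (swap x1 x2).
Proof. by move=> eg <- <-; exact: acts_tconj. Qed.

Lemma acts_saV : acts_as sa^-1%g (rotz 1 P (P - 1)).
Proof. by apply: acts_as_eq (acts_as_rotV kp _ _ _ _ _ sa_acts) _; try slia; move=> x hx; spw. Qed.

Lemma acts_zV : acts_as (E (wz p))^-1%g (c3f P (P + 2) (P + 1)).
Proof. by apply: (acts_asV kp acts_z) => x hx; spw. Qed.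

Lemma Eww : E (ww n p) = sy.
Proof.
apply: acts_as_uniq _ sy_acts; rewrite /ww kE.
have aE : acts_as (E wa) (rotz 1 P 1) by exact: sa_acts.
have yE : acts_as (E wy) (flip k p) by exact: sy_acts.
have aVE : acts_as (E (EPow wa (-1))) (rotz 1 P (P - 1)) by exact: acts_saV.
have zVE : acts_as (E (EPow (wz p) (-1))) (c3f P (P + 2) (P + 1)) by exact: acts_zV.
have MM (e1 e2 : expr 'I_3) (f1 g : int -> int) :
    acts_as (E e1) f1 -> acts_as (E e2) g -> acts_as (E (EMul e1 e2)) (g \o f1).
  exact: acts_asM.
have zE := acts_z.
case: eqP => kp1.
  have h1 : acts_as (E (econj (wt p) (EMul wy (wz p)))) (swap (P + 2) 0).
    by apply: (acts_tconj_to (MM _ _ _ _ yE zE)); rewrite /= /flip; spw.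
  by apply: acts_as_eq h1 _ => x hx; rewrite /flip; spw.
case: eqP => kp0.
  have h1 : acts_as (E (econj (wz p) (EMul wy (EPow (wz p) (-1))))) (c3f (P + 2) 0 (- 1)).
    by apply: (acts_zconj_to (MM _ _ _ _ yE zVE)); rewrite /= /flip; spw.
  have h2 : acts_as (E (econj (wz p) (EMul wy (wz p)))) (c3f (P + 1) 0 (- 1)).
    by apply: (acts_zconj_to (MM _ _ _ _ yE zE)); rewrite /= /flip; spw.
  apply: acts_as_eq (MM _ _ _ _ h1 h2) _ => x hx /=.
  by rewrite /flip; spw.
case: eqP => kpm.
  have d1 : acts_as (E (wdij p 1 p)) (swap (P + 1) (P + 2) \o swap 1 P) by apply: acts_d; slia.
  have dt : acts_as (E (EMul (wdij p 1 p) (wt p))) (swap 1 P).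
    by apply: acts_as_eq (MM _ _ _ _ d1 acts_t) _ => x hx /=; spw.
  have yaV := MM _ _ _ _ yE aVE.
  have dtc : acts_as (E (econj (EMul (wdij p 1 p) (wt p)) (EMul wy (EPow wa (-1))))) (swap 0 P).
    rewrite evJ; apply: acts_as_eq (acts_as_conj dt yaV (g' := flip k p \o rotz 1 P 1) _) _ => x hx /=.
      by rewrite /flip; spw.
    by rewrite /flip; spw.
  have h1 : acts_as (E (econj (wz p) (EMul (EMul (EMul wa wy) (EPow wa (-1))) (EPow (wz p) (-1)))))
      (c3f (P + 2) (- 1) (- 2)).
    by apply: (acts_zconj_to (MM _ _ _ _ (MM _ _ _ _ (MM _ _ _ _ aE yE) aVE) zVE)); rewrite /= /flip; spw.
  have h2 : acts_as (E (econj (wz p) (EMul (EMul (EMul wa wy) (EPow wa (-1))) (wz p))))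
      (c3f (P + 1) (- 1) (- 2)).
    by apply: (acts_zconj_to (MM _ _ _ _ (MM _ _ _ _ (MM _ _ _ _ aE yE) aVE) zE)); rewrite /= /flip; spw.
  apply: acts_as_eq (MM _ _ _ _ (MM _ _ _ _ h1 h2) dtc) _ => x hx /=.
  by rewrite /flip; spw.
have kp2 : (k + 2 <= p)%N by slia.
rewrite nk; have [ok|ok] := boolP (odd k).
  have jE : (p - k = 2 * (p - k)./2)%N by slia.
  have hj : (k + 2 * (p - k)./2 <= p)%N by lia.
  have T := acts_telescope kp2 hj; rewrite -jE in T; apply: acts_as_eq T _.
  by move=> x hx; rewrite /pairswap /flip; ssplit; slia.
have jE : ((p - k).-1 = 2 * (p - k).-1./2)%N by slia.
have hj : (k + 2 * (p - k).-1./2 <= p)%N by lia.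
(* Here $p-k$ is odd, so the telescoping product, which adds pairs two at a time, stops one pair
   short; a conjugate of $t$ supplies the outermost one. *)
have tc : acts_as (E (econj (wt p) (EMul (EMul (EMul (wz p) wa) wy) (EPow (EMul (wz p) wa) (-1)))))
    (swap lo (P + 2)).
  have zaV : acts_as (E (EPow (EMul (wz p) wa) (-1))) (rotz 1 (P + 2) (P + 2 - 1)).
    by apply: acts_zaN; slia.
  by apply: (acts_tconj_to (MM _ _ _ _ (MM _ _ _ _ acts_za yE) zaV)); rewrite /= /flip; spw.
have T := acts_asM tc (acts_telescope kp2 hj).
have assoc4 (a b c d : {perm O}) : (a * (b * c * d) = a * b * c * d)%g by rewrite !mulgA.
rewrite -jE assoc4 in T; apply: acts_as_eq T _.
by move=> x hx /=; rewrite /pairswap /flip; spw.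
Qed.

End WordW.

Lemma acts_as_commute (u v : {perm O}) (f1 f2 : int -> int) : acts_as u f1 -> acts_as v f2 ->
  (forall x, inO x -> f1 x = x \/ f2 x = x) -> (u * v = v * u)%g.
Proof.
move=> u1 v2 d; apply: perm_disjoint_commute => x.
by have [h|h] := d _ (valO x); [left | right]; apply: val_inj; rewrite ?u1 ?v2.
Qed.

Lemma rho_s' : rho * s%:~R = (s - 1)%:~R :> 'F_p.
Proof. by rewrite intrB -[- _ in RHS]rho_s mulrBr mulr1 addrC subrK mulrC. Qed.

Lemma ev_erel (e1 e2 : expr 'I_3) : E e1 = E e2 -> E (erel e1 e2) = 1%g.
Proof. by move=> e12; rewrite evM evV e12 mulgV. Qed.

Section Relators.

Variable n : nat.
Hypotheses (kE : kpar n p = k) (nk : odd n = odd k).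

(** The relations that involve $y$ hold for reasons of support: $y$ fixes $1,\ldots,k$ pointwise and
    maps $k+1,\ldots,p+2$ below $1$. Thus $e^y$ moves no point from $3$ on, while $d$ moves only
    points from $5$ on. *)
Lemma gens_relators : {in [seq word_of e | e <- relators n p r s],
  forall w, evw (gens sa sg sy) w = 1%g}.
Proof.
move=> w; rewrite !inE => /or4P[|||/or4P[]] /eqP ->; rewrite -ev_word.
- by apply: ev_erel; rewrite -[LHS]/(sa ^+ p)%g sa_expP -[RHS]/(E wb ^+ p.-1)%g bX_p1.
- apply: ev_erel; rewrite evJ conjgE Eb -[E (EPow _ _)]/(gexpz sa s) -[RHS]/(gexpz sa (s - 1)).
  apply: (mulgI (mulP rho)); rewrite mulKVg; apply/permP => x; rewrite !permM.
  case: (OP x) => [[f ->]|[z -> /andP[hz hz']]].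
    by rewrite !(sa_expz, mulP_ptF) ?rho0 // mulrDr rho_s'.
  by rewrite !(mulP_out, sa_expz_out) ?rho0.
- rewrite -[LHS]/((E (wz p) * E (econj (wz p) wa)) ^+ 2)%g evJ Ez cyc3J.
  rewrite -[E wa]/sa sa_ptF add0r !sa_out; try slia.
  by apply: cyc3M_expg2; rewrite ?ptF_al ?ptF_be ?al_be // (inj_eq ptF_inj) eq_sym oner_eq0.
- apply: ev_erel; rewrite evJ evM Eh mulg1 Ewatil cyc3J -[E wy]/sy.
  by rewrite !(acts_as_pt _ sy_acts); try slia; congr cyc3; congr omega_pt; rewrite /flip; ssplit; slia.
- apply: ev_erel; rewrite evJ -[E wy]/sy conjgE.
  rewrite (acts_as_commute (acts_wc kE nk) sy_acts) ?mulKg // => x hx.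
  by case: (odd n); rewrite /flip; pw; (try by left); (try by right); slia.
- have c : (E (wd p) * E (econj (we n p) wy) = E (econj (we n p) wy) * E (wd p))%g.
    rewrite evJ; apply: (acts_as_commute acts_wd (acts_conj_y (acts_we kE nk))) => x hx.
    have [x5|x5] := boolP (5 <= x); [right | by left; pw].
    by rewrite /= /efun /flip; ssplit; slia.
  have commE (a b : {perm O}) : (a * b = b * a -> a^-1 * b^-1 * a * b = 1)%g.
    by move=> ab; rewrite -mulgA -invgM ab mulVg.
  exact: (commE _ _ c).
by apply: ev_erel; rewrite (Eww kE nk).
Qed.

End Relators.

End Images.

(** * Consequences of the relations *)

Class satisfies_relators (n p : nat) (r s : int) (G : groupType) (ga gg gy : G) : Prop :=
  SatisfiesRelators {
  rel1 : (ga ^+ p = ev (gens ga gg gy) wb ^+ p.-1)%g;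
  rel2 : (gexpz ga s ^ ev (gens ga gg gy) wb = gexpz ga (s - 1))%g;
  rel3 : ((ev (gens ga gg gy) (wz p) * ev (gens ga gg gy) (wz p) ^ ga) ^+ 2 = 1)%g;
  rel4 : (ev (gens ga gg gy) (watil p) =
    (ev (gens ga gg gy) (watil p) * ev (gens ga gg gy) (wh p r)) ^ gy)%g;
  rel5 : (ev (gens ga gg gy) (wc n p) = ev (gens ga gg gy) (wc n p) ^ gy)%g;
  rel6 : commute (ev (gens ga gg gy) (wd p)) (ev (gens ga gg gy) (we n p) ^ gy)%g;
  rel7 : gy = ev (gens ga gg gy) (ww n p) }.

Section Retraction.

Context {k p : nat} {kpS : setting k p}.
Local Notation p_pr := (@p_pr k p kpS).
Local Notation P := (p%:Z).
Local Notation K := (k%:Z).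
Local Notation lo := (- P + K - 1).
Local Notation O := (Omega k p).
Local Notation inO x := ((lo <= x) && (x <= P + 2)).
Local Notation pt := (omega_pt (@kp k p kpS)).
Local Notation al := (pt (P + 1)).
Local Notation be := (pt (P + 2)).
Implicit Types (x i j : int) (f : 'F_p).

Context {r s : int} {alpha : 'F_p} {sa sg sy : {perm O}}.
Context {GS : gen_setting r s alpha sa sg sy}.
Local Notation rho := (r%:~R : 'F_p).
Local Notation alpha0 := (@alpha0 _ _ _ _ _ _ _ _ GS).
Local Notation rho_gen := (@rho_gen _ _ _ _ _ _ _ _ GS).
Local Notation rho_s := (@rho_s _ _ _ _ _ _ _ _ GS).
Local Notation sa_acts := (@sa_acts _ _ _ _ _ _ _ _ GS).
Local Notation sy_acts := (@sy_acts _ _ _ _ _ _ _ _ GS).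

Local Notation E e := (ev (gens sa sg sy) e).

#[local] Hint Extern 0 (is_true (alpha != _)) => exact: alpha0 : core.

Context {n : nat} {G : groupType} {ga gg gy : G}.
Context {RS : satisfies_relators n p r s ga gg gy}.
Local Notation D e := (ev (gens ga gg gy) e).
Local Notation rel1 := (@rel1 _ _ _ _ _ _ _ _ RS).
Local Notation rel2 := (@rel2 _ _ _ _ _ _ _ _ RS).
Local Notation rel3 := (@rel3 _ _ _ _ _ _ _ _ RS).
Local Notation rel4 := (@rel4 _ _ _ _ _ _ _ _ RS).
Local Notation rel5 := (@rel5 _ _ _ _ _ _ _ _ RS).
Local Notation rel6 := (@rel6 _ _ _ _ _ _ _ _ RS).
Local Notation rel7 := (@rel7 _ _ _ _ _ _ _ _ RS).

(** Being a power of $b$, the element $a^p$ commutes with $b$. The $p$-th power of the second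
    relation then equates $a^{ps}$ with $a^{p(s-1)}$. *)
Lemma ga_p : (ga ^+ p = 1)%g.
Proof.
have c : (ga ^+ p ^ D wb = ga ^+ p)%g.
  by rewrite rel1 conjXg conjgE mulgA mulVg mul1g.
have e : gexpz (ga ^+ p)%g s = gexpz (ga ^+ p)%g (s - 1).
  by rewrite -{1}c gexpzJ !gexpzX conjXg rel2.
apply: (mulgI (gexpz (ga ^+ p)%g (s - 1))).
by rewrite mulg1 -[RHS]e -[s in RHS](subrK 1) [RHS]gexpzD.
Qed.

Local Notation aF := (expF ga).

Definition zF (f : 'F_p) : G := (D (wz p) ^ aF f)%g.

Arguments zF f%_R.

Lemma Dzi i : D (wzi p i) = zF i%:~R.
Proof. by rewrite /wzi evJ /zF (expF_int p_pr ga_p). Qed.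

Lemma zF0 : zF 0 = D (wz p). Proof. by rewrite /zF expF0 conjg1. Qed.

Lemma zFJ f h : (zF f ^ aF h)%g = zF (f + h).
Proof. by rewrite /zF -conjgM -(expFD p_pr ga_p). Qed.

Lemma zF_a f : (zF f ^ ga)%g = zF (f + 1).
Proof. by rewrite -{1}(expF1 p_pr ga_p) zFJ. Qed.

(** $z$ and $b$ are both powers of $g$ and commute, so $b$ acts only on the exponent of $a$. *)
Lemma zF_b f : (zF f ^ D wb)%g = zF (rho * f).
Proof.
rewrite /zF conjJg (affine_conj p_pr ga_p rho_s rel2); congr (_ ^ _)%g.
by apply/conjg_fixP/commgP; rewrite -[D (wz p)]/(gg ^+ p.-1)%g -[D wb]/(gg ^+ 3)%g; apply: commuteX2.
Qed.

(** $z^3=g^{3(p-1)}=b^{p-1}=a^p=1$. *)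
Lemma zF_expg3 f : (zF f ^+ 3 = 1)%g.
Proof.
rewrite /zF -conjXg; suff -> : (D (wz p) ^+ 3 = 1)%g by rewrite conj1g.
rewrite -[D (wz p)]/(gg ^+ p.-1)%g expgnAC -[(gg ^+ 3)%g]/(D wb) -rel1.
exact: ga_p.
Qed.

(** The third relation is the case of the pair $(0,1)$. Conjugation by powers of $b$ gives
    $(0,r^i)$, hence all pairs $(0,f)$ with $f \ne 0$, and conjugation by powers of $a$ gives the
    rest. *)
Lemma zF_expg2 f h : f != h -> ((zF f * zF h) ^+ 2 = 1)%g.
Proof.
move=> fh; have e0 : h - f != 0 by rewrite subr_eq0 eq_sym.
have [i _ ei] := rho_gen e0.
have z01 : ((zF 0 * zF 1) ^+ 2 = 1)%g
  by rewrite zF0 -(add0r (1 : 'F_p)) -zF_a zF0; exact: rel3.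
have z0r (j : nat) : ((zF 0 * zF (rho ^+ j)) ^+ 2 = 1)%g.
  elim: j => // j IH; move/(congr1 (fun g => g ^ D wb)%g): IH.
  by rewrite conj1g conjXg conjMg !zF_b mulr0 -exprS.
have := congr1 (fun g => g ^ aF f)%g (z0r i).
by rewrite conj1g conjXg conjMg !zFJ add0r -ei subrK.
Qed.

(** * The alternating group on $1,\ldots,p+2$ inside [G] *)

Definition posO : {set O} := [set x | 1 <= val x].

Lemma ptF_X f : ptF f \in posO.
Proof. by rewrite inE /ptF val_pt; have h := repF_bound p_pr f; slia. Qed.

Lemma al_X : al \in posO. Proof. by rewrite inE val_pt; slia. Qed.
Lemma be_X : be \in posO. Proof. by rewrite inE val_pt; slia. Qed.

Lemma posOP u : u \in posO -> u != al -> u != be -> exists f : 'F_p, u = ptF f.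
Proof.
rewrite inE => uX ual ube; case: (OP u) => [//|[z uz /andP[hz hz']]].
move: uX ual ube; rewrite uz val_pt // !pt_eq //; slia.
Qed.

Lemma ptF_val f : (val (ptF f))%:~R = f :> 'F_p.
Proof.
by rewrite /ptF val_pt ?repFK //; have h := repF_bound p_pr f; slia.
Qed.

Definition is_alt_lift (F : {perm O} -> G) : Prop :=
  (forall f, F (cyc3 (ptF f) al be) = zF f) /\
  (forall u v, perm_on posO u -> perm_on posO v -> ~~ odd_perm v -> F (u * v)%g = (F u * F v)%g).

Lemma alt_lift_exists : exists F, is_alt_lift F.
Proof.
have [||F [F1 F2]] := carmichael_alt al_be al_X be_X (x := fun u => zF (val u)%:~R).
- by move=> i _ _ _; exact: zF_expg3.
- move=> i j iX ia ib jX ja jb ij; apply: zF_expg2.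
  have [f ef] := posOP iX ia ib; have [h eh] := posOP jX ja jb.
  by move: ij; rewrite ef eh !ptF_val (inj_eq ptF_inj).
by exists F; split=> // f; rewrite F1 ?ptF_X ?ptF_al ?ptF_be // ptF_val.
Qed.

Section AltLift.

Variable F : {perm O} -> G.
Hypothesis FP : is_alt_lift F.

Definition lifts (u : {perm O}) (g : G) : Prop :=
  [/\ perm_on posO u, ~~ odd_perm u & F u = g].

Lemma lifts_fun u g g' : lifts u g -> lifts u g' -> g = g'.
Proof. by case=> _ _ <- [_ _ <-]. Qed.

Lemma lifts1 : lifts 1 1.
Proof.
have [_ FM] := FP; split; rewrite ?perm_on1 ?odd_perm1 //.
apply: (mulgI (F 1%g)); rewrite mulg1 -FM ?mul1g ?perm_on1 ?odd_perm1 //.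
Qed.

Lemma liftsM u v g h : lifts u g -> lifts v h -> lifts (u * v) (g * h).
Proof.
have [_ FM] := FP; case=> uX ue <- [vX ve <-]; split; first exact: perm_onM.
  by rewrite odd_permM (negPf ue) (negPf ve).
exact: FM.
Qed.

Lemma liftsV u g : lifts u g -> lifts u^-1 g^-1.
Proof.
case=> uX ue ug; have uV : lifts u^-1 (F u^-1).
  by split; rewrite ?odd_permV //; exact: perm_onV.
have l : lifts u g by [].
have := liftsM l uV; rewrite mulgV => /(lifts_fun lifts1) e.
have [h1 h2 _] := uV; split=> //.
by apply: (mulgI g); rewrite -e mulgV.
Qed.

Lemma liftsX u g (m : nat) : lifts u g -> lifts (u ^+ m) (g ^+ m).
Proof. by move=> ug; elim: m => [|m IH]; [exact: lifts1 | rewrite !expgS; exact: liftsM]. Qed.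

Lemma lifts_gexpz u g (m : int) : lifts u g -> lifts (gexpz u m) (gexpz g m).
Proof. by move=> ug; case: m => m; apply: liftsX => //; exact: liftsV. Qed.

Lemma liftsJ u v g h : lifts u g -> lifts v h -> lifts (u ^ v) (g ^ h).
Proof. by move=> ug vh; rewrite !conjgE; apply: liftsM (liftsV vh) (liftsM ug vh). Qed.

(** [g] acts by conjugation on the image of [F] as [u] does on permutations, without being known to
    lie in that image. This is all that is available for $a$ and $b$ at first. *)
Definition normal_lifts (u : {perm O}) (g : G) : Prop :=
  perm_on posO u /\ forall v h, lifts v h -> lifts (v ^ u) (h ^ g).

Lemma normal_liftsM u v g h : normal_lifts u g -> normal_lifts v h ->
  normal_lifts (u * v) (g * h).
Proof.
case=> uX ug [vX vh]; split; first exact: perm_onM.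
by move=> w k' wk; rewrite !conjgM; apply: vh; apply: ug.
Qed.

Lemma normal_lifts1 : normal_lifts 1 1.
Proof. by split; [exact: perm_on1 | move=> v h vh; rewrite !conjg1]. Qed.

Lemma normal_liftsX u g (m : nat) : normal_lifts u g -> normal_lifts (u ^+ m) (g ^+ m).
Proof.
by move=> ug; elim: m => [|m IH]; [exact: normal_lifts1 | rewrite !expgS; exact: normal_liftsM].
Qed.

Lemma lifts_normal u g : lifts u g -> normal_lifts u g.
Proof. by move=> ug; split; [case: ug | move=> v h vh; exact: liftsJ]. Qed.

Lemma normal_lifts_gen (u : {perm O}) (g : G) : perm_on posO u ->
    (forall f, lifts (cyc3 (ptF f) al be ^ u) (zF f ^ g)) -> normal_lifts u g.
Proof.
move=> uX ug; split=> // v h [vX ve <-]; move: v vX ve.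
suff H : forall v, perm_on posO v -> ~~ odd_perm v -> lifts v (F v) /\ lifts (v ^ u) (F v ^ g).
  by move=> v vX ve; have [] := H v vX ve.
have [Fz FM] := FP.
apply: (alt_ind al_be al_X be_X) => [|w i iX ia ib [lw lw']].
  by have [_ _ ->] := lifts1; rewrite !conj1g; split; exact: lifts1.
have [f ef] := posOP iX ia ib; subst i.
have lz : lifts (cyc3 (ptF f) al be) (zF f).
  split; rewrite ?odd_cyc3 ?ptF_al ?ptF_be //.
  by apply: cyc3_on; rewrite ?ptF_X ?al_X ?be_X.
have lwz := liftsM lw lz; have [_ _ ->] := lwz.
by split=> //; rewrite (conjMg w) (conjMg (F w)); exact: liftsM lw' (ug f).
Qed.

Lemma lifts_zF f : lifts (cyc3 (ptF f) al be) (zF f).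
Proof.
have [Fz _] := FP; split; rewrite ?odd_cyc3 ?ptF_al ?ptF_be //.
by apply: cyc3_on; rewrite ?ptF_X ?al_X ?be_X.
Qed.

Lemma posO_on (u : {perm O}) (f1 : int -> int) : acts_as u f1 ->
  (forall x, inO x -> ~~ (1 <= x) -> f1 x = x) -> perm_on posO u.
Proof.
move=> u1 h; apply/subsetP => x; rewrite !inE; apply: contraR => hx.
by apply/eqP/val_inj; rewrite u1 h ?valO.
Qed.

Lemma sa_X : perm_on posO sa.
Proof. by apply: posO_on sa_acts _ => x hx hx'; spw. Qed.

Lemma mulP_X f : f != 0 -> perm_on posO (mulP f).
Proof. by move=> f0; apply: posO_on (acts_mulP f0) _ => x hx hx'; rewrite mulFE // ifF //; slia. Qed.

Lemma normal_a : normal_lifts sa ga.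
Proof.
apply: normal_lifts_gen sa_X _ => f; rewrite zF_a cyc3J sa_ptF !sa_out; try slia.
exact: lifts_zF.
Qed.

Lemma normal_b : normal_lifts (E wb) (D wb).
Proof.
rewrite Eb; apply: normal_lifts_gen; first by apply: mulP_X; exact: rho0.
move=> f; rewrite zF_b cyc3J mulP_ptF ?rho0 // mulP_al ?mulP_be ?rho0 //.
exact: lifts_zF.
Qed.

Lemma lifts_zi i : lifts (E (wzi p i)) (D (wzi p i)).
Proof. by rewrite Ezi Dzi; exact: lifts_zF. Qed.

Definition elifts e : Prop := lifts (E e) (D e).

Lemma lifts_emul e1 e2 : elifts e1 -> elifts e2 -> elifts (EMul e1 e2).
Proof. exact: liftsM. Qed.

Lemma lifts_epow e m : elifts e -> elifts (EPow e m).
Proof. exact: lifts_gexpz. Qed.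

Lemma lifts_econj e1 e2 : elifts e1 -> elifts e2 -> elifts (econj e1 e2).
Proof. by move=> h1 h2; exact: lifts_emul (lifts_emul (lifts_epow _ h2) h1) h2. Qed.

Lemma gb_p1 : (D wb ^+ p.-1 = 1)%g.
Proof. by rewrite -rel1 ga_p. Qed.

Lemma mulg_conj_shift (H : groupType) (x u b c d : H) :
  (x * u * (b * c * d) = x * b * (u ^ b * (c * d)))%g.
Proof. by rewrite conjgE !mulgA mulgK. Qed.

(** Collects all factors $b^2$ on the left. They normalise the alternating copy, so what remains is
    one and the same even element seen on both sides. *)
Lemma h_split (m : nat) : exists u g, [/\ lifts u g,
  ((E wb ^+ 2 * E (wzi p 1) * E (wzi p r)) ^+ m = (E wb ^+ 2) ^+ m * u)%g &
  ((D wb ^+ 2 * D (wzi p 1) * D (wzi p r)) ^+ m = (D wb ^+ 2) ^+ m * g)%g].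
Proof.
have lw := liftsM (lifts_zi 1) (lifts_zi r).
have nb := normal_liftsX 2 normal_b.
elim: m => [|m [u [g [ug eE eD]]]].
  by exists 1%g, 1%g; rewrite !expg0 !mulg1; split=> //; exact: lifts1.
exists (u ^ (E wb ^+ 2) * (E (wzi p 1) * E (wzi p r)))%g.
exists (g ^ (D wb ^+ 2) * (D (wzi p 1) * D (wzi p r)))%g.
split; first by apply: liftsM lw; apply: (nb.2).
  by rewrite expgSr eE [in RHS]expgSr mulg_conj_shift.
by rewrite expgSr eD [in RHS]expgSr mulg_conj_shift.
Qed.

Lemma normal_h : normal_lifts (E (wh p r)) (D (wh p r)).
Proof.
have h : normal_lifts (E wb ^+ 2 * E (wzi p 1) * E (wzi p r))
    (D wb ^+ 2 * D (wzi p 1) * D (wzi p r)).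
  apply: normal_liftsM (lifts_normal (lifts_zi r)).
  by apply: normal_liftsM (lifts_normal (lifts_zi 1)); apply: normal_liftsX; exact: normal_b.
exact: (normal_liftsX p.+1./2 h).
Qed.

Lemma h_commute u g : lifts u g -> (g ^ D (wh p r) = g)%g.
Proof.
move=> ug; have [_ /(_ _ _ ug)] := normal_h; rewrite Eh conjg1 => ug'.
exact: lifts_fun ug' ug.
Qed.

(** For $m=(p+1)/2$ the collected power is $b^{p+1}=b^2$, so $h=b^2g$ with $g$ in the alternating
    copy, whereas on permutations the same product is trivial. *)
Lemma h_b2 : lifts (E wb ^+ 2) ((D (wh p r))^-1 * D wb ^+ 2).
Proof.
have [e1 e2 e3 e5] := @half_p k p kpS.
have [u [g [ug eE eD]]] := h_split p.+1./2.
have eh : D (wh p r) = (D wb ^+ 2 * g)%g.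
  rewrite -[LHS]/((D wb ^+ 2 * D (wzi p 1) * D (wzi p r)) ^+ p.+1./2)%g eD.
  by rewrite e2 expgSr -expgnA -e1 gb_p1 mul1g.
have eu : (1 = E wb ^+ 2 * u)%g.
  rewrite -Eh -[LHS]/((E wb ^+ 2 * E (wzi p 1) * E (wzi p r)) ^+ p.+1./2)%g eE.
  by rewrite e2 expgSr -expgnA -e1 bX_p1 mul1g.
have -> : (E wb ^+ 2 = u^-1)%g by apply: (mulIg u); rewrite mulVg -eu.
by rewrite eh invgM mulgVK; exact: liftsV.
Qed.

(** The image of $h$ is trivial, so $h$ centralises the copy. The $(p-1)/2$-th powers of $b^2$ and
    of its lift $h^{-1}b^2$ are both trivial, hence so is that of $h$. As $\tilde a$ has cube $1$
    and commutes with $h$, the relation $\tilde a=(\tilde ah)^y$ gives $h^3=1$. Finally $(p-1)/2$ is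
    prime to $3$. *)
Lemma h_eq1 : D (wh p r) = 1%g.
Proof.
have [e1 e2 e3 e5] := @half_p k p kpS.
set h := D (wh p r); have l := h_b2; rewrite -/h in l.
have c : commute h (h^-1 * D wb ^+ 2)%g.
  by apply/commute_sym/commgP/conjg_fixP; exact: h_commute l.
have eb : (D wb ^+ 2 = h * (h^-1 * D wb ^+ 2))%g by rewrite mulVKg.
have hm : (h ^+ p.-1./2 = 1)%g.
  have [_ _ l1] := liftsX p.-1./2 l.
  have e : ((h^-1 * D wb ^+ 2) ^+ p.-1./2 = 1)%g.
    by rewrite -l1 -expgnA -e1 bX_p1; case: lifts1.
  by have := gb_p1; rewrite {1}e1 expgnA eb expgMn // e mulg1.
have h3 : (h ^+ 3 = 1)%g.
  have w3 : (D (watil p) ^+ 3 = 1)%g.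
    by rewrite /watil evJ -conjXg Dzi zF_expg3 conj1g.
  have lw : lifts (E (watil p)) (D (watil p)).
    exact: lifts_econj (lifts_zi 3) (lifts_emul (lifts_zi 2) (lifts_zi 1)).
  have cw : commute (D (watil p)) h by apply/commgP/conjg_fixP; exact: h_commute lw.
  have e : ((D (watil p) * h) ^+ 3 = h ^+ 3)%g by rewrite (expgMn _ cw) w3 mul1g.
  rewrite -e; apply: (conjg_inj gy); rewrite conjXg conj1g.
  by rewrite -[(_ ^ gy)%g]rel4 w3.
by apply: expg_coprime hm h3; [lia | rewrite coprime_sym prime_coprime //; slia].
Qed.

Lemma lifts_b2 : lifts (E wb ^+ 2) (D wb ^+ 2).
Proof. by have := h_b2; rewrite h_eq1 invg1 mul1g. Qed.

Lemma sa_even : ~~ odd_perm sa.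
Proof.
have -> : sa = ((sa ^+ p.+1./2) ^+ 2)%g.
  have e : (p.+1./2 * 2 = p + 1)%N by slia.
  by rewrite -expgnA e expgnDr sa_expP mul1g.
by rewrite expg2 odd_permM addbb.
Qed.

Lemma rel2_perm : (gexpz sa s ^ E wb = gexpz sa (s - 1))%g.
Proof.
rewrite conjgE Eb; apply: (mulgI (mulP rho)); rewrite mulKVg; apply/permP => x; rewrite !permM.
case: (OP x) => [[f ->]|[z -> /andP[hz hz']]].
  by rewrite !(sa_expz, mulP_ptF) ?rho0 // mulrDr rho_s'.
by rewrite !(mulP_out, sa_expz_out) ?rho0.
Qed.

(** Let [zeta] be the quotient of $a$ by the lift [phi] of its image. It centralises the copy, in
    particular $b^2$. Conjugation by $b^2$ raises both $a$ and [phi] to the power $r^2$, so [zeta]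
    equals its own power with exponent $r^2$. Its order thus divides both $p$ and $r^2-1$, read with
    the representative [v], and these are coprime. *)
Lemma lifts_a : lifts sa ga.
Proof.
have lsa : lifts sa (F sa) by split; rewrite ?sa_even //; exact: sa_X.
set phi := F sa in lsa; pose zeta := (ga * phi^-1)%g.
have na : normal_lifts sa ga by exact: normal_a.
have a_phi : commute ga phi.
  apply/commute_sym/commgP/conjg_fixP; have := na.2 _ _ lsa.
  by rewrite [(sa ^ sa)%g]conjgE mulKg => /(lifts_fun lsa).
have zc u g : lifts u g -> (g ^ zeta = g)%g.
  move=> ug; have h := liftsJ (na.2 _ _ ug) (liftsV lsa).
  rewrite -!conjgM mulgV conjg1 in h.
  exact: lifts_fun h ug.
pose v := val (rho ^+ 2 : 'F_p).
have sa_b2 : (sa ^ (E wb ^+ 2) = sa ^+ v)%g.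
  have ap : (sa ^+ p = 1)%g by exact: sa_expP.
  rewrite expg2 conjgM -{1}(expF1 p_pr ap) !(affine_conj p_pr ap rho_s rel2_perm).
  by rewrite mulr1 -expr2.
have ga_b2 : (ga ^ (D wb ^+ 2) = ga ^+ v)%g.
  have ap : (ga ^+ p = 1)%g by exact: ga_p.
  rewrite expg2 conjgM -{1}(expF1 p_pr ap) !(affine_conj p_pr ap rho_s rel2).
  by rewrite mulr1 -expr2.
have lb2 : lifts (E wb ^+ 2) (D wb ^+ 2) by exact: lifts_b2.
have phi_b2 : (phi ^ (D wb ^+ 2) = phi ^+ v)%g.
  by have h := liftsJ lsa lb2; rewrite sa_b2 in h; apply: lifts_fun h (liftsX v lsa).
have zeta_b2 : (zeta ^ (D wb ^+ 2) = zeta)%g.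
  by apply/conjg_fixP/commgP/commute_sym/commgP/conjg_fixP; exact: zc lb2.
have zphi : (zeta * phi = ga)%g by rewrite mulgVK.
have cz : commute zeta phi.
  by apply/commute_sym/commgP/conjg_fixP; exact: zc lsa.
have zv : (zeta ^+ v = zeta)%g.
  apply: (mulIg (phi ^+ v)%g); rewrite -expgMn // zphi -ga_b2 -{1}zphi conjMg.
  by rewrite zeta_b2 phi_b2.
have zp : (zeta ^+ p = 1)%g.
  apply: (mulIg (phi ^+ p)%g); rewrite -expgMn // zphi mul1g.
  have h := liftsX p lsa; rewrite sa_expP in h.
  rewrite -(lifts_fun (lifts1) h).
  exact: ga_p.
have r20 : rho ^+ 2 != 0 by rewrite expf_neq0 ?rho0.
have v_lt : (v < p)%N by exact: Fp_lt.
(* $r$ has order $p-1>2$, so $r^2 \ne 1$; this makes $v-1$ a positive integer below $p$. *)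
have v_gt : (1 < v)%N.
  rewrite ltn_neqAle lt0n; apply/andP; split.
    apply: contraTneq isT => e; have : rho ^+ 2 == 1 by apply/eqP/val_inj; rewrite -/v -e /= modn_small.
    rewrite rhoX_eq1 => /dvdn_leq h; have := h isT; slia.
  by apply: contraNneq r20 => e; apply/eqP/val_inj.
have zv1 : (zeta ^+ v.-1 = 1)%g.
  by apply: (mulgI zeta); rewrite mulg1 -expgS prednK //; lia.
have z1 : zeta = 1%g.
  apply: expg_coprime zv1 zp; first lia.
  by rewrite coprime_sym prime_coprime //; apply/negP => /dvdn_leq; lia.
by move: zphi; rewrite z1 mul1g => <-.
Qed.

(** * From the alternating to the symmetric group on $1,\ldots,p+2$ *)

Fixpoint yfree (e : expr 'I_3) : bool :=
  match e with
  | EOne => true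
  | EGen i => val i != 2%N
  | EMul e1 e2 => yfree e1 && yfree e2
  | EPow e1 _ => yfree e1
  end.

Let lM e1 e2 : elifts e1 -> elifts e2 -> elifts (EMul e1 e2).
Proof. exact: (lifts_emul). Qed.

Let lX e m : elifts e -> elifts (EPow e m).
Proof. exact: (lifts_epow). Qed.

Let lJ e1 e2 : elifts e1 -> elifts e2 -> elifts (econj e1 e2).
Proof. exact: (lifts_econj). Qed.

Let la : elifts wa. Proof. exact: lifts_a. Qed.

Let lzi i : elifts (wzi p i). Proof. exact: lifts_zi. Qed.

Let lz : elifts (wz p).
Proof. by have := lifts_zF 0; rewrite zF0 -Ez. Qed.

Let ld i j : elifts (wdij p i j).
Proof. by apply: lM; [apply: lM; [|apply: lX]|]; exact: lzi. Qed.

Let lc_low i j : elifts (wc_low p i j).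
Proof. by apply: lM; [apply: lM; [apply: lX|apply: lX; apply: lM; [|exact: ld]]|apply: lX]; exact: la. Qed.

Let lc_p i : elifts (wc_p p i).
Proof. by apply: lM; [apply: lJ; [|apply: lX; apply: lM]|exact: lc_low]; (exact: la || exact: lz). Qed.

Lemma lifts_c i j : elifts (wcij p i j).
Proof.
rewrite /wcij; case: ifP => _; first exact: lc_p.
case: ifP => _.
  by apply: lM; [apply: lJ; [|apply: lX; apply: lM]|exact: lc_low]; (exact: la || exact: lz).
by case: ifP => _; [apply: lM; [exact: lz|exact: lc_p]|exact: lc_low].
Qed.

Lemma lifts_v : elifts (wv p).
Proof.
apply: (lX p.-1./2); apply: lM; last exact: ld.
by apply: lM; [|apply: lX]; exact: lifts_c.
Qed.

Lemma normal_b2 : normal_lifts (E (wb2 p)) (D (wb2 p)).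
Proof. by apply: (normal_liftsX p.-1./2); exact: normal_b. Qed.

Lemma normal_t : normal_lifts (E (wt p)) (D (wt p)).
Proof. exact: normal_liftsM (lifts_normal lifts_v) normal_b2. Qed.

Lemma cyc3V_al f : ((cyc3 (ptF f) al be)^-1 = cyc3 (ptF f) be al)%g.
Proof. by rewrite /cyc3 -!lock invgM !tpermV. Qed.

Lemma zF_t f : (zF f ^ D (wt p) = (zF f)^-1)%g.
Proof.
have lf := lifts_zF f; have := normal_t.2 _ _ lf.
rewrite Et cyc3J tpermL tpermR tpermD 1?eq_sym ?ptF_al ?ptF_be // -cyc3V_al => h.
exact: lifts_fun h (liftsV lf).
Qed.

Lemma b2_sq : (D (wb2 p) ^+ 2 = 1)%g.
Proof.
have [e1 e2 e3 e5] := @half_p k p kpS.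
by rewrite -[D (wb2 p)]/(D wb ^+ p.-1./2)%g -expgnA mulnC -e1; exact: gb_p1.
Qed.

Lemma b2_sq_perm : (E (wb2 p) ^+ 2 = 1)%g.
Proof.
have [e1 e2 e3 e5] := @half_p k p kpS.
by rewrite -[E (wb2 p)]/(E wb ^+ p.-1./2)%g -expgnA mulnC -e1; exact: bX_p1.
Qed.

Lemma mul_involution_sq (H : groupType) (v b : H) : (b ^+ 2 = 1 -> (v * b) ^+ 2 = v * v ^ b)%g.
Proof.
move=> b2; have bV : (b^-1 = b)%g by apply: (mulgI b); rewrite mulgV -b2 expg2.
by rewrite conjgE bV expg2 !mulgA.
Qed.

(** Although $t$ is odd, its square is $v\,v^{b_2}$, a product of elements of the alternating copy,
    and can be compared with its image there. *)
Lemma t_sq : (D (wt p) ^+ 2 = 1)%g.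
Proof.
have lv := lifts_v; have h := liftsM lv (normal_b2.2 _ _ lv).
rewrite -(mul_involution_sq _ b2_sq_perm) -(mul_involution_sq _ b2_sq) in h.
rewrite -[(E (wv p) * _)%g]/(E (wt p)) Et -[(D (wv p) * _)%g]/(D (wt p)) expg2 tperm2 in h.
exact: lifts_fun h (lifts1).
Qed.

(** The second clause says that [tau] inverts evaluation on every word in $a$ and $g$. The third
    records the parity of the words [wcij] for all indices, and yields that the image of $c$ is
    odd. *)
Definition is_sym_lift (tau : {perm O} -> G) : Prop :=
  [/\ forall u v, perm_on posO u -> perm_on posO v -> tau (u * v)%g = (tau u * tau v)%g,
      forall e, yfree e -> perm_on posO (E e) /\ tau (E e) = D e
    & forall i j, ~~ odd_perm (E (wcij p i j))].

Lemma tperm_X : perm_on posO (tperm al be).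
Proof.
apply: subset_trans (tperm_on _ _) _; apply/subsetP => w.
by rewrite !inE => /orP[] /eqP ->; rewrite val_pt; slia.
Qed.

Lemma sym_lift_exists : exists tau, is_sym_lift tau.
Proof.
pose x (u : O) := zF ((val u)%:~R : 'F_p).
have x3 (i : O) : i \in posO -> i != al -> i != be -> (x i ^+ 3 = 1)%g by move=> *; exact: zF_expg3.
have x2 (i j : O) : i \in posO -> i != al -> i != be -> j \in posO -> j != al -> j != be ->
    i != j -> ((x i * x j) ^+ 2 = 1)%g.
  move=> iX ia ib jX ja jb ij; apply: zF_expg2.
  have [f ef] := posOP iX ia ib; have [h eh] := posOP jX ja jb.
  by move: ij; rewrite ef eh !ptF_val (inj_eq ptF_inj).
have xt (i : O) : i \in posO -> i != al -> i != be -> (x i ^ D (wt p) = (x i)^-1)%g by move=> *; exact: zF_t.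
have [tau [tz tt tM]] := carmichael_sym al_be al_X be_X x3 x2 t_sq xt.
exists tau; pose L u g := perm_on posO u /\ tau u = g.
have LM u v g h : L u g -> L v h -> L (u * v)%g (g * h)%g.
  by case=> uX <- [vX <-]; split; [exact: perm_onM | exact: tM].
have L1 : L 1%g 1%g.
  split; first exact: perm_on1.
  by apply: (mulgI (tau 1%g)); rewrite mulg1 -tM ?mul1g ?perm_on1.
have LV u g : L u g -> L u^-1%g g^-1%g.
  case=> uX <-; split; first exact: perm_onV.
  have [_ t1] := L1; by apply: (mulgI (tau u)); rewrite -tM ?perm_onV // !mulgV.
have LX u g (m : nat) : L u g -> L (u ^+ m)%g (g ^+ m)%g.
  by move=> ug; elim: m => // m IH; rewrite !expgS; exact: LM.
have LF u g : lifts u g -> L u g.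
  case=> uX ue <-; split=> //; suff [] : lifts u (tau u) /\ perm_on posO u by case.
  move: u uX ue; apply: (alt_ind al_be al_X be_X) => [|u i iX ia ib [lu uX]].
    by have [_ ->] := L1; split; [exact: (lifts1) | exact: perm_on1].
  have [f ef] := posOP iX ia ib; subst i.
  have cX : perm_on posO (cyc3 (ptF f) al be) by case: (lifts_zF f).
  split; last exact: perm_onM.
  rewrite tM // tz ?ptF_al ?ptF_be // /x ptF_val.
  have e := (liftsM lu (lifts_zF f)). exact: e.
have Lt : L (E (wt p)) (D (wt p)) by rewrite Et; split=> //; exact: tperm_X.
(* $b_2=v^{-1}t$, and both factors are already covered. *)
have Lb2 : L (E (wb2 p)) (D (wb2 p)).
  have h := LM _ _ _ _ (LV _ _ (LF _ _ lifts_v)) Lt.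
  by rewrite -[E (wt p)]/(E (wv p) * E (wb2 p))%g -[D (wt p)]/(D (wv p) * D (wb2 p))%g !mulKg in h.
have [e1 e2 e3 e5] := @half_p k p kpS.
(* As $(p-1)/2$ is odd, $b$ lies in the group generated by $b_2$ and $b^2$; the exponents add up to
   $p$, that is, to $1$ modulo $p-1$. *)
have bsplit (H : groupType) (b : H) : (b ^+ p.-1 = 1 -> b ^+ p.-1./2 * (b ^+ 2) ^+ (p.-1./2.+1./2) = b)%g.
  move=> b1; rewrite -expgnA -expgnDr.
  have -> : (p.-1./2 + 2 * p.-1./2.+1./2 = p.-1 + 1)%N by slia.
  by rewrite expgnDr b1 mul1g.
have Lbb : L (E wb ^+ 2)%g (D wb ^+ 2)%g by apply: LF; exact: lifts_b2.
have Lb : L (E wb) (D wb).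
  have h := LM _ _ _ _ Lb2 (LX _ _ p.-1./2.+1./2 Lbb).
  rewrite -[E (wb2 p)]/(E wb ^+ p.-1./2)%g -[D (wb2 p)]/(D wb ^+ p.-1./2)%g in h.
  by rewrite !bsplit in h; [|exact: gb_p1|exact: bX_p1].
(* As $p-1 \equiv 1 \pmod 3$, dividing $z=g^{p-1}$ by a power of $b=g^3$ leaves $g$. *)
have gsplit (H : groupType) (g : H) : (((g ^+ 3) ^+ (p.-1 %/ 3))^-1 * g ^+ p.-1 = g)%g.
  rewrite {2}(divn_eq p.-1 3) mod3_p expgnDr mulnC expgnA mulKg //.
have Lg : L sg gg.
  have h := LM _ _ _ _ (LV _ _ (LX _ _ (p.-1 %/ 3)%N Lb)) (LF _ _ lz).
  rewrite -[E wb]/(sg ^+ 3)%g -[D wb]/(gg ^+ 3)%g in h.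
  by rewrite -[E (wz p)]/(sg ^+ p.-1)%g -[D (wz p)]/(gg ^+ p.-1)%g !gsplit in h.
split=> //.
- elim=> [_|[i ii] |e1' IH1 e2' IH2|e IH m] /=; first exact: L1.
  + case: i ii => [|[|[]]] //= ii _.
    exact: LF la.
  + by case/andP=> /IH1 h1 /IH2 h2; exact: LM.
  by move=> /IH h; case: m => m; apply: LX => //; exact: LV.
by move=> i j; case: (lifts_c i j).
Qed.

End AltLift.

Lemma sym_lift : exists tau, is_sym_lift tau.
Proof. by have [F FP] := alt_lift_exists; exact: sym_lift_exists FP. Qed.

Lemma h_trivial : D (wh p r) = 1%g.
Proof.
have [F FP] := alt_lift_exists.
exact: h_eq1 FP.
Qed.

Hypotheses (kE : kpar n p = k) (nk : odd n = odd k).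

(** * The symmetric group on $1,\ldots,k$ is centralised by [gy] *)

Section SymLift.

Variable tau : {perm O} -> G.
Hypothesis tauP : is_sym_lift tau.

Let tauM u v : perm_on posO u -> perm_on posO v -> tau (u * v)%g = (tau u * tau v)%g.
Proof. by case: tauP => h _ _; exact: h. Qed.

Let tauE e : yfree e -> tau (E e) = D e.
Proof. by case: tauP => _ h _ /h[]. Qed.

Let tau_on e : yfree e -> perm_on posO (E e).
Proof. by case: tauP => _ h _ /h[]. Qed.

Let tau1 : tau 1%g = 1%g.
Proof. by apply: (mulgI (tau 1%g)); rewrite mulg1 -tauM ?mul1g ?perm_on1. Qed.

Let tauV u : perm_on posO u -> tau u^-1%g = (tau u)^-1%g.
Proof. by move=> uX; apply: (mulgI (tau u)); rewrite -tauM ?perm_onV // !mulgV tau1. Qed.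

Let tauJ u v : perm_on posO u -> perm_on posO v -> tau (u ^ v)%g = (tau u ^ tau v)%g.
Proof. by move=> uX vX; rewrite !conjgE !tauM ?perm_onM ?perm_onV ?tauV. Qed.

Lemma pt_case (Q : O -> Prop) : (forall z, inO z -> Q (pt z)) -> forall x : O, Q x.
Proof. by move=> h x; rewrite -(ptK kp x); apply: h; exact: valO. Qed.

Definition midO : {set O} := [set x | (1 <= val x) && (val x <= K)].

Lemma mid_pos u : perm_on midO u -> perm_on posO u.
Proof.
move=> uB; apply: subset_trans uB _; apply/subsetP => x; rewrite !inE.
by case/andP.
Qed.

Let fixed (u : {perm O}) : Prop := perm_on posO u /\ (tau u ^ gy = tau u)%g.

Let fixed1 : fixed 1%g.
Proof. by split; [exact: perm_on1 | rewrite tau1 conj1g]. Qed.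

Let fixedM u v : fixed u -> fixed v -> fixed (u * v)%g.
Proof.
by case=> uX ug [vX vg]; split; [exact: perm_onM | rewrite tauM // conjMg ug vg].
Qed.

Lemma yfree_c i j : yfree (wcij p i j).
Proof. by rewrite /wcij; do 3?case: ifP => _. Qed.

Lemma yfree_wc : yfree (wc n p).
Proof. by rewrite /wc; case: ifP => _; rewrite /= !yfree_c. Qed.

Let fixed_c : fixed (E (wc n p)).
Proof. by split; rewrite ?tauE ?yfree_wc // ?tau_on ?yfree_wc // -rel5. Qed.

Let fixed_a : fixed (cyc3 (pt 3) (pt 1) (pt 2)).
Proof.
rewrite -Ewatil; split; first exact: tau_on.
by rewrite tauE // [RHS]rel4 h_trivial mulg1.
Qed.

Lemma odd_wc : odd_perm (E (wc n p)).
Proof.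
case: tauP => _ _ ev_c.
rewrite /wc; case: ifP => _; rewrite evM odd_permM (negPf (ev_c _ _)) Et odd_tperm al_be //.
Qed.

Lemma pt_neq (x y : int) : inO x -> inO y -> x != y -> pt x != pt y.
Proof. by move=> hx hy; rewrite pt_eq. Qed.

(** For odd $n$ the cycle $(2,\ldots,k)$ fixes $1$, and [alt_chain] applies to it and $(3,1,2)$ at
    once. For even $n$ the cycle $(1,\ldots,k)$ leaves no point of $1,\ldots,k$ free to serve as
    pivot, and has to be shortened first. *)
Lemma fixed_alt u : perm_on midO u -> ~~ odd_perm u -> fixed u.
Proof.
have ac : acts_as (E (wc n p)) (rotz (if odd n then 2 else 1) K 1) by exact: acts_wc kE nk.
have acX (m : nat) : (m%:Z <= K - (if odd n then 2 else 1) + 1) ->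
    acts_as (E (wc n p) ^+ m)%g (rotz (if odd n then 2 else 1) K m%:Z).
  by move=> hm; apply: (acts_as_rotX kp _ _ _ _ ac); case: (odd n) hm => hm; slia.
have aX (e : {perm O}) (m : nat) : acts_as e (rotz 3 K 1) -> m%:Z <= K - 2 ->
    acts_as (e ^+ m)%g (rotz 3 K m%:Z).
  by move=> ae hm; apply: (acts_as_rotX kp _ _ _ _ ae); slia.
have [on|on] := boolP (odd n).
  rewrite on in ac acX.
  have h := alt_chain fixed1 fixedM (e := E (wc n p)) (q := pt 1) (x := pt 2) fixed_c.
  move=> uB ue; apply: h ue.
  - by rewrite (acts_as_pt _ ac); [congr omega_pt; spw|slia].
  - by apply: pt_neq; slia.
  - rewrite (acts_as_pt _ ac); last slia.
    by have -> : rotz 2 K 1 2 = 3 by spw.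
  apply: subset_trans uB _; apply/subsetP; apply: pt_case => z hz; rewrite !inE val_pt // => hx.
  have [->|z1] := eqVneq z 1; first by rewrite eqxx.
  apply/orP; right; apply/porbitP; exists `|(z - 2)%R|%N.
  rewrite (acts_as_pt _ (acX _ _)); try slia.
  by congr omega_pt; spw.
rewrite (negPf on) in ac acX.
(* [e] is the cycle $(3,\ldots,k)$, which fixes $2$; with $(4,2,3)$, the conjugate of [w] by $c$, it
   gives the alternating group on $2,\ldots,k$, and the point $1$ is adjoined last. *)
pose w := cyc3 (pt 3) (pt 1) (pt 2); pose e := (E (wc n p) * w^-1)%g.
have fe : fixed e by apply: fixedM fixed_c _; exact: perm_expV fixed1 fixedM _ fixed_a.
have wV : acts_as w^-1%g (c3f 1 3 2).
  by apply: (acts_asV kp (acts_as_cyc3 kp _ _ _ _ _ _)); try slia; move=> x hx; spw.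
have ae : acts_as e (rotz 3 K 1).
  by apply: acts_as_eq (acts_asM ac wV) _ => x hx /=; spw.
have c423 : fixed (cyc3 (pt 4) (pt 2) (pt 3)).
  have := submonoidJ fixed1 fixedM fixed_a fixed_c.
  rewrite cyc3J !(acts_as_pt _ ac); try slia.
  have -> : rotz 1 K 1 3 = 4 by spw.
  have -> : rotz 1 K 1 1 = 2 by spw.
  by have -> : rotz 1 K 1 2 = 3 by spw.
have H : forall v, perm_on (pt 2 |: porbit e (pt 3)) v -> ~~ odd_perm v -> fixed v.
  apply: (alt_chain fixed1 fixedM fe).
  - by rewrite (acts_as_pt _ ae); [congr omega_pt; spw|slia].
  - by apply: pt_neq; slia.
  rewrite (acts_as_pt _ ae); last slia.
  by have -> : rotz 3 K 1 3 = 4 by spw.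
have f123 : fixed (cyc3 (pt 1) (pt 2) (pt 3)).
  by rewrite -(@cyc3_rot _ (pt 3)) //; apply: pt_neq; slia.
move=> uB; apply: (alt_add fixed1 fixedM _ _ _ H f123).
- by apply: pt_neq; slia.
- by rewrite !inE eqxx.
- by rewrite !inE porbit_id orbT.
apply: subset_trans uB _; apply/subsetP; apply: pt_case => z hz; rewrite !inE val_pt // => hx.
have [->|z1] := eqVneq z 1; first by rewrite eqxx.
have [->|z2] := eqVneq z 2; first by rewrite eqxx orbT.
apply/orP; right; apply/orP; right; apply/porbitP; exists `|(z - 3)%R|%N.
rewrite (acts_as_pt _ (aX _ _ ae _)); try slia.
by congr omega_pt; spw.
Qed.

(** The image of $c$ is an odd permutation of $1,\ldots,k$ fixed under $y$, so it extends
    [fixed_alt] to both parities. *)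
Lemma fixed_mid u : perm_on midO u -> (tau u ^ gy = tau u)%g.
Proof.
move=> uB; suff [] : fixed u by [].
have [uo|uo] := boolP (odd_perm u); last exact: fixed_alt.
have cB : perm_on midO (E (wc n p)).
  apply/subsetP; apply: pt_case => z hz; rewrite !inE val_pt //; apply: contraR => hx.
  by rewrite (acts_as_pt _ (acts_wc kE nk)) //; apply/eqP; congr omega_pt; case: (odd n); spw.
rewrite -[u](mulgVK (E (wc n p))); apply: fixedM fixed_c.
apply: fixed_alt; first by apply: perm_onM => //; exact: perm_onV.
by rewrite odd_permM odd_permV uo odd_wc.
Qed.

Let tauX u (m : nat) : perm_on posO u -> tau (u ^+ m)%g = (tau u ^+ m)%g.
Proof.
move=> uX; suff [] : perm_on posO (u ^+ m)%g /\ tau (u ^+ m)%g = (tau u ^+ m)%g by [].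
elim: m => [|m [IH1 IH2]]; first by rewrite !expg0 perm_on1.
by split; [rewrite expgS; exact: perm_onM uX IH1 | rewrite !expgS (tauM uX IH1) IH2].
Qed.

Let mid u : perm_on midO u -> (tau u ^ gy = tau u)%g := @fixed_mid u.

Lemma perm_onJ (A : {set O}) u v : perm_on A u -> perm_on A v -> perm_on A (u ^ v)%g.
Proof. by move=> uA vA; rewrite conjgE !perm_onM ?perm_onV. Qed.

(** * Commutation of lifts with conjugates under [gy] *)

Let com (u v : {perm O}) : Prop := commute (tau u) (tau v ^ gy)%g.

(** An element on $1,\ldots,k$ has the same lift before and after conjugation by [gy], so it acts
    compatibly on both entries. This is the only way to produce new commuting pairs from the single
    pair $(d,e)$. *)
Let comJ u v w : perm_on posO u -> perm_on posO v -> perm_on midO w ->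
  com u v -> com (u ^ w)%g (v ^ w)%g.
Proof.
move=> uX vX wB uv; have wX := mid_pos wB.
by rewrite /com !tauJ // conjJg (mid wB) /commute -!conjMg uv.
Qed.

Let comPl v u : Prop := perm_on posO u /\ com u v.
Let comPr u v : Prop := perm_on posO v /\ com u v.

Let comPl1 v : comPl v 1%g.
Proof. by split; [exact: perm_on1 | rewrite /com tau1; apply/commute_sym/commute1]. Qed.

Let comPlM v u1 u2 : comPl v u1 -> comPl v u2 -> comPl v (u1 * u2)%g.
Proof.
case=> u1X c1 [u2X c2]; split; first exact: perm_onM.
by rewrite /com tauM //; apply/commute_sym/commuteM; apply/commute_sym.
Qed.

Let comPr1 u : comPr u 1%g.
Proof. by split; [exact: perm_on1 | rewrite /com tau1 conj1g; exact: commute1]. Qed.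

Let comPrM u v1 v2 : comPr u v1 -> comPr u v2 -> comPr u (v1 * v2)%g.
Proof.
case=> v1X c1 [v2X c2]; split; first exact: perm_onM.
by rewrite /com tauM // conjMg; apply: commuteM.
Qed.

Lemma yfree_we : yfree (we n p).
Proof. by rewrite /we; case: ifP => _; rewrite /= !yfree_c. Qed.

Let com_de : com (E (wd p)) (E (we n p)).
Proof. by rewrite /com !tauE ?yfree_we ?yfree_c //; exact: rel6. Qed.

Let acts_e : acts_as (E (we n p)) (efun (k := k) (p := p) n).
Proof. exact: acts_we. Qed.

Lemma tperm_on_set (A : {set O}) (x y : O) : x \in A -> y \in A -> perm_on A (tperm x y).
Proof.
move=> xA yA; apply: subset_trans (tperm_on _ _) _.
by apply/subsetP => w; rewrite !inE => /orP[] /eqP ->.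
Qed.

(** The transposition $w=(4,5)$ fixes $e$, because $k \ge 6$, but not $d$. Hence $d$ and $d^w$ both
    commute with $e^y$, and $d\,(d^w)^{-1}$ is the 3-cycle $(4,p+2,5)$; its conjugate by $d$ starts
    [alt_chain] along the cycle $d$ with pivot $4$. *)
Let com_alt_e u : perm_on [set x : O | 4 <= val x] u -> ~~ odd_perm u -> com u (E (we n p)).
Proof.
set d := E (wd p); set e := E (we n p).
have dX : perm_on posO d by apply: tau_on; exact: yfree_c.
have eX : perm_on posO e by apply: tau_on; exact: yfree_we.
have ad : acts_as d (rotz 5 (P + 2) 1) by exact: acts_wd.
pose w := tperm (pt 4) (pt 5).
have wB : perm_on midO w by apply: tperm_on_set; rewrite inE val_pt; slia.
have aw : acts_as w (swap 4 5) by apply: acts_as_tperm; slia.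
have ew : (e ^ w = e)%g.
  rewrite conjgE (acts_as_commute acts_e aw) ?mulKg // => x hx.
  by rewrite /efun /swap; case: (odd n); ssplit; try (by left); try (by right); slia.
have Pd : comPl e d by [].
have Pdw : comPl e (d ^ w)%g.
  split; first exact: perm_onJ dX (mid_pos wB).
  by rewrite -ew; exact: comJ dX eX wB com_de.
have adw : acts_as (d ^ w)%g (swap 4 5 \o rotz 5 (P + 2) 1 \o swap 4 5).
  by apply: acts_as_conj ad aw _ => x hx; spw.
have Pc : comPl e (cyc3 (pt 4) (pt (P + 2)) (pt 5)).
  have -> : cyc3 (pt 4) (pt (P + 2)) (pt 5) = (d * (d ^ w)^-1)%g.
    apply: (mulIg (d ^ w)%g); rewrite mulgVK.
    have ac : acts_as (cyc3 (pt 4) (pt (P + 2)) (pt 5)) (c3f 4 (P + 2) 5) by apply: acts_as_cyc3; slia.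
    by apply: acts_as_uniq _ ad; apply: acts_as_eq (acts_asM ac adw) _ => x hx /=; spw.
  exact: comPlM Pd (perm_expV (comPl1 e) (@comPlM e) Pdw).
have Pc2 : comPl e (cyc3 (d (pt 5)) (pt 4) (pt 5)).
  have := submonoidJ (comPl1 e) (@comPlM e) Pc Pd.
  have d4 : d (pt 4) = pt 4 by rewrite (acts_as_pt _ ad); [congr omega_pt; spw|slia].
  have d5 : d (pt 5) = pt 6 by rewrite (acts_as_pt _ ad); [congr omega_pt; spw|slia].
  have dp : d (pt (P + 2)) = pt 5 by rewrite (acts_as_pt _ ad); [congr omega_pt; spw|slia].
  rewrite cyc3J d4 d5 dp [cyc3 (pt 6) _ _]cyc3_rot //; apply: pt_neq; slia.
have H := alt_chain (comPl1 e) (@comPlM e) Pd _ _ Pc2.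
move=> uS ue; suff [] : comPl e u by [].
apply: H ue.
- by rewrite (acts_as_pt _ ad); [congr omega_pt; spw|slia].
- by apply: pt_neq; slia.
apply: subset_trans uS _; apply/subsetP; apply: pt_case => z hz; rewrite !inE val_pt // => hx.
have [->|z4] := eqVneq z 4; first by rewrite eqxx.
apply/orP; right; apply/porbitP; exists `|(z - 5)%R|%N.
have adX : acts_as (d ^+ `|(z - 5)%R|%N)%g (rotz 5 (P + 2) `|(z - 5)%R|%N).
  by apply: (acts_as_rotX kp _ _ _ _ ad); slia.
by rewrite (acts_as_pt _ adX); [congr omega_pt; spw|slia].
Qed.

Let outE : {set O} := [set x | (val x == 1) || (val x == 3) || (K + 1 <= val x)].

(** The same device on the other side: $w=(1,3)$ fixes [u] but not $e$, and $e\,(e^w)^{-1}$ is the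
    3-cycle $(1,3,p+2)$. The chain then runs along the cycle $e$ with pivot $3$. *)
Let com_alt_alt u v : perm_on [set x : O | 4 <= val x] u -> ~~ odd_perm u ->
  perm_on outE v -> ~~ odd_perm v -> com u v.
Proof.
set e := E (we n p) => uS ue.
have uX : perm_on posO u.
  by apply: subset_trans uS _; apply/subsetP; apply: pt_case => z hz; rewrite !inE val_pt //; lia.
have eX : perm_on posO e by apply: tau_on; exact: yfree_we.
pose w := tperm (pt 1) (pt 3).
have wB : perm_on midO w by apply: tperm_on_set; rewrite inE val_pt; slia.
have aw : acts_as w (swap 1 3) by apply: acts_as_tperm; slia.
have uw : (u ^ w = u)%g.
  rewrite conjgE (_ : u * w = w * u)%g ?mulKg //.
  apply: perm_disjoint_commute; apply: pt_case => z hz.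
  have [z4|z4] := boolP (4 <= z); last by left; apply: (out_perm uS); rewrite inE val_pt.
  by right; rewrite (acts_as_pt _ aw) //; congr omega_pt; spw.
have Pe : comPr u e by split=> //; exact: com_alt_e.
have Pew : comPr u (e ^ w)%g.
  split; first exact: perm_onJ eX (mid_pos wB).
  by rewrite -uw; apply: comJ uX eX wB _; exact: com_alt_e.
have aew : acts_as (e ^ w)%g (swap 1 3 \o efun (k := k) (p := p) n \o swap 1 3).
  by apply: acts_as_conj acts_e aw _ => x hx; spw.
have Pc : comPr u (cyc3 (pt 1) (pt 3) (pt (P + 2))).
  have -> : cyc3 (pt 1) (pt 3) (pt (P + 2)) = (e * (e ^ w)^-1)%g.
    apply: (mulIg (e ^ w)%g); rewrite mulgVK.
    have ac : acts_as (cyc3 (pt 1) (pt 3) (pt (P + 2))) (c3f 1 3 (P + 2)) by apply: acts_as_cyc3; slia.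
    apply: acts_as_uniq _ acts_e; apply: acts_as_eq (acts_asM ac aew) _ => x hx /=.
    by rewrite /efun; case: (odd n); spw.
  exact: comPrM Pe (perm_expV (comPr1 u) (@comPrM u) Pew).
have e3 : e (pt 3) = pt 3.
  by rewrite (acts_as_pt _ acts_e); [congr omega_pt; rewrite /efun; ssplit; slia|slia].
have ep : e (pt (P + 2)) = pt 1.
  by rewrite (acts_as_pt _ acts_e); [congr omega_pt; rewrite /efun; ssplit; slia|slia].
have Pc2 : comPr u (cyc3 (e (pt 1)) (pt 3) (pt 1)).
  by have := submonoidJ (comPr1 u) (@comPrM u) Pc Pe; rewrite cyc3J e3 ep.
have n31 : pt 3 != pt 1 by apply: pt_neq; slia.
have H := alt_chain (comPr1 u) (@comPrM u) Pe e3 n31 Pc2.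
move=> vS ve; suff [] : comPr u v by [].
apply: H ve; apply: subset_trans vS _; apply/subsetP; apply: pt_case => z hz.
rewrite !inE val_pt // => /orP[/orP[/eqP ->|/eqP ->]|hx].
- by rewrite porbit_id orbT.
- by rewrite eqxx.
apply/orP; right; apply/porbitP.
(* For odd $n$ the cycle $e$ visits $2$ between $1$ and $k+1$, hence one more step. *)
have [i ei] : exists i : nat, (e ^+ i)%g (pt 1) = pt (K + 1).
  have [on|on] := boolP (odd n); [exists 2%N | exists 1%N].
    rewrite expg2 permM (acts_as_pt _ acts_e) ?(acts_as_pt _ acts_e); try slia.
      by congr omega_pt; rewrite /efun on; ssplit; slia.
    by rewrite /efun on; ssplit; slia.
  rewrite expg1 (acts_as_pt _ acts_e); last slia.
  by congr omega_pt; rewrite /efun (negPf on); ssplit; slia.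
have step (m : nat) : K + 1 + m%:Z <= P + 2 -> (e ^+ (i + m))%g (pt 1) = pt (K + 1 + m%:Z).
  elim: m => [|m IH] hm; first by rewrite addn0 addr0.
  rewrite addnS expgSr permM IH; last lia.
  rewrite (acts_as_pt _ acts_e); last slia.
  by congr omega_pt; rewrite /efun; case: (odd n); ssplit; slia.
exists (i + `|(z - K - 1)%R|)%N; rewrite step; last slia.
by congr omega_pt; slia.
Qed.

(** Transpositions are odd, so each is first paired with one inside $1,\ldots,k$: $(4,i)$ with
    $(5,6)$ and $(1,j)$ with $(1,3)$. The auxiliary transpositions are unchanged by [gy], so their
    commutation takes place within the image of [tau] and they can be cancelled; $k \ge 6$ provides
    the room. *)
Lemma com_tperm i j : K + 1 <= i -> i <= P + 2 -> K + 1 <= j -> j <= P + 2 ->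
  com (tperm (pt 4) (pt i)) (tperm (pt 1) (pt j)).
Proof.
move=> i1 i2 j1 j2.
have n4i : pt 4 != pt i by apply: pt_neq; slia.
have n1j : pt 1 != pt j by apply: pt_neq; slia.
have n13 : pt 1 != pt 3 by apply: pt_neq; slia.
have n56 : pt 5 != pt 6 by apply: pt_neq; slia.
have tX x y : 1 <= x -> x <= P + 2 -> 1 <= y -> y <= P + 2 -> perm_on posO (tperm (pt x) (pt y)).
  by move=> *; apply: tperm_on_set; rewrite inE val_pt; slia.
have comm x y z w : inO x -> inO y -> inO z -> inO w -> x != z -> x != w -> y != z -> y != w ->
    commute (tperm (pt x) (pt y)) (tperm (pt z) (pt w)).
  move=> hx hy hz hw xz xw yz yw; apply: perm_disjoint_commute => v.
  rewrite !permE /=; have [->|vx] := eqVneq v (pt x); first by right; rewrite !pt_eq // (negPf xz) (negPf xw).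
  have [->|vy] := eqVneq v (pt y); first by right; rewrite !pt_eq // (negPf yz) (negPf yw).
  by left.
have t56 : perm_on midO (tperm (pt 5) (pt 6)) by apply: tperm_on_set; rewrite inE val_pt; slia.
have t13 : perm_on midO (tperm (pt 1) (pt 3)) by apply: tperm_on_set; rewrite inE val_pt; slia.
have tau_comm u v : perm_on posO u -> perm_on posO v -> commute u v -> commute (tau u) (tau v).
  by move=> uX vX uv; rewrite /commute -!tauM // uv.
have c1 : comPr (tperm (pt 4) (pt i)) (tperm (pt 1) (pt j) * tperm (pt 1) (pt 3))%g.
  have vX : perm_on posO (tperm (pt 1) (pt j) * tperm (pt 1) (pt 3))%g.
    by apply: perm_onM; apply: tX; slia.
  split=> //; rewrite -[tperm (pt 4) (pt i)](mulgK (tperm (pt 5) (pt 6))) tpermV.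
  set v := (_ * _)%g in vX *.
  suff [] : comPl v (tperm (pt 4) (pt i) * tperm (pt 5) (pt 6) * tperm (pt 5) (pt 6))%g by [].
  apply: comPlM; first split.
  - by apply: perm_onM; apply: tX; slia.
  - apply: com_alt_alt.
    + by apply: perm_onM; apply: tperm_on_set; rewrite inE val_pt; slia.
    + by rewrite odd_permM !odd_tperm n4i n56.
    + by apply: perm_onM; apply: tperm_on_set; rewrite inE val_pt; slia.
    by rewrite /v odd_permM !odd_tperm n1j n13.
  split; first exact: mid_pos.
  rewrite /com -(mid t56) /commute -!conjMg; congr (_ ^ _)%g.
  apply: tau_comm => //; first exact: mid_pos.
  by apply: commuteM; apply: comm; slia.
have c2 : comPr (tperm (pt 4) (pt i)) (tperm (pt 1) (pt 3)).
  split; first exact: mid_pos.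
  rewrite /com (mid t13); apply: tau_comm; [by apply: tX; slia | exact: mid_pos |].
  by apply: comm; slia.
by have [] := comPrM c1 c2; rewrite -mulgA tperm2 mulg1.
Qed.

(** * Carmichael generators for the whole of [Omega] *)

Local Notation p1 := (pt 1).
Local Notation p4 := (pt 4).

Let c (u : O) : {perm O} := cyc3 u p1 p4.

Let x (u : O) : G := if u \in posO then tau (c u) else (tau (c (sy u)) ^ gy)%g.
Let t : G := tau (tperm p1 p4).

Lemma pt_pos z : inO z -> (pt z \in posO) = (1 <= z).
Proof. by move=> hz; rewrite inE val_pt. Qed.

Lemma pt_mid z : inO z -> (pt z \in midO) = (1 <= z) && (z <= K).
Proof. by move=> hz; rewrite inE val_pt. Qed.

Let p1X : p1 \in posO. Proof. by rewrite pt_pos; slia. Qed.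
Let p4X : p4 \in posO. Proof. by rewrite pt_pos; slia. Qed.
Let p1B : p1 \in midO. Proof. by rewrite pt_mid; slia. Qed.
Let p4B : p4 \in midO. Proof. by rewrite pt_mid; slia. Qed.
Let p14 : p1 != p4. Proof. by apply: pt_neq; slia. Qed.

Let c_on u : u \in posO -> perm_on posO (c u).
Proof. by move=> uX; exact: cyc3_on. Qed.

Let c_mid u : u \in midO -> perm_on midO (c u).
Proof. by move=> uX; exact: cyc3_on uX p1B p4B. Qed.

Let t_mid : perm_on midO (tperm p1 p4). Proof. exact: tperm_on_set p1B p4B. Qed.

Lemma sy_pt z : inO z -> sy (pt z) = pt (flip k p z).
Proof. by move=> hz; rewrite (acts_as_pt _ sy_acts). Qed.

Lemma syK u : sy (sy u) = u.
Proof.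
move: u; apply: pt_case => z hz; have [h1 h2] := @flip_inO k p kpS z hz.
by rewrite !sy_pt // h2.
Qed.

Lemma sy_mid u : u \in midO -> sy u = u.
Proof.
move: u; apply: pt_case => z hz; rewrite pt_mid // => hz'.
by rewrite sy_pt //; congr omega_pt; rewrite /flip; ssplit; slia.
Qed.

Lemma sy_neg u : u \notin posO -> [/\ sy u \in posO & sy u \notin midO].
Proof.
move: u; apply: pt_case => z hz; rewrite pt_pos // => hz'.
have [h1 h2] := @flip_inO k p kpS z hz.
by rewrite sy_pt // pt_pos // pt_mid //; rewrite /flip; split; ssplit; slia.
Qed.

Lemma sy_pos_neg u : u \in posO -> u \notin midO -> sy u \notin posO.
Proof.
move: u; apply: pt_case => z hz; rewrite pt_pos // pt_mid // => hz1 hz2.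
have [h1 h2] := @flip_inO k p kpS z hz.
by rewrite sy_pt // pt_pos //; rewrite /flip; ssplit; slia.
Qed.

Let sy1 : sy p1 = p1. Proof. exact: sy_mid. Qed.
Let sy4 : sy p4 = p4. Proof. exact: sy_mid. Qed.

(** A point of $1,\ldots,k$ can be read on either side of [gy]. This is why the two branches of [x]
    fit together. *)
Let x_sy u : u \in posO -> x (sy u) = (tau (c u) ^ gy)%g.
Proof.
move=> uX; have [uB|uB] := boolP (u \in midO); rewrite /x.
  by rewrite sy_mid // uX mid // c_mid.
by rewrite (negPf (sy_pos_neg uX uB)) syK.
Qed.

Let x_neg u : u \notin posO -> x u = (tau (c (sy u)) ^ gy)%g.
Proof. by rewrite /x => /negPf ->. Qed.

Let sy_ne u v : sy v = v -> u != v -> sy u != v.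
Proof. by move=> sv uv; rewrite -sv (inj_eq perm_inj). Qed.

Let x3 (u : O) : u \in [set: O] -> u != p1 -> u != p4 -> (x u ^+ 3 = 1)%g.
Proof.
move=> _ u1 u4; have H v : v \in posO -> v != p1 -> v != p4 -> (tau (c v) ^+ 3 = 1)%g.
  by move=> vX v1 v4; rewrite -tauX ?c_on // cyc3_expg3.
rewrite /x; case: ifPn => uX; first exact: H.
have [sX _] := sy_neg uX.
by rewrite -conjXg H ?conj1g //; exact: sy_ne.
Qed.

Let x2_pos u v : u \in posO -> u != p1 -> u != p4 -> v \in posO -> v != p1 -> v != p4 ->
  u != v -> ((tau (c u) * tau (c v)) ^+ 2 = 1)%g.
Proof.
by move=> uX u1 u4 vX v1 v4 uv; rewrite -tauM ?c_on // -tauX ?perm_onM ?c_on // cyc3M_expg2.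
Qed.

(** Write $(u,1,4)=(4,u)(1,4)$ and $(v,1,4)=(1,4)(1,v)$. The factor $(1,4)$ is unchanged by [gy] and
    cancels in the middle, leaving the commuting involutions of [com_tperm]. *)
Let x2_mix u v : u \in posO -> u \notin midO -> v \in posO -> v \notin midO ->
  ((tau (c u) * tau (c v) ^ gy) ^+ 2 = 1)%g.
Proof.
move=> uX uB vX vB.
have nB w : w \notin midO -> w != p1 /\ w != p4.
  by move=> wB; split; apply: contraNneq wB => ->.
have [u1 u4] := nB _ uB; have [v1 v4] := nB _ vB.
have t4X w : w \in posO -> perm_on posO (tperm p4 w) by move=> wX; exact: tperm_on_set.
have t1X w : w \in posO -> perm_on posO (tperm p1 w) by move=> wX; exact: tperm_on_set.
have tX := mid_pos t_mid.
rewrite /c (cyc3_tperm u1 u4 p14).1 (cyc3_tperm v1 v4 p14).2 !tauM ?t4X ?t1X //.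
have tt : (tau (tperm p1 p4) * tau (tperm p1 p4) = 1)%g by rewrite -tauM // tperm2 tau1.
rewrite conjMg (mid t_mid) -mulgA (mulgA (tau (tperm p1 p4))) tt mul1g.
have cm : commute (tau (tperm p4 u)) (tau (tperm p1 v) ^ gy)%g.
  move: u v uX uB vX vB {u1 u4 v1 v4}; apply: pt_case => i hi; apply: pt_case => j hj.
  rewrite !pt_pos // !pt_mid // => h1 h2 h3 h4.
  by apply: com_tperm; slia.
rewrite expgMn // -conjXg -!tauX ?t4X ?t1X // !expg2 !tperm2 tau1 conj1g mulg1 //.
Qed.

(** If one of two points of opposite sign lies in $1,\ldots,k$, both generators are conjugates by
    [gy] and the relation is inherited from [tau]; otherwise it is [x2_mix]. *)
Let x2 (u v : O) : u \in [set: O] -> u != p1 -> u != p4 -> v \in [set: O] -> v != p1 -> v != p4 ->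
  u != v -> ((x u * x v) ^+ 2 = 1)%g.
Proof.
move=> _ u1 u4 _ v1 v4 uv.
have sne w : w != p1 -> w != p4 -> sy w != p1 /\ sy w != p4.
  by move=> w1 w4; split; exact: sy_ne.
have both a b : a \in posO -> a != p1 -> a != p4 -> b \in posO -> b != p1 -> b != p4 -> a != b ->
    ((tau (c a) ^ gy * tau (c b) ^ gy) ^+ 2 = 1)%g.
  by move=> *; rewrite -conjMg -conjXg x2_pos ?conj1g.
have suv : sy u != sy v by rewrite (inj_eq perm_inj).
have [su1 su4] := sne _ u1 u4; have [sv1 sv4] := sne _ v1 v4.
have [uX|uX] := boolP (u \in posO); have [vX|vX] := boolP (v \in posO).
- by rewrite /x uX vX x2_pos.
- have [svX svB] := sy_neg vX; rewrite (x_neg vX).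
  have [uB|uB] := boolP (u \in midO).
    have -> : x u = (tau (c u) ^ gy)%g by rewrite -(x_sy uX) (sy_mid uB).
    by apply: both => //; rewrite -(sy_mid uB).
  by rewrite /x uX x2_mix.
- have [suX suB] := sy_neg uX; rewrite (x_neg uX); apply: expg2_mulgC.
  have [vB|vB] := boolP (v \in midO).
    have -> : x v = (tau (c v) ^ gy)%g by rewrite -(x_sy vX) (sy_mid vB).
    by apply: both => //; rewrite -(sy_mid vB) eq_sym.
  by rewrite /x vX x2_mix.
have [suX suB] := sy_neg uX; have [svX svB] := sy_neg vX.
by rewrite !x_neg // both.
Qed.

Let t2 : (t ^+ 2 = 1)%g.
Proof. by rewrite /t -tauX ?(mid_pos t_mid) // expg2 tperm2 tau1. Qed.

Let xt (u : O) : u \in [set: O] -> u != p1 -> u != p4 -> (x u ^ t = (x u)^-1)%g.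
Proof.
move=> _ u1 u4; have H v : v \in posO -> v != p1 -> v != p4 -> (tau (c v) ^ t = (tau (c v))^-1)%g.
  move=> vX v1 v4; rewrite -tauJ ?c_on ?(mid_pos t_mid) // -tauV ?c_on //; congr tau.
  by rewrite cyc3J tpermL tpermR tpermD 1?eq_sym // /c /cyc3 -!lock invgM !tpermV.
rewrite /x; case: ifPn => uX; first exact: H.
have [sX _] := sy_neg uX; have tg : (t ^ gy = t)%g by exact: mid t_mid.
by rewrite -conjVg -H; [rewrite [RHS]conjJg tg | exact: sX | exact: sy_ne | exact: sy_ne].
Qed.

(** The last property stands in for the value of [theta] at the image of $y$, which is not yet
    known. It is proved on Carmichael's generators, where it is [x_sy]. *)
Lemma full_lift : exists theta : {perm O} -> G,
  [/\ {morph theta : u v / (u * v)%g}, forall u, perm_on posO u -> theta u = tau u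
    & forall u, perm_on posO u -> theta (u ^ sy)%g = (tau u ^ gy)%g].
Proof.
have [th [thx tht thM]] := carmichael_sym p14 (in_setT p1) (in_setT p4) x3 x2 t2 xt.
have onT u : perm_on [set: O] u by apply/subsetP.
exists th; split=> [u v|u uX|u uX]; first exact: thM.
  suff [] : perm_on posO u /\ th u = tau u by [].
  move: u uX; apply: (sym_ind p14 p1X p4X) => [|u i iX i1 i4 [uX eu]|u [uX eu]].
  - split; first exact: perm_on1.
    by rewrite tau1; apply: (mulgI (th 1%g)); rewrite mulg1 -thM ?mul1g.
  - split; first exact: perm_onM uX (c_on iX).
    by rewrite thM // tauM ?c_on // thx ?inE // /x iX eu.
  split; first exact: perm_onM uX (mid_pos t_mid).
  by rewrite thM // tauM ?(mid_pos t_mid) // tht eu.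
suff [] : perm_on posO u /\ th (u ^ sy)%g = (tau u ^ gy)%g by [].
move: u uX; apply: (sym_ind p14 p1X p4X) => [|u i iX i1 i4 [uX eu]|u [uX eu]].
- split; first exact: perm_on1.
  by rewrite conj1g tau1 conj1g; apply: (mulgI (th 1%g)); rewrite mulg1 -thM ?mul1g.
- split; first exact: perm_onM uX (c_on iX).
  rewrite conjMg thM // tauM ?c_on // conjMg eu; congr (_ * _)%g.
  rewrite cyc3J sy1 sy4 thx ?inE // ?x_sy //.
    exact: sy_ne sy1 i1.
  exact: sy_ne sy4 i4.
split; first exact: perm_onM uX (mid_pos t_mid).
rewrite conjMg thM // tauM ?(mid_pos t_mid) // conjMg eu (mid t_mid).
by rewrite tpermJ sy1 sy4 tht.
Qed.

End SymLift.

(** Every occurrence of $y$ in $w$ is inside a conjugation $e^y$ with $e$ free of $y$, once a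
    conjugation by a product is split into successive ones. So [full_lift] evaluates [theta] on $w$
    in every case of its definition, and the image of $w$ is that of $y$. *)
Theorem presentation_retraction : exists theta : {perm O} -> G,
  [/\ {morph theta : u v / (u * v)%g}, theta sa = ga, theta sg = gg & theta sy = gy].
Proof.
have [tau tauP] : exists tau : {perm O} -> G, is_sym_lift tau.
  by exact: sym_lift.
have [th [thM th1 thy]] := full_lift tauP.
have [_ tE _] := tauP.
exists th; have free e : yfree e -> th (E e) = D e.
  by move=> ye; have [ex et] := tE e ye; rewrite th1.
have freey e : yfree e -> th (E e ^ sy)%g = (D e ^ gy)%g.
  by move=> ye; have [ex et] := tE e ye; rewrite thy // et.
have thV := morph_grpV thM; have thX := morph_grpX thM.
have thJ u v : th (u ^ v)%g = (th u ^ th v)%g by rewrite !conjgE !thM thV.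
split=> //; [exact: (free wa) | exact: (free wg) |].
pose L e := th (E e) = D e.
have LM e1 e2 : L e1 -> L e2 -> L (EMul e1 e2) by rewrite /L !evM thM => -> ->.
have LJ e1 e2 : L e1 -> L e2 -> L (econj e1 e2) by rewrite /L !evJ thJ => -> ->.
have LX e m : L e -> L (EPow e m).
  by rewrite /L /= => h; case: m => m /=; rewrite thX ?thV h.
have Ly e : yfree e -> L (econj e wy) by move=> ye; rewrite /L !evJ; exact: freey.
have LMJ (e f1 f2 : expr 'I_3) : L (econj (econj e f1) f2) -> L (econj e (EMul f1 f2)).
  by rewrite /L !evJ !evM !conjgM.
have wE : E (ww n p) = sy by exact: Eww.
suff Lw : L (ww n p) by rewrite -{1}wE [RHS]rel7; exact: Lw.
rewrite /ww kE.
have yt : yfree (wt p) by rewrite /= !yfree_c.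
have yz : yfree (wz p) by [].
have yd i j : yfree (wdij p i j) by [].
have Lxt : L (wxtil n p).
  by rewrite /wxtil; apply: (LJ); [exact: free | apply: (LM); exact: Ly].
have Lu : L (wu p) by apply: (LM); [exact: free | exact: Ly].
case: ifP => _; first by apply: (LMJ); apply: (LJ); [exact: Ly | exact: free].
case: ifP => _.
  by apply: (LM); apply: (LMJ); apply: (LJ); first [exact: Ly | exact: free].
case: ifP => _.
  have Lz e : yfree e -> L (econj (wz p) (EMul (EMul (EMul wa wy) (EPow wa (-1))) e)).
    move=> ye; apply: (LMJ); apply: (LJ); last exact: free.
    apply: (LMJ); apply: (LJ); last exact: free.
    by apply: (LMJ); exact: Ly.
  apply: (LM); first by apply: (LM); exact: Lz.
  by apply: (LMJ); apply: (LJ); [apply: (Ly); rewrite /= !yfree_c | exact: free].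
case: ifP => _; last first.
  apply: (LM); last exact: LX.
  apply: (LM) => //; apply: (LM); last by apply: (LX); apply: (LM) => //; exact: LX.
  apply: (LMJ); apply: (LJ); last exact: free.
  by apply: (LMJ); apply: (Ly); rewrite /= !yfree_c.
by apply: (LM); [apply: (LM) => //; apply: (LX); apply: (LM) => //; exact: LX | exact: LX].
Qed.

End Retraction.

(** * The isomorphism *)

Section CycleForms.

Context {k p : nat} {kpS : setting k p}.
Local Notation P := (p%:Z).
Local Notation K := (k%:Z).
Local Notation lo := (- P + K - 1).
Local Notation inO x := ((lo <= x) && (x <= P + 2)).
Implicit Types x : int.

Lemma cycles_half x : cycles [seq [:: i; P - i] | i <- irange 1 p.-1./2] x =
  if (1 <= x) && (x <= P - 1) then P - x else x.
Proof.
rewrite cycles_swaps ?irange_uniq //; last by move=> i j; rewrite !mem_irange; slia.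
by rewrite !mem_irange; ssplit; slia.
Qed.

Lemma cycles_flip x : inO x ->
  cycles [seq [:: i; K + 1 - i] | i <- irange (- P - 1 + K) 0] x = flip k p x.
Proof.
move=> hx; rewrite cycles_swaps ?irange_uniq //; last by move=> i j; rewrite !mem_irange; slia.
by rewrite !mem_irange /flip; ssplit; slia.
Qed.

Lemma next_efun n x : next ((if odd n then [:: 1; 2] else [:: 1]) ++ irange (K + 1) (P + 2)) x
  = efun (k := k) (p := p) n x.
Proof.
have sz : size (irange (K + 1) (P + 2)) = (p + 2 - k)%N by rewrite size_irange; slia.
have nth_r i : (i < p + 2 - k)%N -> nth 0 (irange (K + 1) (P + 2)) i = K + 1 + i%:Z.
  by move=> hi; rewrite nth_irange //; slia.
move: x; case: (boolP (odd n)) => on; rewrite /efun ?on ?(negPf on); apply: next_spec.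
- by rewrite /= irange_uniq ?inE !mem_irange; slia.
- move=> [|[|i]] //=; rewrite sz => hi; rewrite ?nth_r; try slia; ssplit; slia.
- move=> _ /=; rewrite sz; case E: (p + 2 - k)%N => [|i] /=; first by slia.
  by rewrite nth_r; [ssplit; slia | lia].
- by move=> x; rewrite /= ?inE mem_irange; ssplit; slia.
- by rewrite /= irange_uniq ?inE !mem_irange; slia.
- move=> [|i] //=; rewrite sz => hi; rewrite ?nth_r; try slia; ssplit; slia.
- move=> _ /=; rewrite sz; case E: (p + 2 - k)%N => [|i] /=; first by slia.
  by rewrite nth_r; [ssplit; slia | lia].
by move=> x; rewrite /= ?inE mem_irange; ssplit; slia.
Qed.

Lemma next_ufun x : next (irange 1 K ++ rev (irange lo 0)) x =
  if (1 <= x) && (x <= K - 1) then x + 1 else if x == K then 0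
  else if (lo + 1 <= x) && (x <= 0) then x - 1 else if x == lo then 1 else x.
Proof.
pose f x := if (1 <= x) && (x <= K - 1) then x + 1 else if x == K then 0
  else if (lo + 1 <= x) && (x <= 0) then x - 1 else if x == lo then 1 else x.
rewrite -/(f x); move: x.
have sz1 : size (irange 1 K) = k by rewrite size_irange; slia.
have sz2 : size (irange lo 0) = (p + 2 - k)%N by rewrite size_irange; slia.
have nthE i : (i < p + 2)%N ->
    nth 0 (irange 1 K ++ rev (irange lo 0)) i = if (i < k)%N then 1 + i%:Z else K - i%:Z.
  move=> hi; rewrite nth_cat sz1; case: ifP => hk; first by rewrite nth_irange; slia.
  by rewrite nth_rev sz2 ?nth_irange; slia.
have sz : size (irange 1 K ++ rev (irange lo 0)) = (p + 2)%N by rewrite size_cat size_rev sz1 sz2; slia.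
apply: next_spec => [|i|_|x]; rewrite ?sz.
- rewrite cat_uniq rev_uniq !irange_uniq andbT; apply/hasPn => x.
  by rewrite mem_rev !mem_irange; slia.
- by move=> hi; rewrite !nthE /f; try slia; ssplit; slia.
- by rewrite !nthE /f; try slia; ssplit; slia.
by rewrite mem_cat mem_rev !mem_irange /f => h; ssplit; slia.
Qed.

Lemma cycles_ufun x : (k + 2 <= p)%N -> inO x ->
  cycles [:: irange 1 (P + 2); irange 1 K ++ rev (irange (- P - 1 + K) 0)] x =
  ufun (k := k) (p := p) x.
Proof.
move=> kp2 hx; rewrite cycles2 next_irange.
have -> : - P - 1 + K = lo by lia.
by rewrite next_ufun /ufun; spw.
Qed.

End CycleForms.

Lemma pelt_nth (X : choiceType) (R : seq (expr X)) (i : nat) :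
  (i < size R)%N -> pelt R (nth EOne R i) = 1%g.
Proof.
move=> hi; apply/eqP/pclassP; rewrite -(nth_map EOne [::]) //.
have := @weq_relator _ R [::] [::] (nth [::] [seq word_of e | e <- R] i).
by rewrite /= cats0; apply; apply: mem_nth; rewrite size_map.
Qed.

Lemma generates_unitsP (p : nat) (r : int) : prime p -> generates_units p r ->
  (forall i j : nat,
     ((r%:~R : 'F_p) ^+ i == r%:~R ^+ j) = (i == j %[mod p.-1])%N) /\
  forall f : 'F_p, f != 0 -> exists2 i : nat, (i < p.-1)%N & f = r%:~R ^+ i.
Proof.
move=> p_pr [u <- ugen].
have ou : #[u]%g = p.-1.
  by rewrite orderE -(eqP ugen) card_finField_unit card_Fp.
split=> [i j|f f0].
  by rewrite -!FinRing.val_unitX (inj_eq val_inj) eq_expg_mod_order ou.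
have fU : f \is a GRing.unit by rewrite unitfE.
have : FinRing.unit 'F_p fU \in <[u]>%g by rewrite -(eqP ugen) inE.
case/cyclePmin=> i; rewrite ou => hi fE; exists i => //.
by rewrite -FinRing.val_unitX -fE.
Qed.

Section Isomorphism.

Context {k p : nat} {kpS : setting k p}.
Local Notation P := (p%:Z).
Local Notation O := (Omega k p).
Local Notation pt := (omega_pt (@kp k p kpS)).
Local Notation al := (pt (P + 1)).
Local Notation be := (pt (P + 2)).
Implicit Types (x i j : int) (f : 'F_p).

Context {r s : int} {alpha : 'F_p} {sa sg sy : {perm O}}.
Context {GS : gen_setting r s alpha sa sg sy}.

Local Notation E e := (ev (gens sa sg sy) e).

Local Notation p1 := (pt 1).
Local Notation p4 := (pt 4).

Lemma ev_onto_pos (u : {perm O}) : perm_on posO u -> exists e, E e = u.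
Proof.
have aX : al \in posO by rewrite pt_pos; slia.
have bX : be \in posO by rewrite pt_pos; slia.
have ab : al != be by exact: al_be.
move: u; apply: (sym_ind ab aX bX) => [|u i|u [e <-]].
- by exists EOne.
- move=> iX ia ib [e <-]; move: i iX ia ib; apply: pt_case => z hz.
  rewrite pt_pos // !pt_eq //; try slia.
  move=> h1 h2 h3; exists (EMul e (wzi p z)).
  by rewrite evM Ezi_int //; slia.
by exists (EMul e (wt p)); rewrite evM Et.
Qed.

(** The cycles $(i,1,4)$ with $i \le 0$ are conjugates by $y$ of cycles on positive points, since
    $y$ fixes $1$ and $4$. *)
Lemma ev_onto (u : {perm O}) : exists e, E e = u.
Proof.
have p14 : p1 != p4 by rewrite pt_eq; slia.
have sy1 : sy p1 = p1 by rewrite sy_pt /flip; [congr omega_pt; spw | slia].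
have sy4 : sy p4 = p4 by rewrite sy_pt /flip; [congr omega_pt; spw | slia].
have X1 : p1 \in posO by rewrite pt_pos; slia.
have X4 : p4 \in posO by rewrite pt_pos; slia.
have onc (i : O) : i \in posO -> i != p1 -> i != p4 -> exists e, E e = cyc3 i p1 p4.
  by move=> iX i1 i4; apply: ev_onto_pos; exact: cyc3_on.
have : perm_on [set: O] u by apply/subsetP.
move: u; apply: (sym_ind p14 (in_setT _) (in_setT _)) => [|u i _ i1 i4 [e <-]|u [e <-]].
- by exists EOne.
- have [iX|iX] := boolP (i \in posO).
    by have [f fE] := onc i iX i1 i4; exists (EMul e f); rewrite evM fE.
  have [sX _] := sy_neg iX.
  have sne (q : O) : sy q = q -> i != q -> sy i != q by move=> sq; rewrite -{2}sq (inj_eq perm_inj).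
  have [f fE] := onc _ sX (sne _ sy1 i1) (sne _ sy4 i4).
  exists (EMul e (econj f wy)); rewrite evM evJ fE -[E wy]/sy cyc3J sy1 sy4.
  by rewrite syK.
have [f fE] : exists e, E e = tperm p1 p4 by apply: ev_onto_pos; exact: tperm_on_set.
by exists (EMul e f); rewrite evM fE.
Qed.

Section Presentation.

Variable n : nat.
Hypotheses (kE : kpar n p = k) (nk : odd n = odd k).

Local Notation R := (relators n p r s).
Local Notation ga := (pelt R wa).
Local Notation gg := (pelt R wg).
Local Notation gy := (pelt R wy).
Local Notation D e := (ev (gens ga gg gy) e).

Lemma ev_pelt e : D e = pelt R e.
Proof.
rewrite [RHS]pelt_ev; congr (ev _ e).
apply: boolp.funext => -[[|[|[|i]]] hi] //; rewrite /gens /=; congr (pelt R (EGen _)); exact: val_inj.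
Qed.

Lemma pelt_erel (i : nat) (e f : expr _) : (i < 7)%N -> nth EOne R i = erel e f -> D e = D f.
Proof.
move=> /(@pelt_nth _ R) + ef; rewrite {}ef -ev_pelt evM evV => h.
by apply: (mulIg (D f)^-1%g); rewrite h mulgV.
Qed.

Lemma presented_satisfies : satisfies_relators n p r s ga gg gy.
Proof.
split.
- exact: (pelt_erel (i := 0) isT erefl).
- have := pelt_erel (i := 1) isT erefl; rewrite evJ; exact.
- have -> : (D (wz p) ^ ga = D (econj (wz p) wa))%g by rewrite evJ.
  by have := pelt_nth (R := R) (i := 2) isT; rewrite -ev_pelt; exact.
- have := pelt_erel (i := 3) isT erefl; rewrite evJ evM; exact.
- have := pelt_erel (i := 4) isT erefl; rewrite evJ; exact.
- have -> : (D (we n p) ^ gy = D (econj (we n p) wy))%g by rewrite evJ.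
  have := pelt_nth (R := R) (i := 5) isT; rewrite -ev_pelt.
  rewrite -[X in X = _ -> _]/((D (wd p))^-1 *
    (D (econj (we n p) wy))^-1 * D (wd p) * D (econj (we n p) wy))%g.
  rewrite -invgM -mulgA => h; rewrite /commute.
  by apply: (mulgI (D (econj (we n p) wy) * D (wd p))^-1%g); rewrite h mulVg.
exact: (pelt_erel (i := 6) isT erefl).
Qed.

(** [theta] undoes evaluation on every expression. Each class of words is that of an expression,
    which makes [theta] a left inverse, and by [ev_onto] it is a right inverse as well. *)
Lemma presentation_iso : exists phi : {multiplicative presented R -> {perm O}},
  bijective phi /\ forall e, phi (pelt R e) = E e.
Proof.
have fR : {in [seq word_of e | e <- R], forall w, evw (gens sa sg sy) w = 1%g}.
  exact: gens_relators.
pose f := presented_lift (R := R) (gens sa sg sy).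
pose phi : {multiplicative presented R -> {perm O}} :=
  HB.pack f (isMultiplicative.Build _ _ f (presented_liftM fR)).
have phiE e : phi (pelt R e) = E e by rewrite ev_word; exact: presented_liftE.
exists phi; split=> //.
have RS := presented_satisfies.
have [theta [thM tha thg thy]] : exists theta : {perm O} -> presented R,
    [/\ {morph theta : u v / (u * v)%g}, theta sa = ga, theta sg = gg & theta sy = gy].
  by exact: presentation_retraction.
have thE e : theta (E e) = pelt R e.
  rewrite -ev_pelt -ev_morph //; congr (ev _ e).
  by apply: boolp.funext => -[[|[|[|?]]] ?] //=; rewrite /gens /= ?tha ?thg ?thy.
exists theta => [g|u]; last by have [e <-] := ev_onto u; rewrite thE phiE.
rewrite -(pclass_repr g); move: (prepr g) => w.
have [e <-] : exists e, pelt R e = pclass R w.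
  elim: w => [|[x b] w [e ew]]; first by exists EOne.
  exists (EMul (if b then EPow (EGen x) (-1) else EGen x) e).
  by rewrite -[_ :: w]/([:: _] ++ w) -pmulE -ew pmulE /pelt /=; case: (b).
by rewrite phiE thE.
Qed.

End Presentation.

End Isomorphism.

(** * Existence of the generating permutations and of [alpha] *)

Section Generators.

Context {k p : nat} {kpS : setting k p}.
Local Notation P := (p%:Z).
Local Notation O := (Omega k p).

Lemma generators_exist (r s : int) (alpha : 'F_p) : generates_units p r ->
    (s * (r - 1) = -1 %[mod p])%Z -> alpha != 0 -> alpha ^+ 3 = r%:~R ->
  exists sa sg sy : {perm O}, gen_setting r s alpha sa sg sy.
Proof.
move=> rgen rs a0 a3; have [rho_o rho_g] := generates_unitsP p_pr rgen.
have [sa saP] : exists sa : {perm O}, acts_as sa (rotz 1 P 1).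
  by apply: (acts_as_exists kp) => [x hx|x y hx hy]; spw.
have [sy syP] : exists sy : {perm O}, acts_as sy (flip k p).
  by apply: (acts_as_exists kp) => [x hx|x y hx hy]; rewrite /flip; ssplit; slia.
have [ca cP] : exists ca : {perm O}, acts_as ca (c3f P (P + 1) (P + 2)).
  by apply: (acts_as_exists kp) => [x hx|x y hx hy]; spw.
exists sa, (mulP alpha * ca)%g, sy; split=> //; last exact: acts_asM (acts_mulP a0) cP.
have /dvdzP[q qE] : (P %| s * (r - 1) - - 1)%Z by rewrite -eqz_mod_dvd; apply/eqP.
rewrite -[1](mulr1z 1) -intrB -intrM -intrN.
by have -> : s * (r - 1) = - 1 + q * P; [lia | rewrite intrD intrM Fp_P // mulr0 addr0].
Qed.

Lemma cube_root_exists (r : int) : generates_units p r ->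
  exists alpha : 'F_p, alpha != 0 /\ alpha ^+ 3 = r%:~R.
Proof.
move=> rgen; have [rho_o rho_g] := generates_unitsP p_pr rgen.
have [q qE] : exists q, p = (12 * q + 11)%N by exists (p %/ 12)%N; slia.
(* The exponent is the inverse of $3$ modulo $p-1=12q+10$, as $3(8q+7)=2(p-1)+1$. *)
exists (r%:~R ^+ (8 * q + 7)); split.
  by rewrite expf_neq0 //; have [u <- _] := rgen; rewrite -unitfE (valP u).
rewrite -exprM -[RHS]expr1; apply/eqP; rewrite rho_o.
by have -> : ((8 * q + 7) * 3 = 2 * p.-1 + 1)%N; [lia | rewrite modnMDl].
Qed.

End Generators.

(** * The images in cycle notation *)

Section CycleImages.

Context {k p : nat} {kpS : setting k p}.
Local Notation P := (p%:Z).
Local Notation K := (k%:Z).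
Local Notation O := (Omega k p).
Context {r s : int} {alpha : 'F_p} {sa sg sy : {perm O}}.
Context {GS : gen_setting r s alpha sa sg sy}.
Local Notation E e := (ev (gens sa sg sy) e).
Local Notation maps e f := (acts_as (E e) f).
Local Notation half := [seq [:: i; P - i] | i <- irange 1 p.-1./2].

Lemma images_gens : [/\ maps wa (cycles [:: irange 1 P]),
  maps wg (fun x => cycles [:: [:: P; P + 1; P + 2]] (mulF alpha x)) &
  maps wy (cycles [seq [:: i; K + 1 - i] | i <- irange (- P - 1 + K) 0])].
Proof.
split.
- by apply: (acts_as_eq sa_acts) => x _; rewrite cycles_irange1.
- by apply: (acts_as_eq sg_acts).
by apply: (acts_as_eq sy_acts) => x hx; rewrite cycles_flip.
Qed.

Lemma images_z : [/\ maps wb (mulF (r%:~R : 'F_p)),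
  maps (wz p) (cycles [:: [:: P; P + 1; P + 2]]),
  maps (wh p r) id,
  (forall i : int, 1 <= i <= P -> maps (wzi p i) (cycles [:: [:: i; P + 1; P + 2]])) &
  (forall i j : int, 1 <= i <= P -> 1 <= j <= P -> i != j ->
     maps (wdij p i j) (cycles [:: [:: i; j]; [:: P + 1; P + 2]]))].
Proof.
split.
- by rewrite Eb; apply: acts_mulP; exact: rho0.
- exact: acts_z.
- by rewrite Eh; exact: acts_as1.
- by move=> i hi; rewrite Ezi_int //; apply: acts_as_cyc3; slia.
by move=> i j hi hj ij; rewrite Edij_int //; exact: acts_tt.
Qed.

Lemma images_c : [/\ maps (wx p) (cycles [:: [:: 1; P]; [:: P + 1; P + 2]]),
  (forall i j : int, wcij_defined p i j ->
     maps (wcij p i j) (cycles (irange i j :: nseq `|j - i|%N [:: P + 1; P + 2]))),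
  maps (wb2 p) (cycles half),
  maps (wcbul p) (cycles [:: irange 1 p.-1./2; rev (irange p.+1./2 (P - 1))]) &
  maps (wv p) (cycles (rcons half [:: P + 1; P + 2]))].
Proof.
split.
- exact: acts_x.
- by move=> i j ij; apply: (acts_as_eq (acts_c ij)) => x _; rewrite cycles_irange_nseq.
- by apply: (acts_as_eq acts_b2) => x _; rewrite cycles_half.
- apply: (acts_as_eq acts_cbul) => x _; rewrite cycles2 next_irange next_rev_irange.
  by spw.
apply: (acts_as_eq acts_v) => x _; rewrite cycles_rcons cycles_half.
by rewrite -[next _ _]/(swap (P + 1) (P + 2) _); spw.
Qed.

Variable n : nat.
Hypotheses (kE : kpar n p = k) (nk : odd n = odd k).

Lemma images_t : [/\ maps (wt p) (cycles [:: [:: P + 1; P + 2]]),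
  maps (watil p) (cycles [:: [:: 1; 2; 3]]),
  maps (wc n p) (cycles [:: if odd n then irange 2 K else irange 1 K]),
  maps (wd p) (cycles [:: irange 5 (P + 2)]) &
  maps (we n p)
    (cycles [:: (if odd n then [:: 1; 2] else [:: 1]) ++ irange (K + 1) (P + 2)])].
Proof.
split.
- exact: acts_t.
- rewrite Ewatil; apply: acts_as_eq (acts_as_cyc3 _ _ _ _ _ _ _) _; try slia.
  by move=> x _; rewrite -[cycles _ _]/(c3f 1 2 3 x); spw.
- apply: (acts_as_eq (acts_wc kE nk)) => x _.
  by case: ifP => _; rewrite cycles_irange1.
- by apply: (acts_as_eq acts_wd) => x _; rewrite cycles_irange1.
by apply: (acts_as_eq (acts_we kE nk)) => x _; rewrite -next_efun.
Qed.

Lemma images_u : (k + 2 <= p)%N ->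
  maps (wxtil n p) (cycles [:: [:: -1; K + 2]; [:: 0; K + 1]]) /\
  maps (wu p) (cycles [:: irange 1 (P + 2); irange 1 K ++ rev (irange (- P - 1 + K) 0)]).
Proof.
move=> kp2; split; last by apply: (acts_as_eq (acts_u kp2)) => x hx; rewrite cycles_ufun.
apply: (acts_as_eq (acts_xtil kE kp2)) => x _.
by rewrite -[cycles _ _]/(swap 0 (K + 1) (swap (-1) (K + 2) x)) /pairswap; spw.
Qed.

End CycleImages.

Local Close Scope ring_scope.

Theorem theorem66 :
  exists C : nat, forall (n p : nat) (r s : int),
    [|| 14 <= n <= 20, 26 <= n <= 44 | 50 <= n] ->
    prime p -> p = 11 %[mod 12] -> n + 2 <= 2 * p -> p <= n - 3 ->
    (`|r| < p)%N -> (`|s| < p)%N ->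
    generates_units p r ->
    (s * (r - 1) = -1 %[mod p])%Z ->
    let k := kpar n p in
    let P := (p%:Z)%R in
    let K := (k%:Z)%R in
    let R := relators n p r s in
    [/\ 6 <= k <= p + 1, n = k %[mod 2], #|Omega k p| = n,
        size R = 7 & bitlength R <= C * trunc_log 2 n] /\
    (exists alpha : 'F_p, alpha != 0%R /\ (alpha ^+ 3 = r%:~R)%R) /\
    forall alpha : 'F_p, alpha != 0%R -> (alpha ^+ 3 = r%:~R)%R ->
    exists phi : {multiplicative presented R -> {perm Omega k p}},
    let maps (e : expr 'I_3) (f : int -> int) := acts_as (phi (pelt R e)) f in
    let half := [seq [:: i; P - i]%R | i <- irange 1 p.-1./2] in
    [/\ bijective phi,
        maps wa (cycles [:: irange 1 P]),
        maps wg (fun x => cycles [:: [:: P; P + 1; P + 2]%R] (mulF alpha x)) &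
        maps wy (cycles [seq [:: i; K + 1 - i]%R | i <- irange (- P - 1 + K)%R 0])] /\
    [/\ maps wb (mulF (r%:~R : 'F_p)%R),
        maps (wz p) (cycles [:: [:: P; P + 1; P + 2]%R]),
        maps (wh p r) id,
        (forall i : int, (1 <= i <= P)%R ->
           maps (wzi p i) (cycles [:: [:: i; P + 1; P + 2]%R])) &
        (forall i j : int, (1 <= i <= P)%R -> (1 <= j <= P)%R -> i != j ->
           maps (wdij p i j) (cycles [:: [:: i; j]; [:: P + 1; P + 2]%R]))] /\
    [/\ maps (wx p) (cycles [:: [:: 1; P]%R; [:: P + 1; P + 2]%R]),
        (forall i j : int, wcij_defined p i j ->
           maps (wcij p i j)
             (cycles (irange i j :: nseq `|j - i|%N [:: P + 1; P + 2]%R))),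
        maps (wb2 p) (cycles half),
        maps (wcbul p)
          (cycles [:: irange 1 p.-1./2; rev (irange p.+1./2 (P - 1)%R)]) &
        maps (wv p) (cycles (rcons half [:: P + 1; P + 2]%R))] /\
    [/\ maps (wt p) (cycles [:: [:: P + 1; P + 2]%R]),
        maps (watil p) (cycles [:: [:: 1; 2; 3]%R]),
        maps (wc n p) (cycles [:: if odd n then irange 2 K else irange 1 K]),
        maps (wd p) (cycles [:: irange 5 (P + 2)%R]) &
        maps (we n p)
          (cycles [:: (if odd n then [:: 1; 2]%R else [:: 1]%R)
                        ++ irange (K + 1)%R (P + 2)%R])] /\
    (k <= p - 2 ->
       maps (wxtil n p) (cycles [:: [:: -1; K + 2]%R; [:: 0; K + 1]%R]) /\
       maps (wu p)
         (cycles [:: irange 1 (P + 2)%R;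
                     irange 1 K ++ rev (irange (- P - 1 + K)%R 0)])) /\
    phi (pelt R (ww n p)) = phi (pelt R wy).
Proof.
exists 3410 => n p r s hn p_pr p11 np pn hr hs rgen rs k P K R.
(* $6 \le k$ is the bound $n+2 \le 2p$, and $k \le p+1$ is $p \le n-3$. *)
have kpS : setting k p by split=> //; rewrite /k /kpar; lia.
have kE : kpar n p = k by [].
have nk : odd n = odd k by rewrite /k /kpar; lia.
split; last split; first split=> //.
- by rewrite /k /kpar; lia.
- by rewrite !modn2 nk.
- by rewrite card_Omega // /k /kpar; lia.
- by apply: bitlength_relators; lia.
- exact: cube_root_exists.
move=> alpha a0 a3.
have [sa [sg [sy GS]]] := generators_exist rgen rs a0 a3.
have [phi [phi_bij phiE]] := presentation_iso (GS := GS) kE nk.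
exists phi => maps half.
have mapsE e f : acts_as (ev (gens sa sg sy) e) f -> maps e f by rewrite /maps phiE.
have [ma mg my] := @images_gens k p kpS _ _ _ _ _ _ GS.
have [mb mz mh mzi md] := @images_z k p kpS _ _ _ _ _ _ GS.
have [mx mc mb2 mcb mv] := @images_c k p kpS _ _ _ _ _ _ GS.
have [mt mat mwc mwd mwe] := @images_t k p kpS _ _ _ _ _ _ GS n kE nk.
split; first by split=> //; exact: mapsE.
split; first by split; try exact: mapsE; move=> *; apply: mapsE; [exact: mzi | exact: md].
split; first by split; try exact: mapsE; move=> *; apply: mapsE; exact: mc.
split; first by split; exact: mapsE.
split; last by rewrite !phiE Eww.
move=> kp2; have kp2' : k + 2 <= p by lia.
have [mxt mu] := @images_u k p kpS _ _ _ _ _ _ GS n kE nk kp2'.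
by split; exact: mapsE.
Qed.
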